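(* Let $f$ be an admissible representation with parameter $a>0$ (and real coefficients $c_{nk}$). Let $D\subset\mathbb C$ be a simply connected domain having an analytic cusp at $0$ with the boundary analytic arcs $[0,\epsilon]\subset\mathbb R$, $\epsilon>0$, and $\Gamma=\Gamma[-\epsilon,0]$, where $\Gamma$ is given by the admissible representation $f$. Let $g:\mathbb H\to D$ be a conformal map (of $\mathbb H$ onto $D$) with $g(0)=0$. Then $$\lim_{z\to0,\ \operatorname{Im} z>0}\; g(z)\left(-\frac{2\pi}{a\log|z|}\right)^{-1}=1 .$$
   Context: $\mathbb H=\{z\in\mathbb C:\operatorname{Im} z>0\}$. For $z\ne0$ in the closure of $\mathbb H$, $\log z$ is the continuous branch with $\log i=i\pi/2$; thus $\log x=\log|x|$ for $x>0$ and $\log x=\log|x|+i\pi$ for $x<0$. Admissible representation: a representation $$f(z)=\frac{-2\pi}{a\log z}\left(1+\sum_{n=1}^{\infty}\sum_{k=0}^{\infty}\frac{c_{nk}z^k}{\log^n z}\right),$$ with $a>0$ and real coefficients $c_{nk}$ ($n\ge1$, $k\ge0$), for $z\neq 0$ near $0$ with $\operatorname{Im} z\ge0$, is called admissible if: (i) the set $\{\sqrt[k]{|c_{nk}|}: n\ge1,\ k\ge1\}$ is bounded; (ii) the quantities $\sqrt[n]{\left|\sum_{k=0}^\infty c_{nk}z^k\right|}$ are bounded uniformly over $n\ge1$ and over $z$ with $\operatorname{Im} z\ge0$ and $|z|$ small enough (i.e. there are $r,M>0$ such that they are at most $M$ for all $n\ge1$ and all $z$ with $|z|<r$, $\operatorname{Im}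 z\ge0$); (iii) the quantities $\sqrt[n]{\left|\sum_{k=1}^\infty k c_{nk}z^{k-1}\right|}$ are bounded uniformly in the same sense; (iv) $c_{10}\ne0$. The curve given by the admissible representation $f$ is $\Gamma[-\epsilon,0]=\{f(x):x\in[-\epsilon,0)\}\cup\{0\}$, for $\epsilon>0$ small enough that $f$ is defined there (note $f(x)\to0$ as $x\to0$). Analytic cusp: a domain $D\subset\mathbb C$ with $0\in\partial D$ has an analytic cusp at $0$ if $\partial D$ at $0$ (i.e. in a neighborhood of $0$) consists of two regular analytic curves (here the two named arcs) such that the interior angle of $D$ at $0$ vanishes. The condition $g(0)=0$ is understood in terms of boundary values: $g(z)\to0$ as $z\to0$, $z\in\mathbb H$. *)

(* Defs.v *)
(* Stdlib reals with Coquelicot's complex numbers. *)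
From Stdlib Require Export Reals.
From Coquelicot Require Export Coquelicot.
Open Scope R_scope.

Definition upper_half_plane (z : C) : Prop := 0 < Im z.

(* The principal argument is acos (Re z / |z|) throughout Im z >= 0, z <> 0, so
   this is the continuous branch there with value i*PI/2 at i; meaningless
   elsewhere. *)
Definition clog (z : C) : C := (ln (Cmod z), acos (Re z / Cmod z)).

Lemma clog_Ci : clog Ci = (0, PI / 2).
Proof.
unfold clog; rewrite Cmod_Ci, ln_1; simpl.
now unfold Rdiv at 1; rewrite Rmult_0_l, acos_0.
Qed.

Lemma clog_pos (x : R) : 0 < x -> clog (RtoC x) = (ln x, 0).
Proof.
intros hx; unfold clog; rewrite Cmod_R, Rabs_pos_eq by now apply Rlt_le.
simpl; unfold Rdiv; rewrite Rinv_r by now apply Rgt_not_eq.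
now rewrite acos_1.
Qed.

Lemma clog_neg (x : R) : x < 0 -> clog (RtoC x) = (ln (Rabs x), PI).
Proof.
intros hx; unfold clog; rewrite Cmod_R, (Rabs_left x) by assumption; simpl.
replace (x / - x) with (- (1)) by (field; now apply Rlt_not_eq).
now rewrite acos_opp, acos_1, Rminus_0_r.
Qed.

(* n-th root of x >= 0, for n >= 1; [Rpower 0 _] is 1, hence the case split. *)
Definition nroot (n : nat) (x : R) : R :=
  if Req_EM_T x 0 then 0 else Rpower x (/ INR n).

(* Value of a convergent complex series. *)
Definition CSeries (u : nat -> C) : C :=
  (Series (fun n => Re (u n)), Series (fun n => Im (u n))).

(* In what follows [c n k] is c_{nk}; the entries [c 0 k] are never used, and
   sums over n >= 1 are indexed by m with n = S m. *)
Definition coef_term (c : nat -> nat -> R) (n : nat) (z : C) (k : nat) : C :=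
  (RtoC (c n k) * z ^ k)%C.

(* The k-th term is (k+1) c_{n,k+1} z^k. *)
Definition dcoef_term (c : nat -> nat -> R) (n : nat) (z : C) (k : nat) : C :=
  (RtoC (INR (S k) * c n (S k)) * z ^ k)%C.

Definition rep_term (c : nat -> nat -> R) (z : C) (m : nat) : C :=
  (CSeries (coef_term c (S m) z) / clog z ^ S m)%C.

Definition rep (a : R) (c : nat -> nat -> R) (z : C) : C :=
  (RtoC (- 2 * PI) / (RtoC a * clog z) * (1 + CSeries (rep_term c z)))%C.

Definition rep_defined (c : nat -> nat -> R) (z : C) : Prop :=
  z <> RtoC 0 /\ 0 <= Im z /\ clog z <> RtoC 0 /\
  (forall n, (1 <= n)%nat -> ex_series (V := C_NormedModule) (coef_term c n z)) /\
  ex_series (V := C_NormedModule) (rep_term c z).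

(* u n z k, summed over k, has sum s(n, z) for all n >= 1 and all small z with
   Im z >= 0, and |s(n, z)|^(1/n) is bounded uniformly in n and z. *)
Definition uniformly_root_bounded (u : nat -> C -> nat -> C) : Prop :=
  exists r M : R, 0 < r /\ 0 < M /\
    forall (n : nat) (z : C), (1 <= n)%nat -> Cmod z < r -> 0 <= Im z ->
      exists s : C, is_series (V := C_NormedModule) (u n z) s /\
                    nroot n (Cmod s) <= M.

Record admissible (a : R) (c : nat -> nat -> R) : Prop := {
  adm_pos : 0 < a;
  adm_coef : exists M : R, forall n k : nat, (1 <= n)%nat -> (1 <= k)%nat ->
               nroot k (Rabs (c n k)) <= M;
  adm_sum : uniformly_root_bounded (coef_term c);
  adm_dsum : uniformly_root_bounded (dcoef_term c);
  adm_c10 : c 1%nat 0%nat <> 0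
}.

Definition Gamma (a : R) (c : nat -> nat -> R) (eps : R) (w : C) : Prop :=
  w = RtoC 0 \/ exists x : R, - eps <= x < 0 /\ w = rep a c (RtoC x).

Definition real_segment (x y : R) (w : C) : Prop :=
  exists t : R, x <= t <= y /\ w = RtoC t.

Definition connected (D : C -> Prop) : Prop :=
  forall U V : C -> Prop, open U -> open V ->
    (forall z, D z -> U z \/ V z) ->
    (exists z, D z /\ U z) -> (exists z, D z /\ V z) ->
    exists z, D z /\ U z /\ V z.

Definition domain (D : C -> Prop) : Prop :=
  (exists z, D z) /\ open D /\ connected D.

(* Every loop in D is freely homotopic in D to a constant. Paths and homotopies
   are total functions, of which only the values on [0,1] and [0,1]^2 matter
   (a continuous function on [0,1] or [0,1]^2 always extends). *)
Definition simply_connected (D : C -> Prop) : Prop :=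
  forall p : R -> C,
    (forall t, continuous p t) -> (forall t, 0 <= t <= 1 -> D (p t)) ->
    p 0 = p 1 ->
    exists (h : R * R -> C) (w : C),
      (forall x, continuous h x) /\
      (forall s t, 0 <= s <= 1 -> 0 <= t <= 1 -> D (h (s, t))) /\
      (forall t, 0 <= t <= 1 -> h (0, t) = p t /\ h (1, t) = w) /\
      (forall s, 0 <= s <= 1 -> h (s, 0) = h (s, 1)).

Definition boundary (D : C -> Prop) (z : C) : Prop :=
  ~ locally z D /\ ~ locally z (fun w => ~ D w).

Definition real_analytic_at (p : R -> C) (t : R) : Prop :=
  exists u : nat -> C,
    locally t (fun s =>
      is_pseries (K := R_AbsRing) (V := C_R_NormedModule) u (s - t) (p s)).

(* A is a simple arc with endpoint w0, real analytic and regular up to and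
   including its endpoints. *)
Definition regular_analytic_arc (w0 : C) (A : C -> Prop) : Prop :=
  exists p : R -> C,
    p 0 = w0 /\
    (forall t, 0 <= t <= 1 -> real_analytic_at p t) /\
    (forall t, 0 <= t <= 1 -> exists l : C,
       is_derive (K := R_AbsRing) (V := C_R_NormedModule) p t l /\ l <> RtoC 0) /\
    (forall s t, 0 <= s <= 1 -> 0 <= t <= 1 -> p s = p t -> s = t) /\
    (forall w, A w <-> exists t, 0 <= t <= 1 /\ w = p t).

(* Up to an arbitrarily small angular error, D coincides near w0 with the sector
   at w0 of directions between theta and theta + alpha. For alpha = 0 only the
   outer inclusion carries information. *)
Definition has_interior_angle (D : C -> Prop) (w0 : C) (alpha : R) : Prop :=
  exists theta : R, forall delta : R, 0 < delta ->
    exists r : R, 0 < r /\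
      forall rho t : R, 0 < rho < r ->
        let w := (w0 + RtoC rho * (cos t, sin t))%C in
        (theta + delta < t < theta + alpha - delta -> D w) /\
        (D w -> exists k : Z,
           theta - delta < t + 2 * IZR k * PI < theta + alpha + delta).

Definition analytic_cusp (D A B : C -> Prop) : Prop :=
  boundary D (RtoC 0) /\
  regular_analytic_arc (RtoC 0) A /\ regular_analytic_arc (RtoC 0) B /\
  (exists r : R, 0 < r /\
     forall w, Cmod w < r -> (boundary D w <-> A w \/ B w)) /\
  has_interior_angle D (RtoC 0) 0.

Definition conformal_map (U D : C -> Prop) (g : C -> C) : Prop :=
  (forall z, U z -> ex_derive (K := C_AbsRing) (V := C_NormedModule) g z) /\
  (forall z, U z -> D (g z)) /\
  (forall z w, U z -> U w -> g z = g w -> z = w) /\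
  (forall w, D w -> exists z, U z /\ g z = w).

(* Main.v *)
Require Import Defs.
From Stdlib Require Import Lra Lia Psatz Classical ClassicalChoice ClassicalEpsilon
  FunctionalExtensionality.
Open Scope R_scope.

(** In the coordinate [l = log z] the reciprocal of an admissible representation
    is [- a / (2 pi) * (l - e l)], where [e] is holomorphic, bounded, real on the
    real axis and, by Cauchy's estimate, Lipschitz with constant 1/4 on a left
    half-plane ([log_chart_exists]). Hence [l |-> 1 / f (exp l)] is injective
    there and covers a right half-plane; it maps the line [Im l = 0] into the
    positive axis and the line [Im l = PI] onto the reciprocals of the points of
    [Gamma]. So near 0 the boundary of [D] consists of the images of these two
    lines, and since the interior angle is 0, near 0 the domain [D] is the image
    of the half-strip [0 < Im l < PI], [Re l < - R2] ([cusp_chart]): any other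
    part of [D] near 0 would contain points in many directions.

    Therefore [W x = - 1 / g^-1 (f x)] is a holomorphic map of an upper half-disc
    into the upper half-plane. When [x] tends to a point of the diameter other
    than 0, [f x] tends to a boundary point of [D] other than 0, so [g^-1 (f x)]
    leaves every compact subset of the half-plane, and it stays away from 0
    because [g] tends to 0 at 0; hence [Im W] tends to 0
    ([preimage_near_boundary]). By Schwarz's reflection principle [W] extends to
    the punctured disc. Schwarz's lemma bounds [W x] by a multiple of
    [1 / Im x], and the maximum principle for [(x^2 - t^2) W x] on annuli improves
    this to [1 / |x|], so that [x W x] has a limit [b] at 0 ([half_disc_pole]).
    Since [W] is unbounded near 0, [b] is not 0. Thus if [g z = f x], then
    [x / z] tends to [- b], whence [log |z| = log |x| + O(1)], and [g z] is
    asymptotic to [- 2 pi / (a log x)] and to [- 2 pi / (a log |z|)], whatever the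
    direction in which [z] approaches 0.

    The function theory used is derived here from Goursat's theorem on rectangles
    ([goursat]). In the coordinate [log (z - z0)] an annulus becomes a rectangle,
    which yields the mean value property and Cauchy's formula; finitely many
    horizontal lines on which the function is merely continuous are admitted
    ([goursat_lines]), which covers removable singularities and reflection at
    the same time. *)

(** * Continuity and differentiability of functions of a complex variable *)

(* Views an equation in the carrier of a structure on [C] as an equation in [C]. *)
Ltac as_C :=
  repeat match goal with
  | w : UniformSpace.sort C_UniformSpace |- _ => change C in w
  | w : AbsRing.sort C_AbsRing |- _ => change C in w
  end;
  match goal with |- @eq _ ?x ?y => change (@eq C x y) end.

Lemma Re_le_Cmod (z : C) : Rabs (Re z) <= Cmod z.
Proof. eapply Rle_trans; [apply Rmax_l | apply (Rmax_Cmod z)]. Qed.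

Lemma Im_le_Cmod (z : C) : Rabs (Im z) <= Cmod z.
Proof. eapply Rle_trans; [apply Rmax_r | apply (Rmax_Cmod z)]. Qed.

Lemma Cmod_le_Re_Im (z : C) : Cmod z <= Rabs (Re z) + Rabs (Im z).
Proof.
destruct z as [x y]; simpl; unfold Cmod; simpl.
apply Rsqr_incr_0_var.
- rewrite Rsqr_sqrt by nra. unfold Rsqr.
  pose proof (Rabs_pos x); pose proof (Rabs_pos y).
  pose proof (Rsqr_abs x); pose proof (Rsqr_abs y); unfold Rsqr in *. nra.
- pose proof (Rabs_pos x); pose proof (Rabs_pos y); lra.
Qed.

Lemma Cmod_sqr (z : C) : Cmod z * Cmod z = Re z * Re z + Im z * Im z.
Proof.
destruct z as [x y]; unfold Cmod; simpl. rewrite sqrt_sqrt; [ring | nra].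
Qed.

Lemma Cmod_minus_sym (z w : C) : Cmod (z - w) = Cmod (w - z).
Proof. rewrite <- Cmod_opp. f_equal. ring. Qed.

Lemma Cmod_tri_minus (a b c : C) : Cmod (a - c) <= Cmod (a - b) + Cmod (b - c).
Proof.
replace (a - c)%C with ((a - b) + (b - c))%C by ring. apply Cmod_triangle.
Qed.

Lemma Cmod_minus_ge (a b : C) : Cmod a - Cmod b <= Cmod (a - b).
Proof.
assert (H : Cmod ((a - b) + b) <= Cmod (a - b) + Cmod b) by apply Cmod_triangle.
replace ((a - b) + b)%C with a in H by ring. lra.
Qed.

Lemma re_minus (z w : C) : Re (z - w) = Re z - Re w.
Proof. unfold Cminus. rewrite re_plus, re_opp. reflexivity. Qed.

Lemma im_minus (z w : C) : Im (z - w) = Im z - Im w.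
Proof. unfold Cminus. rewrite im_plus, im_opp. reflexivity. Qed.

Lemma Re_minus_le (z w : C) : Rabs (Re z - Re w) <= Cmod (z - w).
Proof. rewrite <- re_minus. apply Re_le_Cmod. Qed.

Lemma Im_minus_le (z w : C) : Rabs (Im z - Im w) <= Cmod (z - w).
Proof. rewrite <- im_minus. apply Im_le_Cmod. Qed.

Lemma Cmod_minus_le_Re_Im (z w : C) :
  Cmod (z - w) <= Rabs (Re z - Re w) + Rabs (Im z - Im w).
Proof. rewrite <- re_minus, <- im_minus. apply Cmod_le_Re_Im. Qed.

Lemma Cmod_vertical (z w : C) : Re z = Re w -> Cmod (z - w) = Rabs (Im z - Im w).
Proof.
intros H. rewrite <- (Rmult_1_l (Rabs _)), <- Cmod_Ci, <- Cmod_R, <- Cmod_mult.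
f_equal. destruct z as [x y], w as [u v]. simpl in H. subst u.
unfold Ci, RtoC, Cmult, Cminus, Cplus, Copp; simpl. f_equal; ring.
Qed.

Lemma Cmod_minus_self (z : C) : Cmod (z - z) = 0.
Proof. unfold Cminus. now rewrite Cplus_opp_r, Cmod_0. Qed.

Lemma Cminus_0_r (z : C) : (z - 0)%C = z.
Proof. ring. Qed.

Lemma Cmod_plus_real (z : C) (s : R) : 0 <= s -> Cmod (z + RtoC s - z) = s.
Proof.
intros H. replace (z + RtoC s - z)%C with (RtoC s) by ring.
now rewrite Cmod_R, Rabs_pos_eq.
Qed.

Lemma Re_segment (z w : C) (t : R) :
  Re (z + RtoC t * (w - z))%C = (1 - t) * Re z + t * Re w.
Proof. rewrite re_plus, re_scal_l, re_minus. ring. Qed.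

Lemma Im_segment (z w : C) (t : R) :
  Im (z + RtoC t * (w - z))%C = (1 - t) * Im z + t * Im w.
Proof. rewrite im_plus, im_scal_l, im_minus. ring. Qed.

Lemma near_Im (z w : C) : Cmod (w - z) < Im z -> 0 < Im w.
Proof. intros H. pose proof (Im_minus_le w z) as K. apply Rabs_le_between in K. lra. Qed.

Lemma Cmod_small_eq_0 (z : C) (q : R) : (forall eps, 0 < eps -> Cmod z <= q * eps) -> z = 0%C.
Proof.
intros H. apply Cmod_eq_0. pose proof (Cmod_ge_0 z) as P.
destruct (Req_dec (Cmod z) 0) as [E|N]; auto. exfalso.
pose proof (Rabs_pos q). pose proof (Rle_abs q).
specialize (H (Cmod z / (2 * (Rabs q + 1))) ltac:(apply Rdiv_lt_0_compat; lra)).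
set (e := Cmod z / (2 * (Rabs q + 1))) in *.
assert (E : Cmod z = 2 * (Rabs q + 1) * e) by (unfold e; field; lra).
assert (0 < e) by (apply Rdiv_lt_0_compat; lra). nra.
Qed.

Lemma RtoC_eq_0 (x : R) : RtoC x = RtoC 0 -> x = 0.
Proof. intros E. now injection E. Qed.

Lemma Cinv_neq_0 (z : C) : z <> 0%C -> (/ z)%C <> 0%C.
Proof.
intros H E. apply (f_equal (Cmult z)) in E. rewrite Cinv_r, Cmult_0_r in E by auto.
apply RtoC_eq_0 in E. lra.
Qed.

Lemma real_of_Im (z : C) : Im z = 0 -> z = RtoC (Re z).
Proof. destruct z; simpl; intros ->; reflexivity. Qed.

Lemma Cconj_RtoC (x : R) : Cconj (RtoC x) = RtoC x.
Proof. unfold Cconj, RtoC; simpl. now rewrite Ropp_0. Qed.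

Lemma Cmod_annulus (w z : C) : Cmod z - Cmod (w - z) <= Cmod w <= Cmod z + Cmod (w - z).
Proof.
pose proof (Cmod_minus_ge w z). pose proof (Cmod_minus_ge z w) as T.
rewrite (Cmod_minus_sym z w) in T. lra.
Qed.

Lemma locally_C_eps (z : C) (P : C -> Prop) :
  locally z P <-> exists del, 0 < del /\ forall w, Cmod (w - z) < del -> P w.
Proof.
split.
- intros [e He]. exists e; split; [apply cond_pos|]. intros w Hw. apply He.
  now apply C_NormedModule_mixin_compat1.
- intros (d & Hd & H).
  assert (Hs : 0 < sqrt 2) by (apply sqrt_lt_R0; lra).
  exists (mkposreal (d / sqrt 2) (Rdiv_lt_0_compat _ _ Hd Hs)).
  intros w Hw. apply H. apply C_NormedModule_mixin_compat2 in Hw. simpl in Hw.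
  replace (sqrt 2 * (d / sqrt 2)) with d in Hw by (field; lra). exact Hw.
Qed.

Lemma continuous_to_C_eps {T : UniformSpace} (f : T -> C) (x : T) :
  continuous f x <->
  forall eps, 0 < eps -> locally x (fun y => Cmod (f y - f x) < eps).
Proof.
split.
- intros H eps He. apply (H (fun w => Cmod (w - f x) < eps)).
  apply locally_C_eps. exists eps; auto.
- intros H P HP. apply locally_C_eps in HP. destruct HP as (d & Hd & HP).
  specialize (H d Hd). unfold filtermap. revert H. apply filter_imp. auto.
Qed.

Lemma continuous_C_eps (f : C -> C) (z : C) :
  continuous f z <->
  forall eps, 0 < eps -> exists del, 0 < del /\
    forall w, Cmod (w - z) < del -> Cmod (f w - f z) < eps.
Proof.
rewrite continuous_to_C_eps.
split; intros H eps He; [apply locally_C_eps | apply locally_C_eps]; auto.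
Qed.

Lemma continuous_pair_iff {T : UniformSpace} (f : T -> C) (x : T) :
  continuous f x <->
  continuous (fun y => Re (f y)) x /\ continuous (fun y => Im (f y)) x.
Proof.
split.
- intros H. split.
  + apply (continuous_comp f fst); [exact H | apply continuous_fst].
  + apply (continuous_comp f snd); [exact H | apply continuous_snd].
- intros [H1 H2]. apply continuous_to_C_eps. intros eps He.
  assert (He2 : 0 < eps / 2) by lra.
  generalize (proj1 (filterlim_locally _ _) H1 (mkposreal _ He2)).
  generalize (proj1 (filterlim_locally _ _) H2 (mkposreal _ He2)).
  intros A B. generalize (filter_and _ _ A B). apply filter_imp.
  intros y [Ha Hb]. change (Rabs (Im (f y) - Im (f x)) < eps / 2) in Ha.
  change (Rabs (Re (f y) - Re (f x)) < eps / 2) in Hb.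
  eapply Rle_lt_trans; [apply Cmod_minus_le_Re_Im|]. lra.
Qed.

Lemma continuous_R_eps {T : UniformSpace} (u : T -> R) (x : T) :
  continuous u x <->
  forall eps, 0 < eps -> locally x (fun y => Rabs (u y - u x) < eps).
Proof.
split.
- intros H eps He. apply (proj1 (filterlim_locally _ _) H (mkposreal _ He)).
- intros H. apply filterlim_locally. intros eps. apply (H eps). apply cond_pos.
Qed.

Lemma continuous_Re (z : C) : continuous Re z.
Proof. apply continuous_fst. Qed.

Lemma continuous_Im (z : C) : continuous Im z.
Proof. apply continuous_snd. Qed.

Section ContinuityAlgebra.
Context {T : UniformSpace}.
Implicit Types (f g : T -> C) (x : T).

Lemma continuous_Cplus f g x : continuous f x -> continuous g x ->
  continuous (fun y => f y + g y)%C x.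
Proof.
rewrite !continuous_pair_iff. intros [A B] [A' B']. split.
- exact (continuous_plus (V := R_NormedModule) _ _ x A A').
- exact (continuous_plus (V := R_NormedModule) _ _ x B B').
Qed.

Lemma continuous_Copp f x : continuous f x -> continuous (fun y => - f y)%C x.
Proof.
rewrite !continuous_pair_iff. intros [A B]. split.
- exact (continuous_opp (V := R_NormedModule) _ x A).
- exact (continuous_opp (V := R_NormedModule) _ x B).
Qed.

Lemma continuous_Cminus f g x : continuous f x -> continuous g x ->
  continuous (fun y => f y - g y)%C x.
Proof. intros A B. apply continuous_Cplus; [|apply continuous_Copp]; auto. Qed.

Lemma continuous_Rmult (u v : T -> R) x : continuous u x -> continuous v x ->
  continuous (fun y => u y * v y) x.
Proof. exact (continuous_mult (K := R_AbsRing) u v x). Qed.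

Lemma continuous_Cmult f g x : continuous f x -> continuous g x ->
  continuous (fun y => f y * g y)%C x.
Proof.
rewrite !continuous_pair_iff. intros [A B] [A' B']. split.
- apply (continuous_minus (V := R_NormedModule)
     (fun y => Re (f y) * Re (g y)) (fun y => Im (f y) * Im (g y)));
   now apply continuous_Rmult.
- apply (continuous_plus (V := R_NormedModule)
     (fun y => Re (f y) * Im (g y)) (fun y => Im (f y) * Re (g y)));
   now apply continuous_Rmult.
Qed.

Lemma continuous_Cconj f x : continuous f x ->
  continuous (fun y => Cconj (f y)) x.
Proof.
rewrite !continuous_pair_iff. intros [A B]. split; [exact A|].
exact (continuous_opp (V := R_NormedModule) _ x B).
Qed.

Lemma continuous_Rinv (u : T -> R) x : continuous u x -> u x <> 0 ->
  continuous (fun y => / u y) x.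
Proof.
intros H H0. apply (continuous_comp u Rinv); auto.
apply continuity_pt_filterlim, continuity_pt_inv; auto.
apply derivable_continuous_pt, derivable_pt_id.
Qed.

Lemma continuous_Cinv f x : continuous f x -> f x <> 0%C ->
  continuous (fun y => / f y)%C x.
Proof.
intros H H0. pose proof H as H'. rewrite continuous_pair_iff in H'.
destruct H' as [A B].
assert (N : Re (f x) ^ 2 + Im (f x) ^ 2 <> 0).
{ intros E. apply H0. assert (Re (f x) = 0 /\ Im (f x) = 0) by nra.
  destruct (f x) as [a b]; simpl in *. destruct H1; subst; reflexivity. }
assert (D : continuous (fun y => Re (f y) ^ 2 + Im (f y) ^ 2) x).
{ apply (continuous_plus (V := R_NormedModule)); simpl.
  - apply continuous_Rmult; auto. apply continuous_Rmult; auto.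
    apply continuous_const.
  - apply continuous_Rmult; auto. apply continuous_Rmult; auto.
    apply continuous_const. }
apply continuous_pair_iff; split.
- apply (continuous_Rmult (fun y => Re (f y))); auto.
  now apply continuous_Rinv.
- apply (continuous_Rmult (fun y => - Im (f y))).
  + exact (continuous_opp (V := R_NormedModule) _ x B).
  + now apply continuous_Rinv.
Qed.

Lemma continuous_Cdiv f g x : continuous f x -> continuous g x ->
  g x <> 0%C -> continuous (fun y => f y / g y)%C x.
Proof. intros A B H. apply continuous_Cmult; [|apply continuous_Cinv]; auto. Qed.

Lemma continuous_Cmod f x : continuous f x -> continuous (fun y => Cmod (f y)) x.
Proof.
intros H. apply continuous_R_eps. intros eps He.
generalize (proj1 (continuous_to_C_eps f x) H eps He). apply filter_imp.
intros y Hy. eapply Rle_lt_trans; [|exact Hy].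
pose proof (Cmod_minus_ge (f y) (f x)).
pose proof (Cmod_minus_ge (f x) (f y)). rewrite Cmod_minus_sym in H1.
apply Rabs_le; lra.
Qed.

End ContinuityAlgebra.

Lemma continuous_shift (a z : C) : continuous (fun w => w - a)%C z.
Proof. apply continuous_Cminus; [apply continuous_id|apply continuous_const]. Qed.

Notation Cdiff f z :=
  (ex_derive (K := C_AbsRing) (V := C_NormedModule) f z).
Notation is_Cderive f z l :=
  (is_derive (K := C_AbsRing) (V := C_NormedModule) f z l).

Section Differentiation.
Implicit Types (f g : C -> C) (z l m w a : C).

Lemma is_Cderive_eps (f : C -> C) (z l : C) :
  is_Cderive f z l <->
  forall eps, 0 < eps -> exists del, 0 < del /\ forall w, Cmod (w - z) < del ->
    Cmod (f w - f z - l * (w - z)) <= eps * Cmod (w - z).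
Proof.
split.
- intros [_ H] eps He.
  assert (Hz : is_filter_lim (locally z) z) by now intros P.
  specialize (H z (fun P HP => HP) (mkposreal eps He)). simpl in H.
  unfold Equiv.is_domin in H.
  apply locally_C, locally_C_eps in H. destruct H as (d & Hd & H).
  exists d; split; auto. intros w Hw. specialize (H w Hw).
  replace (f w - f z - l * (w - z))%C
    with (minus (minus (f w) (f z)) (scal (minus w z) l)); [exact H|].
  unfold minus, plus, opp, scal, mult; simpl. unfold mult; simpl.
  ring.
- intros H. split; [apply is_linear_scal_l|].
  intros x Hx.
  apply (is_filter_lim_locally_unique (V := AbsRing_NormedModule C_AbsRing))
    in Hx.
  intros [eps He]. destruct (H eps He) as (d & Hd & H1).
  subst x. apply locally_C, locally_C_eps. exists d; split; auto.
  intros w Hw. specialize (H1 w Hw).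
  replace (f w - f z - l * (w - z))%C
    with (minus (minus (f w) (f z)) (scal (minus w z) l)) in H1; [exact H1|].
  unfold minus, plus, opp, scal, mult; simpl. unfold mult; simpl.
  ring.
Qed.

(** The difference quotient with its value at [z] prescribed: [f] has
    derivative [l] at [z] exactly when it is continuous there (Caratheodory). *)
Definition slope (f : C -> C) (z l w : C) : C :=
  if excluded_middle_informative (w = z) then l else ((f w - f z) / (w - z))%C.

Lemma slope_at f z l : slope f z l z = l.
Proof. unfold slope. now destruct excluded_middle_informative. Qed.

Lemma Cminus_neq0 (w z : C) : w <> z -> (w - z)%C <> 0%C.
Proof. intros H E. apply H. replace w with ((w - z) + z)%C by ring. rewrite E. ring. Qed.

Lemma slope_off f z l w : w <> z -> slope f z l w = ((f w - f z) / (w - z))%C.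
Proof. unfold slope. now destruct excluded_middle_informative. Qed.

Lemma slope_mult f z l w : ((w - z) * slope f z l w)%C = (f w - f z)%C.
Proof.
destruct (excluded_middle_informative (w = z)) as [->|H].
- ring.
- rewrite slope_off by auto. field. now apply Cminus_neq0.
Qed.

Lemma is_Cderive_slope (f : C -> C) (z l : C) :
  is_Cderive f z l <-> continuous (slope f z l) z.
Proof.
rewrite is_Cderive_eps, continuous_C_eps.
assert (K : forall w, w <> z -> (f w - f z - l * (w - z) =
              (w - z) * (slope f z l w - slope f z l z))%C).
{ intros w Hw. rewrite slope_at. ring_simplify.
  rewrite slope_off by auto. field. now apply Cminus_neq0. }
split; intros H eps He.
- destruct (H (eps / 2)) as (d & Hd & H1); [lra|]. exists d; split; auto.
  intros w Hw. destruct (excluded_middle_informative (w = z)) as [->|N].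
  + replace (slope f z l z - slope f z l z)%C with (RtoC 0) by ring.
    now rewrite Cmod_0.
  + specialize (H1 w Hw). rewrite (K w N), Cmod_mult in H1.
    assert (P : 0 < Cmod (w - z)) by now apply Cmod_gt_0, Cminus_neq0.
    nra.
- destruct (H eps He) as (d & Hd & H1). exists d; split; auto.
  intros w Hw. destruct (excluded_middle_informative (w = z)) as [->|N].
  + replace (f z - f z - l * (z - z))%C with (RtoC 0) by ring.
    replace (z - z)%C with (RtoC 0) by ring. rewrite Cmod_0. lra.
  + rewrite (K w N), Cmod_mult. specialize (H1 w Hw).
    pose proof (Cmod_ge_0 (w - z)). nra.
Qed.

Lemma is_Cderive_intro (f phi : C -> C) (z l : C) :
  continuous phi z -> phi z = l ->
  locally z (fun w => f w = (f z + (w - z) * phi w)%C) ->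
  is_Cderive f z l.
Proof.
intros Hc Hl H. apply is_Cderive_slope.
apply continuous_ext_loc with phi; auto.
revert H. apply filter_imp. intros w Hw. subst l.
destruct (excluded_middle_informative (w = z)) as [->|N].
- now rewrite slope_at.
- rewrite slope_off by auto. rewrite Hw. as_C. field. now apply Cminus_neq0.
Qed.

Lemma slope_eq (f : C -> C) z l w :
  f w = (f z + (w - z) * slope f z l w)%C.
Proof. rewrite slope_mult. ring. Qed.

Lemma is_Cderive_continuous f z l : is_Cderive f z l -> continuous f z.
Proof.
intros H. apply is_Cderive_slope in H.
apply continuous_ext with (fun w => f z + (w - z) * slope f z l w)%C.
{ intros w. symmetry. apply slope_eq. }
apply continuous_Cplus; [apply continuous_const|].
apply continuous_Cmult; auto.
apply continuous_shift.
Qed.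

Lemma Cdiff_continuous f z : Cdiff f z -> continuous f z.
Proof. intros [l H]. eapply is_Cderive_continuous, H. Qed.

Lemma is_Cderive_const (a z : C) : is_Cderive (fun _ => a) z (RtoC 0).
Proof.
apply is_Cderive_intro with (fun _ => 0%C); auto using continuous_const.
apply filter_forall; intros w; cbv beta; as_C. ring.
Qed.

Lemma is_Cderive_id (z : C) : is_Cderive (fun w => w) z (RtoC 1).
Proof.
apply is_Cderive_intro with (fun _ => 1%C); auto using continuous_const.
apply filter_forall; intros w; cbv beta; as_C. ring.
Qed.

Lemma is_Cderive_plus f g z l m : is_Cderive f z l -> is_Cderive g z m ->
  is_Cderive (fun w => f w + g w)%C z (l + m)%C.
Proof.
intros Hf Hg. apply is_Cderive_slope in Hf, Hg.
apply is_Cderive_intro with (fun w => slope f z l w + slope g z m w)%C.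
- now apply continuous_Cplus.
- now rewrite !slope_at.
- apply filter_forall; intros w; cbv beta; as_C.
  rewrite (slope_eq f z l w), (slope_eq g z m w) at 1. ring.
Qed.

Lemma is_Cderive_mult f g z l m : is_Cderive f z l -> is_Cderive g z m ->
  is_Cderive (fun w => f w * g w)%C z (l * g z + f z * m)%C.
Proof.
intros Hf Hg. pose proof (is_Cderive_continuous _ _ _ Hg) as Hgc.
apply is_Cderive_slope in Hf, Hg.
apply is_Cderive_intro with
  (fun w => slope f z l w * g w + f z * slope g z m w)%C.
- apply continuous_Cplus; apply continuous_Cmult; auto using continuous_const.
- now rewrite !slope_at.
- apply filter_forall; intros w; cbv beta; as_C.
  rewrite (slope_eq f z l w) at 1.
  replace (f z * g z)%C with (f z * (g w - (w - z) * slope g z m w))%C; [ring|].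
  rewrite slope_mult. ring.
Qed.

Lemma is_Cderive_inv f z l : is_Cderive f z l -> f z <> 0%C ->
  is_Cderive (fun w => / f w)%C z (- l / (f z * f z))%C.
Proof.
intros Hf H0. pose proof (is_Cderive_continuous _ _ _ Hf) as Hfc.
apply is_Cderive_slope in Hf.
apply is_Cderive_intro with (fun w => - slope f z l w / (f w * f z))%C.
- apply continuous_Cdiv.
  + now apply continuous_Copp.
  + apply continuous_Cmult; auto using continuous_const.
  + now apply Cmult_neq_0.
- now rewrite !slope_at.
- assert (P : 0 < Cmod (f z)) by now apply Cmod_gt_0.
  generalize (proj1 (continuous_to_C_eps _ _) Hfc _ P). apply filter_imp.
  intros w Hw.
  assert (f w <> 0%C).
  { intros E. rewrite E in Hw. replace (0 - f z)%C with (- f z)%C in Hw by ring.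
    rewrite Cmod_opp in Hw. lra. }
  replace (f z + 0)%C with (f z) by ring.
  transitivity (/ f z - ((w - z) * slope f z l w) / (f w * f z))%C.
  + rewrite slope_mult. field; auto.
  + field; auto.
Qed.

Lemma is_Cderive_comp f g z l m : is_Cderive f (g z) l -> is_Cderive g z m ->
  is_Cderive (fun w => f (g w)) z (l * m)%C.
Proof.
intros Hf Hg. pose proof (is_Cderive_continuous _ _ _ Hg) as Hgc.
apply is_Cderive_slope in Hf, Hg.
apply is_Cderive_intro with
  (fun w => slope f (g z) l (g w) * slope g z m w)%C.
- apply continuous_Cmult; auto. now apply (continuous_comp g).
- now rewrite !slope_at.
- apply filter_forall; intros w; cbv beta; as_C.
  rewrite (slope_eq f (g z) l (g w)) at 1.
  rewrite (slope_eq g z m w) at 1. ring.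
Qed.

Lemma Cdiff_const a z : Cdiff (fun _ => a) z.
Proof. eexists; apply is_Cderive_const. Qed.
Lemma Cdiff_id z : Cdiff (fun w => w) z.
Proof. eexists; apply is_Cderive_id. Qed.
Lemma Cdiff_plus f g z : Cdiff f z -> Cdiff g z -> Cdiff (fun w => f w + g w)%C z.
Proof. intros [l H] [m K]; eexists; apply is_Cderive_plus; eauto. Qed.
Lemma Cdiff_mult f g z : Cdiff f z -> Cdiff g z -> Cdiff (fun w => f w * g w)%C z.
Proof. intros [l H] [m K]; eexists; apply is_Cderive_mult; eauto. Qed.
Lemma Cdiff_opp f z : Cdiff f z -> Cdiff (fun w => - f w)%C z.
Proof.
intros H. apply (ex_derive_ext (fun w => (-1) * f w)%C).
- intros t. as_C. ring.
- apply (Cdiff_mult (fun _ => (-1)%C)); auto using Cdiff_const.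
Qed.
Lemma Cdiff_minus f g z : Cdiff f z -> Cdiff g z -> Cdiff (fun w => f w - g w)%C z.
Proof. intros H K. apply Cdiff_plus; auto using Cdiff_opp. Qed.
Lemma Cdiff_shift a z : Cdiff (fun w => w - a)%C z.
Proof. apply Cdiff_minus; [apply Cdiff_id|apply Cdiff_const]. Qed.
Lemma Cdiff_inv f z : Cdiff f z -> f z <> 0%C -> Cdiff (fun w => / f w)%C z.
Proof. intros [l H] K; eexists; apply is_Cderive_inv; eauto. Qed.
Lemma Cdiff_div f g z : Cdiff f z -> Cdiff g z -> g z <> 0%C ->
  Cdiff (fun w => f w / g w)%C z.
Proof. intros H K N. apply Cdiff_mult; auto using Cdiff_inv. Qed.
Lemma Cdiff_comp f g z : Cdiff f (g z) -> Cdiff g z -> Cdiff (fun w => f (g w)) z.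
Proof. intros [l H] [m K]; eexists; apply is_Cderive_comp; eauto. Qed.
Lemma Cdiff_pow f n z : Cdiff f z -> Cdiff (fun w => f w ^ n)%C z.
Proof.
intros H; induction n as [|n IH]; simpl; [apply Cdiff_const|].
now apply Cdiff_mult.
Qed.
Lemma Cdiff_ext_loc f g z : locally z (fun w => f w = g w) -> Cdiff f z -> Cdiff g z.
Proof.
intros H [l K]. exists l. apply is_Cderive_slope in K. apply is_Cderive_slope.
apply continuous_ext_loc with (2 := K).
pose proof (locally_singleton _ _ H) as E. revert H. apply filter_imp.
intros w Hw. unfold slope. now rewrite Hw, E.
Qed.

Lemma Cdiff_slope_off f z l w : w <> z -> Cdiff f w -> Cdiff (slope f z l) w.
Proof.
intros N H. apply Cdiff_ext_loc with (fun w => (f w - f z) / (w - z))%C.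
- apply locally_C_eps. exists (Cmod (w - z)). split.
  + now apply Cmod_gt_0, Cminus_neq0.
  + intros v Hv. rewrite slope_off; auto. intros ->.
    rewrite Cmod_minus_sym in Hv. lra.
- apply Cdiff_div.
  + apply Cdiff_minus; auto using Cdiff_const.
  + apply Cdiff_shift.
  + now apply Cminus_neq0.
Qed.

Lemma Cdiff_Cconj f z : Cdiff f (Cconj z) -> Cdiff (fun w => Cconj (f (Cconj w))) z.
Proof.
intros [l H]. exists (Cconj l). apply is_Cderive_slope in H.
assert (J : forall w, Cconj (Cconj w) = w)
  by (intros [x y]; unfold Cconj; simpl; f_equal; ring).
apply is_Cderive_intro with (fun w => Cconj (slope f (Cconj z) l (Cconj w))).
- apply continuous_Cconj. apply (continuous_comp Cconj); auto.
  apply (continuous_Cconj (fun w => w)), continuous_id.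
- now rewrite slope_at.
- apply filter_forall; intros w; cbv beta; as_C.
  rewrite (slope_eq f (Cconj z) l (Cconj w)) at 1.
  rewrite Cplus_conj, Cmult_conj, Cminus_conj, !J. reflexivity.
Qed.

End Differentiation.

(** * The exponential and the logarithm *)

Section ExpLog.
Implicit Types (f g : C -> C) (z l m w a : C).

Definition cexp (z : C) : C := (exp (Re z) * cos (Im z), exp (Re z) * sin (Im z)).

Lemma cexp_plus (z w : C) : cexp (z + w) = (cexp z * cexp w)%C.
Proof.
destruct z as [x y], w as [u v]; unfold cexp, Cmult; simpl.
rewrite exp_plus, cos_plus, sin_plus. f_equal; ring.
Qed.

Lemma Cmod_cexp (z : C) : Cmod (cexp z) = exp (Re z).
Proof.
unfold cexp, Cmod; simpl.
replace (_ + _) with (exp (Re z) * exp (Re z)).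
- apply sqrt_square. left; apply exp_pos.
- pose proof (sin2_cos2 (Im z)); unfold Rsqr in *. nra.
Qed.

Lemma cexp_0 : cexp 0 = 1%C.
Proof. unfold cexp; simpl. rewrite exp_0, cos_0, sin_0. unfold RtoC; f_equal; ring. Qed.

Lemma cexp_neq0 (z : C) : cexp z <> 0%C.
Proof.
intros H. pose proof (Cmod_cexp z) as K. rewrite H, Cmod_0 in K.
pose proof (exp_pos (Re z)); lra.
Qed.

Lemma continuous_cexp (z : C) : continuous cexp z.
Proof.
assert (E : continuous (fun w => exp (Re w)) z).
{ apply (continuous_comp Re exp); [apply continuous_Re|].
  apply continuity_pt_filterlim, derivable_continuous_pt, derivable_pt_exp. }
apply continuous_pair_iff; split; apply continuous_Rmult; auto.
- apply (continuous_comp Im cos); [apply continuous_Im|].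
  apply continuity_pt_filterlim, continuity_cos.
- apply (continuous_comp Im sin); [apply continuous_Im|].
  apply continuity_pt_filterlim, continuity_sin.
Qed.

Lemma real_slope_small (f : R -> R) (l : R) : derivable_pt_lim f 0 l ->
  forall eps, 0 < eps -> exists del, 0 < del /\ forall h, Rabs h < del ->
    Rabs (f h - f 0 - l * h) <= eps * Rabs h.
Proof.
intros H eps He. destruct (H eps He) as [d Hd]. exists d.
split; [apply cond_pos|]. intros h Hh.
destruct (Req_dec h 0) as [->|N].
- replace (f 0 - f 0 - l * 0) with 0 by ring. rewrite Rabs_R0; lra.
- specialize (Hd h N Hh). rewrite Rplus_0_l in Hd.
  replace (f h - f 0 - l * h) with (((f h - f 0) / h - l) * h) by (field; auto).
  rewrite Rabs_mult. apply Rmult_le_compat_r; [apply Rabs_pos | lra].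
Qed.

Lemma is_Cderive_cexp_0 : is_Cderive cexp (RtoC 0) (RtoC 1).
Proof.
apply is_Cderive_eps. intros eps He.
set (k := Rmin (eps / 8) (1 / 2)).
assert (Hk : 0 < k) by (unfold k; apply Rmin_pos; lra).
assert (Hk1 : k <= eps / 8) by apply Rmin_l.
assert (Hk2 : k <= 1 / 2) by apply Rmin_r.
assert (De : derivable_pt_lim exp 0 1) by (pose proof (derivable_pt_lim_exp 0) as H; now rewrite exp_0 in H).
assert (Dc : derivable_pt_lim cos 0 0).
{ pose proof (derivable_pt_lim_cos 0) as H. now rewrite sin_0, Ropp_0 in H. }
assert (Ds : derivable_pt_lim sin 0 1) by (rewrite <- cos_0; apply derivable_pt_lim_sin).
destruct (real_slope_small exp 1 De k Hk) as (d1 & H1 & E1).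
destruct (real_slope_small cos 0 Dc k Hk) as (d2 & H2 & E2).
destruct (real_slope_small sin 1 Ds k Hk) as (d3 & H3 & E3).
exists (Rmin (Rmin d1 d2) (Rmin d3 (k / 2))). split.
{ repeat apply Rmin_pos; lra. }
intros w Hw. rewrite Cminus_0_r in *.
apply Rmin_Rgt_l in Hw as [Hw12 Hw34].
apply Rmin_Rgt_l in Hw12 as [A1 A2]. apply Rmin_Rgt_l in Hw34 as [A3 A4]. rewrite cexp_0.
pose proof (Re_le_Cmod w) as Bx. pose proof (Im_le_Cmod w) as By.
set (m := Cmod w) in *.
destruct w as [x y]. simpl in Bx, By.
specialize (E1 x ltac:(lra)). specialize (E2 y ltac:(lra)). specialize (E3 y ltac:(lra)).
rewrite exp_0 in E1. rewrite cos_0 in E2. rewrite sin_0 in E3.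
assert (Hm : 0 <= m) by (pose proof (Rabs_pos x); lra).
assert (F1 : Rabs (exp x - 1 - 1 * x) <= k * m) by nra.
assert (F2 : Rabs (cos y - 1 - 0 * y) <= k * m) by nra.
assert (F3 : Rabs (sin y - 0 - 1 * y) <= k * m) by nra.
apply Rabs_le_between in F1, F2, F3, Bx, By.
assert (G : Rabs (exp x - 1) <= k) by (apply Rabs_le; nra).
apply Rabs_le_between in G.
eapply Rle_trans; [apply Cmod_le_Re_Im|]. unfold cexp; simpl.
set (ex := exp x) in *. set (cy := cos y) in *. set (sy := sin y) in *.
replace (ex * cy + - (1) + - (1 * x - 0 * y))
  with ((ex - 1 - 1 * x) + ex * (cy - 1)) by ring.
replace (ex * sy + - 0 + - (1 * y + 0 * x))
  with ((ex - 1) * y + ex * (sy - y)) by ring.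
assert (Rabs ((ex - 1 - 1 * x) + ex * (cy - 1)) <= 4 * k * m).
{ eapply Rle_trans; [apply Rabs_triang|]. rewrite Rabs_mult.
  assert (Rabs (ex - 1 - 1 * x) <= k * m) by (apply Rabs_le; lra).
  assert (Rabs ex <= 2) by (apply Rabs_le; lra).
  assert (Rabs (cy - 1) <= k * m) by (apply Rabs_le; lra).
  pose proof (Rabs_pos ex). pose proof (Rabs_pos (cy - 1)). nra. }
assert (Rabs ((ex - 1) * y + ex * (sy - y)) <= 4 * k * m).
{ eapply Rle_trans; [apply Rabs_triang|]. rewrite !Rabs_mult.
  assert (Rabs (ex - 1) <= k) by (apply Rabs_le; lra).
  assert (Rabs y <= m) by (apply Rabs_le; lra).
  assert (Rabs ex <= 2) by (apply Rabs_le; lra).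
  assert (Rabs (sy - y) <= k * m) by (apply Rabs_le; lra).
  pose proof (Rabs_pos ex). pose proof (Rabs_pos (sy - y)).
  pose proof (Rabs_pos (ex - 1)). pose proof (Rabs_pos y). nra. }
nra.
Qed.

Lemma is_Cderive_cexp z : is_Cderive cexp z (cexp z).
Proof.
apply is_Cderive_intro with
  (fun w => cexp z * slope cexp 0 1 (w - z))%C.
- apply continuous_Cmult; [apply continuous_const|].
  apply (continuous_comp (fun w => w - z)%C).
  + apply continuous_shift.
  + cbv beta. replace (z - z)%C with (RtoC 0) by ring.
    apply is_Cderive_slope, is_Cderive_cexp_0.
- replace (z - z)%C with (RtoC 0) by ring. rewrite slope_at. ring.
- apply filter_forall; intros w; as_C.
  transitivity (cexp z + cexp z * ((w - z - 0) * slope cexp 0 1 (w - z)))%C; [|ring].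
  rewrite slope_mult, cexp_0.
  replace w with (z + (w - z))%C at 1 by ring. rewrite cexp_plus. ring.
Qed.

(** Inverse functions are differentiable wherever they are continuous and the
    derivative of the given function does not vanish: the slopes are inverse
    to each other. *)
Lemma is_Cderive_inverse g (p : C -> C) z l :
  continuous p z -> is_Cderive g (p z) l -> l <> 0%C ->
  locally z (fun w => g (p w) = w) -> is_Cderive p z (/ l)%C.
Proof.
intros Hp Hg Hl H. apply is_Cderive_slope in Hg.
assert (Hs : continuous (fun w => slope g (p z) l (p w)) z).
{ now apply (continuous_comp p (slope g (p z) l)). }
apply is_Cderive_intro with (fun w => / slope g (p z) l (p w))%C.
- apply continuous_Cinv; auto. now rewrite slope_at.
- now rewrite slope_at.
- pose proof (locally_singleton _ _ H) as E; cbv beta in E.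
  assert (P : 0 < Cmod l) by now apply Cmod_gt_0.
  generalize (filter_and _ _ H (proj1 (continuous_to_C_eps _ _) Hs _ P)).
  apply filter_imp. intros w [Hw1 Hw2]; as_C. rewrite slope_at in Hw2.
  assert (N : slope g (p z) l (p w) <> 0%C).
  { intros E0. rewrite E0 in Hw2. replace (0 - l)%C with (- l)%C in Hw2 by ring.
    rewrite Cmod_opp in Hw2. lra. }
  replace (w - z)%C with (g (p w) - g (p z))%C by now rewrite Hw1, E.
  rewrite <- (slope_mult g (p z) l (p w)). field. exact N.
Qed.

(** At the ends of the interval, where the derivative is infinite, continuity
    comes from the monotonicity of the cosine. *)
Lemma continuous_acos (x : R) : -1 <= x <= 1 -> continuous acos x.
Proof.
assert (K : continuous acos 1).
{ apply continuous_R_eps. intros eps He. rewrite acos_1.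
  set (e := Rmin eps 1).
  assert (He1 : 0 < e) by (apply Rmin_pos; lra).
  assert (He2 : e <= 1) by apply Rmin_r.
  assert (He3 : e <= eps) by apply Rmin_l.
  pose proof PI2_1. pose proof PI_RGT_0.
  assert (Hc : 0 < 1 - cos e).
  { assert (cos e < cos 0) by (apply cos_decreasing_1; lra). rewrite cos_0 in *; lra. }
  exists (mkposreal _ Hc). intros y Hy.
  change (Rabs (y - 1) < 1 - cos e) in Hy. apply Rabs_def2 in Hy.
  rewrite Rminus_0_r.
  destruct (Rle_dec 1 y) as [H1|H1].
  - unfold acos. destruct (Rle_dec y (-1)) as [H2|H2]; [lra|].
    destruct (Rle_dec 1 y) as [H3|H3]; [rewrite Rabs_R0; lra | lra].
  - assert (Hy1 : -1 <= y <= 1) by (pose proof (COS_bound e); lra).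
    pose proof (acos_bound y) as Hb. rewrite Rabs_pos_eq by lra.
    apply Rlt_le_trans with e; auto. apply Rnot_le_lt. intros C.
    assert (cos (acos y) <= cos e) by (apply cos_decr_1; lra).
    rewrite cos_acos in *; lra. }
intros Hx. destruct (Req_dec x 1) as [->|N1]; auto.
destruct (Req_dec x (-1)) as [->|N2].
- apply continuous_ext with (fun y => PI - acos (- y)).
  { intros y. change (PI - acos (- y) = acos y). rewrite acos_opp. ring. }
  apply (continuous_minus (V := R_NormedModule)); [apply continuous_const|].
  apply (continuous_comp Ropp acos).
  + apply (continuous_opp (V := R_NormedModule)), continuous_id.
  + replace (- -1) with 1 by ring. exact K.
- apply continuity_pt_filterlim, derivable_continuous_pt, derivable_pt_acos. lra.
Qed.

Lemma Re_div_Cmod_bound z : z <> 0%C -> -1 <= Re z / Cmod z <= 1.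
Proof.
intros H. apply Cmod_gt_0 in H. pose proof (Re_le_Cmod z) as K.
apply Rabs_le_between in K.
split; [apply Rle_div_r | apply Rle_div_l]; lra.
Qed.

Lemma continuous_clog z : z <> 0%C -> continuous clog z.
Proof.
intros H. assert (P : 0 < Cmod z) by now apply Cmod_gt_0.
assert (K : continuous Cmod z) by apply (continuous_Cmod (fun w => w)), continuous_id.
apply continuous_pair_iff; split; simpl.
- apply (continuous_comp Cmod ln); auto.
  apply continuity_pt_filterlim, derivable_continuous_pt.
  exists (/ Cmod z). now apply derivable_pt_lim_ln.
- apply (continuous_comp (fun w => Re w / Cmod w) acos).
  + apply continuous_Rmult; [apply continuous_Re|].
    apply continuous_Rinv; auto. lra.
  + apply continuous_acos. now apply Re_div_Cmod_bound.
Qed.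

Lemma cexp_clog z : z <> 0%C -> 0 <= Im z -> cexp (clog z) = z.
Proof.
intros H Hi. pose proof (Re_div_Cmod_bound z H) as B.
assert (P : 0 < Cmod z) by now apply Cmod_gt_0.
unfold cexp, clog; simpl. rewrite exp_ln by auto.
rewrite cos_acos, sin_acos by auto.
pose proof (Cmod_sqr z) as S.
assert (E : sqrt (1 - (Re z / Cmod z)²) = Im z / Cmod z).
{ replace (1 - (Re z / Cmod z)²) with ((Im z / Cmod z) * (Im z / Cmod z)).
  - apply sqrt_square. apply Rdiv_le_0_compat; auto.
  - unfold Rsqr. field_simplify; try lra.
    f_equal. nra. }
rewrite E. destruct z as [x y]; simpl in *. f_equal; field; lra.
Qed.

Lemma clog_Im_bound z : z <> 0%C -> 0 < Im z -> 0 < Im (clog z) < PI.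
Proof.
intros H Hi. assert (P : 0 < Cmod z) by now apply Cmod_gt_0.
apply acos_bound_lt. pose proof (Cmod_sqr z) as S.
split; [apply Rlt_div_r | apply Rlt_div_l]; nra.
Qed.

Lemma clog_cexp (l : C) : 0 <= Im l <= PI -> clog (cexp l) = l.
Proof.
intros H. unfold clog. rewrite Cmod_cexp, ln_exp. unfold cexp at 1; simpl.
replace (exp (Re l) * cos (Im l) / exp (Re l)) with (cos (Im l)).
- rewrite acos_cos by auto. now destruct l.
- field. pose proof (exp_pos (Re l)); lra.
Qed.

Lemma Cdiff_clog z : 0 < Im z -> Cdiff clog z.
Proof.
intros H.
assert (N : forall w, 0 < Im w -> w <> 0%C).
{ intros w Hw E. rewrite E in Hw. simpl in Hw. lra. }
eexists. apply (is_Cderive_inverse cexp).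
- apply continuous_clog; auto.
- apply is_Cderive_cexp.
- apply cexp_neq0.
- apply locally_C_eps. exists (Im z). split; auto. intros w Hw.
  apply near_Im in Hw.
  apply cexp_clog; [auto | lra].
Qed.

End ExpLog.

(** * Cauchy's theorem for rectangles *)

Definition CInt (h : R -> C) (a b : R) : C :=
  RInt (V := C_R_CompleteNormedModule) h a b.

Notation is_CInt h a b l := (is_RInt (V := C_R_NormedModule) h a b l).

Section ComplexIntegrals.
Implicit Types (h k : R -> C) (a b : R).

Lemma is_CInt_unique h a b (l : C) : is_CInt h a b l -> CInt h a b = l.
Proof. exact (is_RInt_unique (V := C_R_CompleteNormedModule) h a b l). Qed.

Lemma ex_CInt_continuous h a b : a <= b ->
  (forall t, a <= t <= b -> continuous h t) -> is_CInt h a b (CInt h a b).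
Proof.
intros Hab H. apply (RInt_correct (V := C_R_CompleteNormedModule)).
apply (ex_RInt_continuous (V := C_R_CompleteNormedModule)).
intros z. rewrite Rmin_left, Rmax_right by auto. apply H.
Qed.

Lemma is_CInt_plus h k a b (l m : C) : is_CInt h a b l -> is_CInt k a b m ->
  is_CInt (fun t => h t + k t)%C a b (l + m)%C.
Proof. exact (is_RInt_plus (V := C_R_NormedModule) h k a b l m). Qed.

Lemma is_CInt_minus h k a b (l m : C) : is_CInt h a b l -> is_CInt k a b m ->
  is_CInt (fun t => h t - k t)%C a b (l - m)%C.
Proof. exact (is_RInt_minus (V := C_R_NormedModule) h k a b l m). Qed.

Lemma is_CInt_pair h a b (l : C) : is_CInt h a b l <->
  is_RInt (fun t => Re (h t)) a b (Re l) /\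
  is_RInt (fun t => Im (h t)) a b (Im l).
Proof.
split.
- intros H. split.
  + exact (is_RInt_fct_extend_fst (U := R_NormedModule) (V := R_NormedModule) h a b l H).
  + exact (is_RInt_fct_extend_snd (U := R_NormedModule) (V := R_NormedModule) h a b l H).
- intros [H1 H2]. destruct l as [x y].
  exact (is_RInt_fct_extend_pair (U := R_NormedModule) (V := R_NormedModule) h a b x y H1 H2).
Qed.

Lemma is_CInt_mult (c : C) h a b (l : C) : is_CInt h a b l ->
  is_CInt (fun t => c * h t)%C a b (c * l)%C.
Proof.
rewrite !is_CInt_pair. intros [H1 H2]. split; simpl.
- apply (is_RInt_minus (V := R_NormedModule) (fun t => Re c * Re (h t))
    (fun t => Im c * Im (h t)));
  now apply (is_RInt_scal (V := R_NormedModule)).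
- apply (is_RInt_plus (V := R_NormedModule) (fun t => Re c * Im (h t))
    (fun t => Im c * Re (h t)));
  now apply (is_RInt_scal (V := R_NormedModule)).
Qed.

Lemma is_CInt_const (c : C) a b : is_CInt (fun _ => c) a b (RtoC (b - a) * c)%C.
Proof.
replace (RtoC (b - a) * c)%C with (scal (V := C_R_NormedModule) (b - a) c).
- apply is_RInt_const.
- destruct c; unfold scal; simpl. unfold prod_scal, scal; simpl.
  unfold mult, Cmult; simpl. f_equal; ring.
Qed.

Lemma is_CInt_ext h k a b (l : C) :
  (forall t, Rmin a b < t < Rmax a b -> h t = k t) ->
  is_CInt h a b l -> is_CInt k a b l.
Proof. apply is_RInt_ext. Qed.

Lemma C_R_norm (z : C) : norm (V := C_R_NormedModule) z = Cmod z.
Proof.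
destruct z as [x y]. change (sqrt (Rabs x ^ 2 + Rabs y ^ 2) = Cmod (x, y)).
unfold Cmod; simpl fst; simpl snd. now rewrite !pow2_abs.
Qed.

Lemma CInt_bound h a b (l : C) M : a <= b -> is_CInt h a b l ->
  (forall t, a <= t <= b -> Cmod (h t) <= M) -> Cmod l <= (b - a) * M.
Proof.
intros Hab Hl H. rewrite <- C_R_norm.
apply (norm_RInt_le_const (V := C_R_NormedModule) h a b); auto.
intros t Ht. rewrite C_R_norm. auto.
Qed.

Lemma CInt_Chasles h a b c : a <= b <= c ->
  (forall t, a <= t <= c -> continuous h t) ->
  (CInt h a b + CInt h b c = CInt h a c)%C.
Proof.
intros Hab H.
apply (RInt_Chasles (V := C_R_CompleteNormedModule));
 apply (ex_RInt_continuous (V := C_R_CompleteNormedModule)); intros z;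
 rewrite Rmin_left, Rmax_right by lra; intros Hz; apply H; lra.
Qed.

End ComplexIntegrals.

(** The integral of [f] along the boundary of [x1,x2] x [y1,y2]. *)
Definition rect_int (f : C -> C) (x1 x2 y1 y2 : R) : C :=
  (CInt (fun x => f (x, y1)) x1 x2 - CInt (fun x => f (x, y2)) x1 x2
   + Ci * (CInt (fun y => f (x2, y)) y1 y2 - CInt (fun y => f (x1, y)) y1 y2))%C.

Definition in_rect (x1 x2 y1 y2 : R) (z : C) : Prop :=
  x1 <= Re z <= x2 /\ y1 <= Im z <= y2.

Lemma continuous_pair_l (x y : R) : continuous (fun t => (t, y) : C) x.
Proof.
apply continuous_pair_iff; split; simpl; [apply continuous_id|apply continuous_const].
Qed.

Lemma continuous_pair_r (x y : R) : continuous (fun t => (x, t) : C) y.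
Proof.
apply continuous_pair_iff; split; simpl; [apply continuous_const|apply continuous_id].
Qed.

Section Rectangle.
Context (f : C -> C) (x1 x2 y1 y2 : R).
Context (hx : x1 <= x2) (hy : y1 <= y2).
Context (hf : forall z, in_rect x1 x2 y1 y2 z -> continuous f z).

Lemma rect_continuous_h y x : y1 <= y <= y2 -> x1 <= x <= x2 ->
  continuous (fun t => f (t, y)) x.
Proof.
intros H K. apply (continuous_comp (fun t => (t, y) : C) f);
[apply continuous_pair_l|]. apply hf. split; simpl; lra.
Qed.

Lemma rect_continuous_v x y : y1 <= y <= y2 -> x1 <= x <= x2 ->
  continuous (fun t => f (x, t)) y.
Proof.
intros H K. apply (continuous_comp (fun t => (x, t) : C) f);
[apply continuous_pair_r|]. apply hf. split; simpl; lra.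
Qed.

Lemma is_CInt_h y : y1 <= y <= y2 ->
  is_CInt (fun t => f (t, y)) x1 x2 (CInt (fun t => f (t, y)) x1 x2).
Proof. intros H. apply ex_CInt_continuous; auto. intros; now apply rect_continuous_h. Qed.

Lemma is_CInt_v x : x1 <= x <= x2 ->
  is_CInt (fun t => f (x, t)) y1 y2 (CInt (fun t => f (x, t)) y1 y2).
Proof. intros H. apply ex_CInt_continuous; auto. intros; now apply rect_continuous_v. Qed.

Lemma rect_int_split_x x : x1 <= x <= x2 ->
  (rect_int f x1 x y1 y2 + rect_int f x x2 y1 y2 = rect_int f x1 x2 y1 y2)%C.
Proof.
intros H. unfold rect_int.
rewrite <- (CInt_Chasles (fun t => f (t, y1)) x1 x x2),
  <- (CInt_Chasles (fun t => f (t, y2)) x1 x x2); auto.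
- ring.
- intros; apply rect_continuous_h; lra.
- intros; apply rect_continuous_h; lra.
Qed.

Lemma rect_int_split_y y : y1 <= y <= y2 ->
  (rect_int f x1 x2 y1 y + rect_int f x1 x2 y y2 = rect_int f x1 x2 y1 y2)%C.
Proof.
intros H. unfold rect_int.
rewrite <- (CInt_Chasles (fun t => f (x1, t)) y1 y y2),
  <- (CInt_Chasles (fun t => f (x2, t)) y1 y y2); auto.
- ring.
- intros; apply rect_continuous_v; lra.
- intros; apply rect_continuous_v; lra.
Qed.

Lemma rect_int_bound M : (forall z, in_rect x1 x2 y1 y2 z -> Cmod (f z) <= M) ->
  Cmod (rect_int f x1 x2 y1 y2) <= 2 * ((x2 - x1) + (y2 - y1)) * M.
Proof.
intros H. unfold rect_int.
assert (Hh : forall y, y1 <= y <= y2 ->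
  Cmod (CInt (fun t => f (t, y)) x1 x2) <= (x2 - x1) * M).
{ intros y Hy. apply (CInt_bound _ _ _ _ _ hx (is_CInt_h y Hy)).
  intros t Ht. apply H. split; simpl; lra. }
assert (Hv : forall x, x1 <= x <= x2 ->
  Cmod (CInt (fun t => f (x, t)) y1 y2) <= (y2 - y1) * M).
{ intros x Hx. apply (CInt_bound _ _ _ _ _ hy (is_CInt_v x Hx)).
  intros t Ht. apply H. split; simpl; lra. }
eapply Rle_trans; [apply Cmod_triangle|].
rewrite Cmod_mult, Cmod_Ci, Rmult_1_l. unfold Cminus.
pose proof (Cmod_triangle (CInt (fun x => f (x, y1)) x1 x2) (- CInt (fun x => f (x, y2)) x1 x2)) as T1.
pose proof (Cmod_triangle (CInt (fun y => f (x2, y)) y1 y2) (- CInt (fun y => f (x1, y)) y1 y2)) as T2.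
rewrite Cmod_opp in T1, T2.
pose proof (Hh y1 ltac:(lra)). pose proof (Hh y2 ltac:(lra)).
pose proof (Hv x1 ltac:(lra)). pose proof (Hv x2 ltac:(lra)). lra.
Qed.

(** Integrals of affine functions along the boundary vanish. *)
Lemma rect_int_minus_affine (c l z0 : C) :
  rect_int (fun z => f z - (c + l * (z - z0)))%C x1 x2 y1 y2
  = rect_int f x1 x2 y1 y2.
Proof.
set (A := fun z : C => (c + l * (z - z0))%C).
assert (cA : forall z, continuous A z).
{ intros z. apply continuous_Cplus; [apply continuous_const|].
  apply continuous_Cmult; [apply continuous_const|].
  apply continuous_shift. }
assert (Ah : forall y, is_CInt (fun t => A (t, y)) x1 x2 (CInt (fun t => A (t, y)) x1 x2)).
{ intros y. apply ex_CInt_continuous; auto. intros t Ht.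
  apply (continuous_comp (fun t => (t, y) : C) A); [apply continuous_pair_l|auto]. }
assert (Av : forall x, is_CInt (fun t => A (x, t)) y1 y2 (CInt (fun t => A (x, t)) y1 y2)).
{ intros x. apply ex_CInt_continuous; auto. intros t Ht.
  apply (continuous_comp (fun t => (x, t) : C) A); [apply continuous_pair_r|auto]. }
assert (E1 : (CInt (fun t => A (t, y1)) x1 x2 - CInt (fun t => A (t, y2)) x1 x2)%C
  = (RtoC (x2 - x1) * (l * (Ci * RtoC (y1 - y2))))%C).
{ rewrite <- (is_CInt_unique _ _ _ _ (is_CInt_minus _ _ _ _ _ _ (Ah y1) (Ah y2))).
  apply is_CInt_unique. eapply is_CInt_ext; [|apply is_CInt_const].
  intros t _. unfold A. destruct l as [l1 l2].
  unfold Cminus, Cplus, Cmult, Copp, Ci, RtoC; simpl. f_equal; ring. }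
assert (E2 : (CInt (fun t => A (x2, t)) y1 y2 - CInt (fun t => A (x1, t)) y1 y2)%C
  = (RtoC (y2 - y1) * (l * RtoC (x2 - x1)))%C).
{ rewrite <- (is_CInt_unique _ _ _ _ (is_CInt_minus _ _ _ _ _ _ (Av x2) (Av x1))).
  apply is_CInt_unique. eapply is_CInt_ext; [|apply is_CInt_const].
  intros t _. unfold A. destruct l as [l1 l2].
  unfold Cminus, Cplus, Cmult, Copp, Ci, RtoC; simpl. f_equal; ring. }
assert (Fh : forall y, y1 <= y <= y2 -> CInt (fun t => f (t, y) - A (t, y))%C x1 x2
   = (CInt (fun t => f (t, y)) x1 x2 - CInt (fun t => A (t, y)) x1 x2)%C).
{ intros y Hy. apply is_CInt_unique, is_CInt_minus; auto. now apply is_CInt_h. }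
assert (Fv : forall x, x1 <= x <= x2 -> CInt (fun t => f (x, t) - A (x, t))%C y1 y2
   = (CInt (fun t => f (x, t)) y1 y2 - CInt (fun t => A (x, t)) y1 y2)%C).
{ intros x Hx. apply is_CInt_unique, is_CInt_minus; auto. now apply is_CInt_v. }
unfold rect_int. unfold A in *. rewrite !Fh, !Fv by lra.
match goal with |- (?p - ?q - (?r - ?s) + Ci * (?t - ?u - (?v - ?w)))%C = _ =>
  transitivity (p - r + Ci * (t - v) - ((q - s) + Ci * (u - w)))%C; [ring|]
end.
rewrite E1, E2. rewrite !RtoC_minus. ring.
Qed.

End Rectangle.

(** Goursat's bisection: if the integral had modulus [K], one of the quarters
    at level n would carry at least [K / 4^n]; at the common point of these
    quarters [f] is affine up to an error which is small compared with their
    size. *)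
Lemma goursat (f : C -> C) x1 x2 y1 y2 : x1 <= x2 -> y1 <= y2 ->
  (forall z, in_rect x1 x2 y1 y2 z -> Cdiff f z) ->
  rect_int f x1 x2 y1 y2 = RtoC 0.
Proof.
intros hx hy hd.
assert (hc : forall z, in_rect x1 x2 y1 y2 z -> continuous f z)
  by (intros z Hz; apply Cdiff_continuous; auto).
set (W := x2 - x1). set (H := y2 - y1). set (K := Cmod (rect_int f x1 x2 y1 y2)).
assert (hW : 0 <= W) by (unfold W; lra). assert (hH : 0 <= H) by (unfold H; lra).
assert (p2 : forall n, 0 < / 2 ^ n) by (intros; apply Rinv_0_lt_compat, pow_lt; lra).
assert (p2s : forall n, / 2 ^ S n = / 2 ^ n / 2)
  by (intros; simpl; field; apply pow_nonzero; lra).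
set (P := fun (n : nat) (c : C) =>
  (x1 <= Re c /\ Re c + W * / 2 ^ n <= x2) /\ (y1 <= Im c /\ Im c + H * / 2 ^ n <= y2) /\
  K * (/ 2 ^ n * / 2 ^ n) <=
  Cmod (rect_int f (Re c) (Re c + W * / 2 ^ n) (Im c) (Im c + H * / 2 ^ n))).
set (stp := fun (n : nat) (c c' : C) =>
  (Re c <= Re c' /\ Re c' + W * / 2 ^ S n <= Re c + W * / 2 ^ n) /\
  (Im c <= Im c' /\ Im c' + H * / 2 ^ S n <= Im c + H * / 2 ^ n)).
assert (next : forall n c, P n c -> exists c', P (S n) c' /\ stp n c c').
{ intros n [u v] [[A1 A2] [[B1 B2] Q]]. simpl in A1, A2, B1, B2, Q. unfold P, stp.
  rewrite p2s. specialize (p2 n). set (t := / 2 ^ n) in *.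
  set (w := W * (t / 2)). set (h := H * (t / 2)).
  replace (W * t) with (w + w) in * by (unfold w; field).
  replace (H * t) with (h + h) in * by (unfold h; field).
  assert (hw : 0 <= w) by (unfold w; nra). assert (hh : 0 <= h) by (unfold h; nra).
  assert (S1 : rect_int f u (u + (w + w)) v (v + (h + h)) =
    ((rect_int f u (u + w) v (v + h) + rect_int f (u + w) (u + w + w) v (v + h)) +
     (rect_int f u (u + w) (v + h) (v + h + h) + rect_int f (u + w) (u + w + w) (v + h) (v + h + h)))%C).
  { replace (u + w + w) with (u + (w + w)) by ring.
    replace (v + h + h) with (v + (h + h)) by ring.
    rewrite <- (rect_int_split_y f u (u + (w + w)) v (v + (h + h))) with (y := v + h); try lra.
    - rewrite <- (rect_int_split_x f u (u + (w + w)) v (v + h)) with (x := u + w); try lra.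
      + rewrite <- (rect_int_split_x f u (u + (w + w)) (v + h) (v + (h + h))) with (x := u + w); try lra.
        * reflexivity.
        * intros z [Z1 Z2]; apply hc; split; lra.
      + intros z [Z1 Z2]; apply hc; split; lra.
    - intros z [Z1 Z2]; apply hc; split; lra. }
  rewrite S1 in Q.
  match type of Q with _ <= Cmod ((?a + ?b) + (?c + ?d))%C =>
    pose proof (Cmod_triangle (a + b) (c + d)) as T1;
    pose proof (Cmod_triangle a b) as T2; pose proof (Cmod_triangle c d) as T3;
    assert (D : K * (t / 2 * (t / 2)) <= Cmod a \/ K * (t / 2 * (t / 2)) <= Cmod b
             \/ K * (t / 2 * (t / 2)) <= Cmod c \/ K * (t / 2 * (t / 2)) <= Cmod d)
  end.
  { match goal with |- ?A \/ ?B \/ ?C \/ ?D =>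
      destruct (classic A); [tauto|]; destruct (classic B); [tauto|];
      destruct (classic C); [tauto|]; destruct (classic D); [tauto|] end.
    lra. }
  destruct D as [D|[D|[D|D]]].
  - exists (u, v); simpl; repeat split; try lra; exact D.
  - exists (u + w, v); simpl; repeat split; try lra; exact D.
  - exists (u, v + h); simpl; repeat split; try lra; exact D.
  - exists (u + w, v + h); simpl; repeat split; try lra; exact D. }
set (s := fix s (n : nat) : C := match n with
  | O => (x1, y1)
  | S m => epsilon (inhabits (RtoC 0)) (fun c' => P (S m) c' /\ stp m (s m) c')
  end).
assert (Ps : forall n, P n (s n)).
{ induction n as [|n IH].
  - unfold P. replace (/ 2 ^ 0) with 1 by (simpl; field). simpl.
    rewrite !Rmult_1_r. unfold W, H. replace (x1 + (x2 - x1)) with x2 by ring.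
    replace (y1 + (y2 - y1)) with y2 by ring. repeat split; try lra.
    unfold K; lra.
  - simpl. apply (epsilon_spec (inhabits (RtoC 0)) _ (next n (s n) IH)). }
assert (Ss : forall n, stp n (s n) (s (S n))).
{ intros n. simpl. apply (epsilon_spec (inhabits (RtoC 0)) _ (next n (s n) (Ps n))). }
assert (lim : forall (u : nat -> R) (d B : R), 0 <= d -> (forall n, u n <= B) ->
  (forall n, u n <= u (S n) /\ u (S n) + d * / 2 ^ S n <= u n + d * / 2 ^ n) ->
  exists x, forall n, u n <= x <= u n + d * / 2 ^ n).
{ intros u d B Hd Hu Hn.
  destruct (ex_finite_lim_seq_incr u B) as [x Hx]; [intros; apply Hn| auto|].
  exists x. intros n. split.
  - apply (is_lim_seq_incr_compare u x Hx). intros; apply Hn.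
  - apply (is_lim_seq_le_loc u (fun _ => u n + d * / 2 ^ n) x (u n + d * / 2 ^ n));
      auto using is_lim_seq_const.
    exists n. intros m Hm.
    assert (u m + d * / 2 ^ m <= u n + d * / 2 ^ n).
    { induction Hm as [|m Hm IH]; [lra|]. specialize (Hn m). lra. }
    specialize (p2 m). nra. }
destruct (lim (fun n => Re (s n)) W x2 hW) as [x Hx].
{ intros n. destruct (Ps n) as [[A1 A2] _]. specialize (p2 n). nra. }
{ intros n. apply (Ss n). }
destruct (lim (fun n => Im (s n)) H y2 hH) as [y Hy].
{ intros n. destruct (Ps n) as [_ [[A1 A2] _]]. specialize (p2 n). nra. }
{ intros n. apply (Ss n). }
assert (Hz : in_rect x1 x2 y1 y2 (x, y)).
{ specialize (Hx 0%nat); specialize (Hy 0%nat). destruct (Ps 0%nat) as [A [B _]].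
  split; simpl in *; lra. }
destruct (hd _ Hz) as [l Hl].
assert (HK : forall eps, 0 < eps -> K <= eps * (2 * (W + H) * (W + H))).
{ intros eps He.
  destruct (proj1 (is_Cderive_eps f (x, y) l) Hl eps He) as (d & Hd & E).
  destruct (pow_lt_1_zero (/ 2) ltac:(rewrite Rabs_pos_eq; lra) (d / (W + H + 1)))
    as [n Hn]; [apply Rdiv_lt_0_compat; lra|].
  specialize (Hn n (le_n n)). rewrite pow_inv, Rabs_pos_eq in Hn by (specialize (p2 n); lra).
  destruct (Ps n) as [[A1 A2] [[B1 B2] Q]].
  specialize (Hx n). specialize (Hy n). specialize (p2 n). cbv beta in Hx, Hy.
  set (t := / 2 ^ n) in *. set (u := Re (s n)) in *. set (v := Im (s n)) in *.
  rewrite <- (rect_int_minus_affine f) with (c := f (x, y)) (l := l) (z0 := (x, y)) in Q;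
   [| nra | nra | intros z [Z1 Z2]; apply hc; split; lra].
  assert (Hn' : (W + H) * t < d).
  { apply Rlt_div_r in Hn; [|lra]. nra. }
  pose proof (rect_int_bound (fun z => f z - (f (x, y) + l * (z - (x, y))))%C
    u (u + W * t) v (v + H * t) ltac:(nra) ltac:(nra)) as R.
  assert (Q' : K * (t * t) <= 2 * (W * t + H * t) * (eps * ((W + H) * t))).
  { eapply Rle_trans; [exact Q|].
    replace (W * t + H * t) with ((u + W * t - u) + (v + H * t - v)) by ring.
    apply R.
    - intros z [Z1 Z2]. apply continuous_Cminus; [apply hc; split; lra|].
      apply continuous_Cplus; [apply continuous_const|].
      apply continuous_Cmult; [apply continuous_const|].
      apply continuous_shift.
    - intros z [Z1 Z2].
      replace (f z - (f (x, y) + l * (z - (x, y))))%C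
        with (f z - f (x, y) - l * (z - (x, y)))%C by ring.
      assert (Hm : Cmod (z - (x, y)) <= (W + H) * t).
      { eapply Rle_trans; [apply Cmod_le_Re_Im|]. unfold Cminus.
        rewrite re_plus, im_plus, re_opp, im_opp. simpl Re at 2. simpl Im at 2.
        assert (Rabs (Re z + - x) <= W * t) by (apply Rabs_le; lra).
        assert (Rabs (Im z + - y) <= H * t) by (apply Rabs_le; lra). lra. }
      eapply Rle_trans; [apply E; lra|]. apply Rmult_le_compat_l; lra. }
  apply Rmult_le_reg_r with (t * t); [nra|]. eapply Rle_trans; [exact Q'|]. right. ring. }
apply (Cmod_small_eq_0 _ (2 * (W + H) * (W + H))). intros eps He.
rewrite Rmult_comm. now apply HK.
Qed.

(** * Compactness in the plane *)

(** Finite covers in the form of an induction principle, which yields bounds and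
    uniformity on compact sets alike. *)
Lemma compact_induction (Q : (C -> Prop) -> Prop) (K : C -> Prop) (B : R) :
  (forall A A' : C -> Prop, (forall z, A z -> A' z) -> Q A' -> Q A) ->
  Q (fun _ => False) ->
  (forall A A' : C -> Prop, Q A -> Q A' -> Q (fun z => A z \/ A' z)) ->
  (forall z, K z -> Cmod z <= B) -> closed K ->
  (forall z, K z -> exists del, 0 < del /\ Q (fun w => K w /\ Cmod (w - z) < del)) ->
  Q K.
Proof.
intros Hsub H0 HU HB Hcl Hloc.
assert (Hloc' : forall z, exists del, 0 < del /\ Q (fun w => K w /\ Cmod (w - z) < del)).
{ intros z. destruct (classic (K z)) as [Hz|Hz]; auto.
  assert (L : locally z (fun w => ~ K w)).
  { apply NNPP. intros N. apply Hz, Hcl, N. }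
  apply locally_C_eps in L. destruct L as (d & Hd & L). exists d. split; auto.
  apply Hsub with (2 := H0). intros w [Hw1 Hw2]. exact (L w Hw2 Hw1). }
assert (G : forall z : C, {d : posreal | Q (fun w => K w /\ Cmod (w - z) < d)}).
{ intros z. apply constructive_indefinite_description.
  destruct (Hloc' z) as (d & Hd & L). now exists (mkposreal d Hd). }
assert (h2 : forall z, 0 < proj1_sig (G z) / 2).
{ intros z. pose proof (cond_pos (proj1_sig (G z))). lra. }
set (dl := fun t : Compactness.Tn 2 R =>
  let z := (fst t, fst (snd t)) in mkposreal _ (h2 z)).
apply NNPP. intros N.
apply (compactness_list 2 (- B, (- B, tt)) (B, (B, tt)) dl).
intros [l Hl]. apply N.
apply Hsub with (fun w => exists t, List.In t l /\
  (K w /\ Cmod (w - (fst t, fst (snd t))) < proj1_sig (G (fst t, fst (snd t))))).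
- intros z Hz. specialize (HB z Hz).
  pose proof (Re_le_Cmod z) as H1. pose proof (Im_le_Cmod z) as H2.
  apply Rabs_le_between in H1, H2.
  destruct (Hl (Re z, (Im z, tt))) as [t [Ht1 [_ Ht2]]].
  { simpl. repeat split; lra. }
  exists t. split; auto. split; auto.
  destruct t as [t1 [t2 []]]. unfold dl in Ht2. simpl in Ht2. simpl.
  destruct Ht2 as [T1 [T2 _]].
  eapply Rle_lt_trans; [apply Cmod_le_Re_Im|]. unfold Cminus.
  rewrite re_plus, im_plus, re_opp, im_opp.
  change (Re (t1, t2)) with t1. change (Im (t1, t2)) with t2.
  unfold Rminus in *.
  set (d := pos (proj1_sig (G (t1, t2)))) in *.
  change (Rabs (Re z + - t1) < d / 2) in T1. change (Rabs (Im z + - t2) < d / 2) in T2.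
  apply Rlt_le_trans with d; [lra|apply Rle_refl].
- clear Hl. induction l as [|t l IH].
  + apply Hsub with (2 := H0). intros z [t [[] _]].
  + eapply Hsub; [|apply (HU _ _ (proj2_sig (G (fst t, fst (snd t)))) IH)].
    intros z [t' [[E|Ht'] Hz]].
    * left. now subst t'.
    * right. now exists t'.
Qed.

Lemma compact_bounded (K : C -> Prop) (B : R) (u : C -> R) :
  (forall z, K z -> Cmod z <= B) -> closed K ->
  (forall z, K z -> continuous u z) -> exists M, forall z, K z -> u z <= M.
Proof.
intros HB Hcl Hu.
apply (compact_induction (fun A => exists M, forall z, A z -> u z <= M) K B); auto.
- intros A A' H [M HM]. exists M; auto.
- exists 0. tauto.
- intros A A' [M HM] [M' HM']. exists (Rmax M M').
  intros z [Hz|Hz]; [eapply Rle_trans; [auto|apply Rmax_l] | eapply Rle_trans; [auto|apply Rmax_r]].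
- intros z Hz. pose proof (proj1 (continuous_R_eps _ _) (Hu z Hz) 1 Rlt_0_1) as L.
  apply locally_C_eps in L. destruct L as (d & Hd & L). exists d; split; auto.
  exists (u z + 1). intros w [_ Hw]. specialize (L w Hw). apply Rabs_def2 in L. lra.
Qed.

Lemma compact_max (K : C -> Prop) (B : R) (u : C -> R) :
  (forall z, K z -> Cmod z <= B) -> closed K -> (exists z, K z) ->
  (forall z, K z -> continuous u z) -> exists z, K z /\ forall w, K w -> u w <= u z.
Proof.
intros HB Hcl [z0 Hz0] Hu.
destruct (compact_bounded K B u HB Hcl Hu) as [M HM].
destruct (completeness (fun r => exists z, K z /\ r = u z)) as [m [Hm1 Hm2]].
{ exists M. intros r [z [Hz ->]]. auto. }
{ now exists (u z0), z0. }
destruct (classic (exists z, K z /\ u z = m)) as [[z [Hz E]]|N].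
- exists z; split; auto. intros w Hw. rewrite E. apply Hm1. now exists w.
- (* otherwise [1 / (m - u)] would be continuous and hence bounded *)
  exfalso.
  assert (L : forall z, K z -> u z < m).
  { intros z Hz. destruct (Rle_lt_or_eq_dec (u z) m) as [H|H]; auto.
    - apply Hm1. now exists z.
    - destruct N. now exists z. }
  destruct (compact_bounded K B (fun z => / (m - u z)) HB Hcl) as [M' HM'].
  { intros z Hz. apply continuous_Rinv; [|specialize (L z Hz); lra].
    apply (continuous_minus (V := R_NormedModule)); auto using continuous_const. }
  assert (P : 0 < Rmax M' 1) by (pose proof (Rmax_r M' 1); lra).
  assert (m <= m - / Rmax M' 1); [|pose proof (Rinv_0_lt_compat _ P); lra].
  apply Hm2. intros r [z [Hz ->]]. specialize (L z Hz).
  assert (/ Rmax M' 1 <= / / (m - u z)); [|rewrite Rinv_inv in *; lra].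
  apply Rinv_le_contravar; [apply Rinv_0_lt_compat; lra|].
  eapply Rle_trans; [now apply HM'|apply Rmax_l].
Qed.

Lemma compact_uniform_continuity (K : C -> Prop) (B : R) (f : C -> C) :
  (forall z, K z -> Cmod z <= B) -> closed K ->
  (forall z, K z -> continuous f z) -> forall eps, 0 < eps ->
  exists del, 0 < del /\ forall z w, K z -> Cmod (w - z) < del -> Cmod (f w - f z) < eps.
Proof.
intros HB Hcl Hf eps He.
apply (compact_induction (fun A => exists del, 0 < del /\
   forall z w, A z -> Cmod (w - z) < del -> Cmod (f w - f z) < eps) K B); auto.
- intros A A' H [d [H1 H2]]. exists d; split; eauto.
- exists 1. split; [lra|tauto].
- intros A A' [d [P1 P2]] [d' [P1' P2']]. exists (Rmin d d').
  split; [now apply Rmin_pos|]. pose proof (Rmin_l d d'). pose proof (Rmin_r d d').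
  intros z w [Hz|Hz] Hw; [apply P2|apply P2']; auto; lra.
- intros z Hz. destruct (proj1 (continuous_C_eps _ _) (Hf z Hz) (eps / 2)) as (d & Hd & G); [lra|].
  exists (d / 2). split; [lra|]. exists (d / 2). split; [lra|].
  intros v w [_ Hv] Hw.
  pose proof (G v ltac:(lra)) as G1.
  pose proof (G w ltac:(eapply Rle_lt_trans; [apply (Cmod_tri_minus w v z)|lra])) as G2.
  eapply Rle_lt_trans; [apply (Cmod_tri_minus (f w) (f z) (f v))|].
  rewrite (Cmod_minus_sym (f z)). lra.
Qed.

Lemma closed_le (u v : C -> R) : (forall z, continuous u z) -> (forall z, continuous v z) ->
  closed (fun z => u z <= v z).
Proof.
intros Hu Hv z N. apply Rnot_lt_le. intros H. apply N.
assert (He : 0 < (u z - v z) / 2) by lra.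
pose proof (proj1 (continuous_R_eps _ _) (Hu z) _ He) as A.
pose proof (proj1 (continuous_R_eps _ _) (Hv z) _ He) as B.
generalize (filter_and _ _ A B). apply filter_imp. intros w [H1 H2] H3.
apply Rabs_def2 in H1, H2. lra.
Qed.

Lemma continuous_const_R (c : R) (z : C) : continuous (fun _ : C => c) z.
Proof. apply continuous_const. Qed.

Lemma continuous_Cmod_minus (z0 z : C) : continuous (fun w => Cmod (w - z0)) z.
Proof.
apply continuous_Cmod, continuous_Cminus; [apply continuous_id|apply continuous_const].
Qed.

Lemma closed_disc (z0 : C) (r : R) : closed (fun z => Cmod (z - z0) <= r).
Proof. apply closed_le; intros; [apply continuous_Cmod_minus|apply continuous_const]. Qed.

Lemma disc_bounded (z0 z : C) (r : R) : Cmod (z - z0) <= r -> Cmod z <= Cmod z0 + r.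
Proof. intros H. pose proof (Cmod_minus_ge z z0). lra. Qed.

Lemma in_rect_closed x1 x2 y1 y2 : closed (in_rect x1 x2 y1 y2).
Proof.
unfold in_rect. repeat apply closed_and; apply closed_le; intros;
 auto using continuous_const_R, continuous_Re, continuous_Im.
Qed.

Lemma in_rect_bounded x1 x2 y1 y2 z : in_rect x1 x2 y1 y2 z ->
  Cmod z <= Rabs x1 + Rabs x2 + Rabs y1 + Rabs y2.
Proof.
intros [H1 H2]. eapply Rle_trans; [apply Cmod_le_Re_Im|].
assert (Rabs (Re z) <= Rabs x1 + Rabs x2).
{ apply Rabs_le. pose proof (Rle_abs x2). pose proof (Rabs_pos x1). pose proof (Rabs_pos x2).
  pose proof (Rle_abs (- x1)). rewrite Rabs_Ropp in *. lra. }
assert (Rabs (Im z) <= Rabs y1 + Rabs y2).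
{ apply Rabs_le. pose proof (Rle_abs y2). pose proof (Rabs_pos y1). pose proof (Rabs_pos y2).
  pose proof (Rle_abs (- y1)). rewrite (Rabs_Ropp y1) in *. lra. }
lra.
Qed.

(** * Circle means of holomorphic functions *)

(** Cauchy's theorem needs differentiability only off the horizontal sides:
    thin strips along them contribute little, by uniform continuity. *)
Lemma goursat_open (f : C -> C) x1 x2 y1 y2 : x1 <= x2 -> y1 <= y2 ->
  (forall z, in_rect x1 x2 y1 y2 z -> continuous f z) ->
  (forall z, x1 <= Re z <= x2 -> y1 < Im z < y2 -> Cdiff f z) ->
  rect_int f x1 x2 y1 y2 = RtoC 0.
Proof.
intros hx hy hc hd.
destruct (Rle_lt_or_eq_dec y1 y2 hy) as [hy'|E].
2:{ subst y2. unfold rect_int.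
  assert (Z : forall h, CInt h y1 y1 = RtoC 0).
  { intros h. apply is_CInt_unique. apply (is_RInt_point (V := C_R_NormedModule)). }
  rewrite !Z. ring. }
pose proof (in_rect_bounded x1 x2 y1 y2) as Bd.
pose proof (in_rect_closed x1 x2 y1 y2) as Cl.
destruct (compact_bounded _ _ (fun z => Cmod (f z)) Bd Cl) as [M HM].
{ intros z Hz. apply continuous_Cmod; auto. }
assert (Strip : forall s t, y1 <= s -> s <= t -> t <= y2 -> forall eps,
  (forall x, x1 <= x <= x2 -> Cmod (f (x, s) - f (x, t)) <= eps) ->
  Cmod (rect_int f x1 x2 s t) <= (x2 - x1) * eps + 2 * ((t - s) * M)).
{ intros s t H1 H2 H3 eps He. unfold rect_int.
  assert (hc' : forall z, in_rect x1 x2 s t z -> continuous f z).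
  { intros z [A A']. apply hc; split; lra. }
  eapply Rle_trans; [apply Cmod_triangle|]. apply Rplus_le_compat.
  - apply (CInt_bound (fun x => f (x, s) - f (x, t))%C x1 x2); auto.
    apply is_CInt_minus; apply (is_CInt_h f x1 x2 s t hx hc'); lra.
  - rewrite Cmod_mult, Cmod_Ci, Rmult_1_l. unfold Cminus.
    eapply Rle_trans; [apply Cmod_triangle|]. rewrite Cmod_opp.
    assert (V : forall x, x1 <= x <= x2 -> Cmod (CInt (fun y => f (x, y)) s t) <= (t - s) * M).
    { intros x Hx. apply (CInt_bound (fun y => f (x, y)) s t); auto.
      - apply (is_CInt_v f x1 x2 s t H2 hc'); lra.
      - intros y Hy. apply HM. split; simpl; lra. }
    pose proof (V x1 ltac:(lra)). pose proof (V x2 ltac:(lra)). lra. }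
assert (Key : forall eps, 0 < eps ->
  Cmod (rect_int f x1 x2 y1 y2) <= 2 * (x2 - x1) * eps + eps).
{ intros eps He.
  destruct (compact_uniform_continuity _ _ f Bd Cl hc eps He) as (d & Hd & U).
  set (M' := Rmax M 0 + 1).
  assert (HM' : 0 < M' /\ M <= M').
  { unfold M'. pose proof (Rmax_l M 0). pose proof (Rmax_r M 0). lra. }
  set (s := Rmin (Rmin (d / 2) ((y2 - y1) / 2)) (eps / (4 * M'))).
  assert (Hs : 0 < s) by (unfold s; repeat apply Rmin_pos; try apply Rdiv_lt_0_compat; lra).
  assert (Hs1 : s <= d / 2) by (eapply Rle_trans; [apply Rmin_l|apply Rmin_l]).
  assert (Hs2 : s <= (y2 - y1) / 2) by (eapply Rle_trans; [apply Rmin_l|apply Rmin_r]).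
  assert (Hs3 : s * (4 * M') <= eps) by (apply Rle_div_r; [lra|apply Rmin_r]).
  rewrite <- (rect_int_split_y f x1 x2 y1 y2 hx hc (y1 + s)) by lra.
  rewrite <- (rect_int_split_y f x1 x2 (y1 + s) y2) with (y := y2 - s);
    [| lra | intros z [A A1]; apply hc; split; lra | lra].
  rewrite (goursat f x1 x2 (y1 + s) (y2 - s)); [| lra | lra |].
  2:{ intros z [A A']. apply hd; lra. }
  rewrite Cplus_0_l.
  assert (Dist : forall x s t, Rabs (s - t) <= d / 2 -> Cmod ((x, s) - (x, t)) < d).
  { intros x s' t' H. eapply Rle_lt_trans; [apply Cmod_le_Re_Im|]. simpl.
    replace (x + - x) with 0 by ring. rewrite Rabs_R0. unfold Rminus in H. lra. }
  eapply Rle_trans; [apply Cmod_triangle|].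
  pose proof (Strip y1 (y1 + s) ltac:(lra) ltac:(lra) ltac:(lra) eps) as S1.
  pose proof (Strip (y2 - s) y2 ltac:(lra) ltac:(lra) ltac:(lra) eps) as S2.
  assert (E1 : forall x, x1 <= x <= x2 -> Cmod (f (x, y1) - f (x, y1 + s)) <= eps).
  { intros x Hx. rewrite Cmod_minus_sym. left. apply U.
    - split; simpl; lra.
    - apply Dist. replace (y1 + s - y1) with s by ring. rewrite Rabs_pos_eq; lra. }
  assert (E2 : forall x, x1 <= x <= x2 -> Cmod (f (x, y2 - s) - f (x, y2)) <= eps).
  { intros x Hx. left. apply U.
    - split; simpl; lra.
    - apply Dist. replace (y2 - s - y2) with (- s) by ring. rewrite Rabs_Ropp, Rabs_pos_eq; lra. }
  specialize (S1 E1). specialize (S2 E2).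
  replace (y1 + s - y1) with s in S1 by ring. replace (y2 - (y2 - s)) with s in S2 by ring.
  nra. }
apply (Cmod_small_eq_0 _ (2 * (x2 - x1) + 1)). intros eps He. specialize (Key eps He). lra.
Qed.

(** The rectangle is cut along the excepted lines. *)
Lemma goursat_lines (f : C -> C) x1 x2 (l : list R) : x1 <= x2 -> forall y1 y2, y1 <= y2 ->
  (forall z, in_rect x1 x2 y1 y2 z -> continuous f z) ->
  (forall z, x1 <= Re z <= x2 -> y1 < Im z < y2 -> ~ List.In (Im z) l -> Cdiff f z) ->
  rect_int f x1 x2 y1 y2 = RtoC 0.
Proof.
intros hx. induction l as [|s l IH]; intros y1 y2 hy hc hd.
- apply goursat_open; auto.
- destruct (classic (y1 < s < y2)) as [Hs|Hs].
  + rewrite <- (rect_int_split_y f x1 x2 y1 y2 hx hc s) by lra.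
    rewrite (IH y1 s), (IH s y2); try lra; try ring.
    * intros z [A A']. apply hc; split; lra.
    * intros z A A' A''. apply hd; auto; try lra. intros [E|E]; [lra|auto].
    * intros z [A A']. apply hc; split; lra.
    * intros z A A' A''. apply hd; auto; try lra. intros [E|E]; [lra|auto].
  + apply IH; auto. intros z A A' A''. apply hd; auto. intros [E|E]; [lra|auto].
Qed.

Definition circle_pt (z0 : C) (r t : R) : C := (z0 + RtoC r * (cos t, sin t))%C.

(** The measure is [dt], not [dz]: this is [2 pi] times the mean of [f]. *)
Definition circle_int (f : C -> C) (z0 : C) (r : R) : C :=
  CInt (fun t => f (circle_pt z0 r t)) 0 (2 * PI).

Lemma Cmod_cos_sin t : Cmod (cos t, sin t) = 1.
Proof.
unfold Cmod; simpl. pose proof (sin2_cos2 t). unfold Rsqr in *.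
replace (_ + _) with 1 by nra. apply sqrt_1.
Qed.

Lemma circle_pt_dist z0 r t : 0 <= r -> Cmod (circle_pt z0 r t - z0) = r.
Proof.
intros H. unfold circle_pt. replace (_ - z0)%C with (RtoC r * (cos t, sin t))%C by ring.
rewrite Cmod_mult, Cmod_cos_sin, Cmod_R, Rabs_pos_eq; lra.
Qed.

Lemma continuous_circle_pt z0 r t : continuous (circle_pt z0 r) t.
Proof.
apply continuous_Cplus; [apply continuous_const|].
apply continuous_Cmult; [apply continuous_const|].
apply continuous_pair_iff; split; simpl;
 apply continuity_pt_filterlim; [apply continuity_cos|apply continuity_sin].
Qed.

Lemma is_circle_int f z0 r : 0 <= r ->
  (forall z, Cmod (z - z0) = r -> continuous f z) ->
  is_CInt (fun t => f (circle_pt z0 r t)) 0 (2 * PI) (circle_int f z0 r).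
Proof.
intros Hr H. apply ex_CInt_continuous; [pose proof PI_RGT_0; lra|].
intros t _. apply (continuous_comp (circle_pt z0 r) f); [apply continuous_circle_pt|].
apply H. now apply circle_pt_dist.
Qed.

(** In the coordinate [log (z - z0)] an annulus becomes a rectangle, along whose
    horizontal sides [f] takes equal values. *)
Lemma circle_int_radius f z0 r1 r2 (l : list R) : 0 < r1 <= r2 ->
  (forall z, r1 <= Cmod (z - z0) <= r2 -> continuous f z) ->
  (forall r t, r1 <= r <= r2 -> 0 < t < 2 * PI -> ~ List.In t l ->
     Cdiff f (circle_pt z0 r t)) ->
  circle_int f z0 r1 = circle_int f z0 r2.
Proof.
intros Hr hc hd. pose proof PI_RGT_0.
set (G := fun w => f (z0 + cexp w)%C).
assert (R1 : forall w, ln r1 <= Re w <= ln r2 -> r1 <= exp (Re w) <= r2).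
{ intros w [A B]. split.
  - rewrite <- (exp_ln r1) at 1 by lra. destruct A as [A|A]; [left; now apply exp_increasing| rewrite A; lra].
  - rewrite <- (exp_ln r2) by lra. destruct B as [B|B]; [left; now apply exp_increasing| rewrite B; lra]. }
assert (P : forall w, (z0 + cexp w)%C = circle_pt z0 (exp (Re w)) (Im w)).
{ intros w. unfold circle_pt. f_equal. unfold cexp, RtoC, Cmult; simpl. f_equal; ring. }
assert (E : rect_int G (ln r1) (ln r2) 0 (2 * PI) = RtoC 0).
{ apply (goursat_lines G _ _ l); try lra.
  - destruct (Rle_lt_or_eq_dec r1 r2) as [A|A]; [lra| |rewrite A; lra]. left. apply ln_increasing; lra.
  - intros w [Hw _]. apply (continuous_comp (fun w => z0 + cexp w)%C f).
    + apply continuous_Cplus; [apply continuous_const|apply continuous_cexp].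
    + apply hc. rewrite P, circle_pt_dist by (left; apply exp_pos). auto.
  - intros w Hw1 Hw2 Hw3. apply (Cdiff_comp f (fun w => z0 + cexp w)%C).
    + rewrite P. apply hd; auto.
    + apply Cdiff_plus; [apply Cdiff_const|]. eexists; apply is_Cderive_cexp. }
assert (V : forall r, 0 < r -> CInt (fun y => G (ln r, y)) 0 (2 * PI) = circle_int f z0 r).
{ intros r Hr0. unfold circle_int. f_equal. apply functional_extensionality. intros t.
  unfold G. rewrite P. simpl. now rewrite exp_ln. }
unfold rect_int in E.
replace (CInt (fun x => G (x, 2 * PI)) (ln r1) (ln r2)) with (CInt (fun x => G (x, 0)) (ln r1) (ln r2)) in E.
2:{ f_equal. apply functional_extensionality. intros x. unfold G. do 2 f_equal.
  unfold cexp; simpl. now rewrite cos_0, sin_0, cos_2PI, sin_2PI. }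
rewrite !V in E by lra.
assert (E' : (Ci * (circle_int f z0 r2 - circle_int f z0 r1))%C = RtoC 0) by (rewrite <- E; ring).
assert (E'' : (circle_int f z0 r2 - circle_int f z0 r1)%C = RtoC 0).
{ apply Cmod_eq_0. apply (f_equal Cmod) in E'. now rewrite Cmod_mult, Cmod_Ci, Rmult_1_l, Cmod_0 in E'. }
symmetry. replace (circle_int f z0 r2) with ((circle_int f z0 r2 - circle_int f z0 r1) + circle_int f z0 r1)%C by ring.
rewrite E''. ring.
Qed.

(** The rays from [z0] are horizontal lines in the coordinate [log (z - z0)]; a
    singularity at [a] is dealt with by excepting the ray through [a]. *)
Lemma circle_pt_angle z0 a : exists t0, forall r t, 0 < r -> 0 < t < 2 * PI ->
  circle_pt z0 r t = a -> t = t0.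
Proof.
pose proof PI_RGT_0 as HPI.
destruct (classic (exists r t, 0 < r /\ 0 < t < 2 * PI /\ circle_pt z0 r t = a))
  as [(r0 & t0 & Hr0 & Ht0 & E0)|N].
2:{ exists 0. intros r t Hr Ht E. exfalso. apply N. now exists r, t. }
exists t0. intros r t Hr Ht E.
assert (r = r0).
{ rewrite <- (circle_pt_dist z0 r t), <- (circle_pt_dist z0 r0 t0) by lra. now rewrite E, E0. }
subst r0.
assert (E1 : circle_pt z0 r t = circle_pt z0 r t0) by now rewrite E, E0.
unfold circle_pt in E1.
assert (H1 : cos t = cos t0 /\ sin t = sin t0).
{ destruct z0 as [u v]. unfold Cplus, Cmult, RtoC in E1; simpl in E1.
  injection E1 as A B. split; nra. }
destruct H1 as [A B].
assert (S : sin ((t - t0) / 2) = 0).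
{ assert (D : cos (2 * ((t - t0) / 2)) = 1).
  { replace (2 * ((t - t0) / 2)) with (t - t0) by field. rewrite cos_minus, A, B.
    pose proof (sin2_cos2 t0). unfold Rsqr in *. lra. }
  rewrite cos_2a_sin in D. nra. }
destruct (Rtotal_order t t0) as [H|[H|H]]; auto.
- assert (0 < sin ((t0 - t) / 2)) by (apply sin_gt_0; lra).
  replace ((t - t0) / 2) with (- ((t0 - t) / 2)) in S by field. rewrite sin_neg in S. lra.
- assert (0 < sin ((t - t0) / 2)) by (apply sin_gt_0; lra). lra.
Qed.

Lemma circle_int_const (c z0 : C) r : circle_int (fun _ => c) z0 r = (RtoC (2 * PI) * c)%C.
Proof. apply is_CInt_unique. rewrite <- (Rminus_0_r (2 * PI)) at 2. apply is_CInt_const. Qed.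

(** By [circle_int_radius] the radius may tend to 0. The rays with angles in [l]
    carry the singularities at which [f] is still continuous. *)
Lemma circle_mean f z0 rho (l : list R) :
  (forall z, Cmod (z - z0) < rho -> continuous f z) ->
  (forall r t, 0 < r < rho -> 0 < t < 2 * PI -> ~ List.In t l -> Cdiff f (circle_pt z0 r t)) ->
  forall r, 0 < r < rho -> circle_int f z0 r = (RtoC (2 * PI) * f z0)%C.
Proof.
intros hc hd r Hr. pose proof PI_RGT_0.
assert (Key : forall eps, 0 < eps -> Cmod (circle_int f z0 r - RtoC (2 * PI) * f z0) <= 2 * PI * eps).
{ intros eps He.
  assert (c0 : continuous f z0).
  { apply hc. rewrite Cmod_minus_self. lra. }
  destruct (proj1 (continuous_C_eps f z0) c0 eps He) as (d & Hd & U).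
  set (s := Rmin (d / 2) r).
  assert (Hs : 0 < s) by (unfold s; apply Rmin_pos; lra).
  assert (Hs1 : s <= d / 2) by apply Rmin_l. assert (Hs2 : s <= r) by apply Rmin_r.
  rewrite <- (circle_int_radius f z0 s r l); [| lra | |].
  - rewrite <- (circle_int_const (f z0) z0 s).
    replace (2 * PI * eps) with ((2 * PI - 0) * eps) by ring.
    apply (CInt_bound (fun t => f (circle_pt z0 s t) - f z0)%C 0 (2 * PI)); [lra| |].
    + apply is_CInt_minus.
      * apply is_circle_int; [lra|]. intros z Hz. apply hc. lra.
      * apply (is_circle_int (fun _ => f z0)); [lra|]. intros; apply continuous_const.
    + intros t _. left. apply U. rewrite circle_pt_dist; lra.
  - intros z Hz. apply hc. lra.
  - intros r' t Hr' Ht Hl. apply hd; auto. lra. }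
apply Cmod_small_eq_0 in Key. replace (circle_int f z0 r)
  with ((circle_int f z0 r - RtoC (2 * PI) * f z0) + RtoC (2 * PI) * f z0)%C by ring.
rewrite Key. ring.
Qed.

(** The integral has the same value for all larger circles, on which the
    integrand is small. *)
Lemma circle_int_inv z0 a r : Cmod (a - z0) < r ->
  circle_int (fun z => / (z - a))%C z0 r = RtoC 0.
Proof.
intros Hr. pose proof PI_RGT_0. pose proof (Cmod_ge_0 (a - z0)) as Ha.
set (A := Cmod (a - z0)) in *.
assert (Far : forall z s, s <= Cmod (z - z0) -> s - A <= Cmod (z - a)).
{ intros z s Hs. pose proof (Cmod_tri_minus z a z0) as T. fold A in T. lra. }
assert (Nz : forall z, r <= Cmod (z - z0) -> (z - a)%C <> RtoC 0).
{ intros z Hz E. specialize (Far z r Hz). rewrite E, Cmod_0 in Far. lra. }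
assert (Cd : forall z, r <= Cmod (z - z0) -> Cdiff (fun z => / (z - a))%C z).
{ intros z Hz. apply Cdiff_inv; auto. apply Cdiff_shift. }
assert (Key : forall s, r <= s -> Cmod (circle_int (fun z => / (z - a))%C z0 r) <= 2 * PI * / (s - A)).
{ intros s Hs. rewrite (circle_int_radius _ z0 r s List.nil).
  - replace (2 * PI * / (s - A)) with ((2 * PI - 0) * / (s - A)) by ring.
    apply (CInt_bound (fun t => / (circle_pt z0 s t - a))%C); [lra| |].
    + apply (is_circle_int (fun z => / (z - a))%C); [lra|]. intros z Hz.
      apply Cdiff_continuous, Cd. lra.
    + intros t _. assert (Hs' : s <= Cmod (circle_pt z0 s t - z0)) by (rewrite circle_pt_dist; lra).
      rewrite Cmod_inv by (apply Nz; lra). apply Rinv_le_contravar; [lra|]. now apply Far.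
  - lra.
  - intros z Hz. apply Cdiff_continuous, Cd. lra.
  - intros r' t Hr' _ _. apply Cd. rewrite circle_pt_dist; lra. }
apply (Cmod_small_eq_0 _ (2 * PI)). intros eps He.
assert (0 < / eps) by now apply Rinv_0_lt_compat.
eapply Rle_trans; [apply (Key (r + / eps)); lra|]. apply Rmult_le_compat_l; [lra|].
rewrite <- (Rinv_inv eps) at 2. apply Rinv_le_contravar; lra.
Qed.

Lemma Im_circle_pt z0 r t : Im (circle_pt z0 r t) = Im z0 + r * sin t.
Proof. unfold circle_pt. rewrite im_plus, im_scal_l. reflexivity. Qed.

Lemma circle_pt_off_line z0 r t : 0 < r -> 0 < t < 2 * PI -> t <> PI ->
  Im (circle_pt z0 r t) <> Im z0.
Proof.
intros Hr Ht N E. rewrite Im_circle_pt in E. assert (S : sin t = 0) by nra.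
destruct (Rtotal_order t PI) as [H|[H|H]]; auto.
- pose proof (sin_gt_0 t). lra.
- assert (0 < sin (t - PI)) by (apply sin_gt_0; lra).
  rewrite sin_minus, cos_PI, sin_PI in *. lra.
Qed.

(** The horizontal line through the centre of the disc may carry singularities
    at which [f] is still continuous. This covers removable singularities at
    [z0] as well as functions extended by reflection. *)
Definition nearly_holo (f : C -> C) (z0 : C) (rho : R) : Prop :=
  (forall z, Cmod (z - z0) < rho -> continuous f z) /\
  (forall z, Cmod (z - z0) < rho -> Im z <> Im z0 -> Cdiff f z).

(** Cauchy's formula: the mean value property of [(z - z0) (f z - f a)/(z - a)]. *)
Lemma cauchy_formula f z0 rho r a : nearly_holo f z0 rho -> 0 < r < rho ->
  Cmod (a - z0) < r -> Im a <> Im z0 ->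
  circle_int (fun z => f z * (z - z0) / (z - a))%C z0 r = (RtoC (2 * PI) * f a)%C.
Proof.
intros [hc hd] Hr Ha Na. pose proof PI_RGT_0.
destruct (hd a ltac:(lra) Na) as [l Hl].
pose proof (is_Cderive_continuous _ _ _ Hl) as Hfa. apply is_Cderive_slope in Hl.
assert (Nz : forall z, Cmod (z - z0) = r -> z <> a).
{ intros z Hz E. subst z. lra. }
assert (cz : forall z, continuous (fun z => z - z0)%C z).
{ intros z. apply continuous_shift. }
assert (ca : forall z, continuous (fun z => z - a)%C z).
{ intros z. apply continuous_shift. }
destruct (circle_pt_angle z0 a) as [t0 Ht0].
set (G := fun z => (slope f a l z * (z - z0))%C).
assert (M : circle_int G z0 r = RtoC 0).
{ rewrite (circle_mean G z0 rho (PI :: t0 :: nil)); auto.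
  - unfold G. ring.
  - intros z Hz. apply continuous_Cmult; auto.
    destruct (excluded_middle_informative (z = a)) as [->|N]; auto.
    apply continuous_ext_loc with (fun z => (f z - f a) / (z - a))%C.
    + apply locally_C_eps. exists (Cmod (z - a)). split; [now apply Cmod_gt_0, Cminus_neq0|].
      intros w Hw. rewrite slope_off; auto. intros ->. rewrite Cmod_minus_sym in Hw. lra.
    + apply continuous_Cdiv; auto using Cminus_neq0.
      apply continuous_Cminus; auto using continuous_const.
  - intros s t Hs Ht Hl'. apply Cdiff_mult.
    + apply Cdiff_slope_off.
      * intros E. apply Hl'. right; left. symmetry. apply (Ht0 s t); auto. lra.
      * apply hd; [rewrite circle_pt_dist; lra|].
        apply circle_pt_off_line; auto; [lra|]. intros E. apply Hl'. now left.
    + apply Cdiff_shift. }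
assert (c1 : forall z, Cmod (z - z0) = r -> continuous (fun z => f z * (z - z0) / (z - a))%C z).
{ intros z Hz. apply continuous_Cdiv; auto.
  - apply continuous_Cmult; auto. apply hc. lra.
  - apply Cminus_neq0; auto. }
assert (c2 : forall z, Cmod (z - z0) = r -> continuous (fun z => / (z - a))%C z).
{ intros z Hz. apply continuous_Cinv; auto. apply Cminus_neq0; auto. }
assert (I1 := is_circle_int _ z0 r ltac:(lra) c1).
assert (I2 := is_circle_int _ z0 r ltac:(lra) c2).
rewrite circle_int_inv in I2 by auto.
assert (I3 := is_circle_int (fun _ => RtoC 1) z0 r ltac:(lra) (fun z _ => continuous_const _ z)).
rewrite circle_int_const in I3.
(* (z - z0) / (z - a) = 1 + (a - z0) / (z - a) *)
assert (I4 := is_CInt_minus _ _ _ _ _ _ I1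
  (is_CInt_mult (f a) _ _ _ _ (is_CInt_plus _ _ _ _ _ _ I3 (is_CInt_mult (a - z0)%C _ _ _ _ I2)))).
assert (E : circle_int G z0 r = (circle_int (fun z => f z * (z - z0) / (z - a)) z0 r
   - f a * (RtoC (2 * PI) * 1 + (a - z0) * 0))%C).
{ apply is_CInt_unique. eapply is_CInt_ext; [|exact I4]. intros t _. cbv beta. unfold G.
  assert (N : circle_pt z0 r t <> a) by (apply Nz, circle_pt_dist; lra).
  rewrite slope_off by auto. as_C. field. now apply Cminus_neq0. }
rewrite M in E.
match type of E with _ = (?x - ?y)%C => replace x with ((x - y) + y)%C by ring; rewrite <- E end.
ring.
Qed.

(** In Cauchy's formula [(z - z0) / (z - a)] is expanded to second order in
    [a - z0]. This gives the formula for [a] off the horizontal line through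
    [z0], and by continuity for all [a]. *)
Lemma taylor_bound f z0 rho r M : nearly_holo f z0 rho -> 0 < r < rho ->
  (forall z, Cmod (z - z0) = r -> Cmod (f z) <= M) ->
  exists d, Cmod d <= M / r /\
    (forall z, Cmod (z - z0) < r / 2 ->
      Cmod (f z - f z0 - d * (z - z0)) <= 2 * M / (r * r) * (Cmod (z - z0) * Cmod (z - z0))) /\
    is_Cderive f z0 d.
Proof.
intros hf Hr HM. pose proof hf as [hc hd]. pose proof PI_RGT_0.
assert (HM0 : 0 <= M).
{ eapply Rle_trans; [apply Cmod_ge_0|apply (HM (circle_pt z0 r 0))]. apply circle_pt_dist; lra. }
assert (N0 : forall z, Cmod (z - z0) = r -> (z - z0)%C <> RtoC 0).
{ intros z Hz E. rewrite E, Cmod_0 in Hz. lra. }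
assert (cz : forall z, continuous (fun z => z - z0)%C z).
{ intros z. apply continuous_shift. }
assert (c1 : forall z, Cmod (z - z0) = r -> continuous (fun z => f z / (z - z0))%C z).
{ intros z Hz. apply continuous_Cdiv; auto. apply hc; lra. }
assert (I1 := is_circle_int (fun z : C => f z / (z - z0))%C z0 r ltac:(lra) c1).
assert (c0 : forall z, Cmod (z - z0) = r -> continuous f z) by (intros; apply hc; lra).
assert (I0 := is_circle_int f z0 r ltac:(lra) c0).
rewrite (circle_mean f z0 rho (PI :: nil)) in I0; auto.
2:{ intros s t Hs Ht Hl. apply hd; [rewrite circle_pt_dist; lra|].
  apply circle_pt_off_line; auto; [lra|]. intros E; apply Hl; now left. }
set (d := (/ RtoC (2 * PI) * circle_int (fun z => f z / (z - z0)) z0 r)%C).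
assert (P2 : RtoC (2 * PI) <> RtoC 0) by (intros E; apply RtoC_eq_0 in E; lra).
assert (Pm : Cmod (/ RtoC (2 * PI)) = / (2 * PI)).
{ rewrite Cmod_inv by auto. rewrite Cmod_R, Rabs_pos_eq; lra. }
assert (Bd : Cmod d <= M / r).
{ unfold d. rewrite Cmod_mult, Pm.
  assert (B : Cmod (circle_int (fun z => f z / (z - z0))%C z0 r) <= (2 * PI - 0) * (M / r)).
  { apply (CInt_bound _ 0 (2 * PI) _ _ ltac:(lra) I1). intros t _.
    assert (E := circle_pt_dist z0 r t ltac:(lra)). rewrite Cmod_div by auto. rewrite E.
    apply Rmult_le_compat_r; auto. left; apply Rinv_0_lt_compat; lra. }
  apply Rmult_le_reg_l with (2 * PI); [lra|].
  rewrite <- Rmult_assoc, Rinv_r, Rmult_1_l by lra. lra. }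
assert (Off : forall z, Cmod (z - z0) < r / 2 -> Im z <> Im z0 ->
  Cmod (f z - f z0 - d * (z - z0)) <= 2 * M / (r * r) * (Cmod (z - z0) * Cmod (z - z0))).
{ intros a Ha Na.
  assert (Nz : forall z, Cmod (z - z0) = r -> (z - a)%C <> RtoC 0).
  { intros z Hz. apply Cminus_neq0. intros ->. lra. }
  assert (ca : forall z, continuous (fun z => z - a)%C z).
  { intros z. apply continuous_shift. }
  assert (c2 : forall z, Cmod (z - z0) = r -> continuous (fun z => f z * (z - z0) / (z - a))%C z).
  { intros z Hz. apply continuous_Cdiv; auto. apply continuous_Cmult; auto. }
  assert (I2 := is_circle_int (fun z : C => f z * (z - z0) / (z - a))%C z0 r ltac:(lra) c2).
  rewrite (cauchy_formula f z0 rho r a hf) in I2 by (auto; lra).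
  assert (I3 := is_CInt_minus _ _ _ _ _ _ (is_CInt_minus _ _ _ _ _ _ I2 I0)
    (is_CInt_mult (a - z0)%C _ _ _ _ I1)).
  assert (I4 := is_CInt_mult (/ RtoC (2 * PI))%C _ _ _ _ I3).
  match type of I4 with is_RInt _ _ _ ?v =>
    replace v with (f a - f z0 - d * (a - z0))%C in I4 by (unfold d; as_C; field; auto) end.
  set (m := Cmod (a - z0)) in *. assert (0 <= m) by apply Cmod_ge_0.
  replace (2 * M / (r * r) * (m * m)) with ((2 * PI - 0) * (/ (2 * PI) * (2 * M / (r * r) * (m * m)))) by (field; lra).
  apply (CInt_bound _ 0 (2 * PI) _ _ ltac:(lra) I4). intros t _.
  assert (E := circle_pt_dist z0 r t ltac:(lra)). set (z := circle_pt z0 r t) in *.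
  rewrite Cmod_mult, Pm. apply Rmult_le_compat_l; [left; apply Rinv_0_lt_compat; lra|].
  replace (f z * (z - z0) / (z - a) - f z - (a - z0) * (f z / (z - z0)))%C
    with (f z * ((a - z0) * (a - z0)) / ((z - z0) * (z - a)))%C by (field; auto).
  rewrite Cmod_div by (apply Cmult_neq_0; auto). rewrite !Cmod_mult, E. fold m.
  assert (Z : r / 2 <= Cmod (z - a)).
  { pose proof (Cmod_tri_minus z a z0) as T. fold m in T. lra. }
  specialize (HM z E). pose proof (Cmod_ge_0 (f z)).
  apply Rle_trans with (M * (m * m) / (r * (r / 2))); [|right; field; lra].
  apply Rmult_le_compat; auto.
  - nra.
  - left; apply Rinv_0_lt_compat; nra.
  - nra.
  - apply Rinv_le_contravar; nra. }
assert (All : forall z, Cmod (z - z0) < r / 2 ->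
  Cmod (f z - f z0 - d * (z - z0)) <= 2 * M / (r * r) * (Cmod (z - z0) * Cmod (z - z0))).
{ intros z Hz. destruct (Req_dec (Im z) (Im z0)) as [Ez|Ez]; auto.
  apply Rnot_lt_le. intros Lt.
  set (u := fun z => Cmod (f z - f z0 - d * (z - z0)) - 2 * M / (r * r) * (Cmod (z - z0) * Cmod (z - z0))).
  assert (cu : continuous u z).
  { apply (continuous_minus (V := R_NormedModule)).
    - apply continuous_Cmod, continuous_Cminus.
      + apply continuous_Cminus; [apply hc; lra|apply continuous_const].
      + apply continuous_Cmult; auto using continuous_const.
    - apply (continuous_Rmult (fun _ : C => 2 * M / (r * r))); [apply continuous_const|].
      apply continuous_Rmult; apply continuous_Cmod; auto. }
  assert (up : 0 < u z) by (unfold u; lra).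
  pose proof (proj1 (continuous_R_eps u z) cu (u z) up) as L.
  apply locally_C_eps in L. destruct L as (e & He & L).
  set (s := Rmin (e / 2) ((r / 2 - Cmod (z - z0)) / 2)).
  assert (Hs : 0 < s) by (apply Rmin_pos; lra).
  assert (Hs1 : s <= e / 2) by apply Rmin_l.
  assert (Hs2 : s <= (r / 2 - Cmod (z - z0)) / 2) by apply Rmin_r.
  set (w := (z + Ci * RtoC s)%C).
  assert (Ew : Cmod (w - z) = s).
  { unfold w. replace (z + Ci * RtoC s - z)%C with (Ci * RtoC s)%C by ring.
    rewrite Cmod_mult, Cmod_Ci, Cmod_R, Rabs_pos_eq; lra. }
  specialize (L w ltac:(lra)). apply Rabs_def2 in L.
  pose proof (Cmod_tri_minus w z z0) as T.
  assert (Iw : Im w = Im z + s).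
  { unfold w. rewrite im_plus, im_scal_r. simpl. ring. }
  specialize (Off w ltac:(lra) ltac:(lra)).
  assert (Uw : 0 < u w) by lra. unfold u in Uw. lra. }
exists d. split; [exact Bd|]. split; [exact All|].
apply is_Cderive_eps. intros eps He.
set (q := 2 * M / (r * r)) in *.
assert (Hq : 0 <= q) by (unfold q; apply Rdiv_le_0_compat; nra).
exists (Rmin (r / 2) (eps / (q + 1))). split.
{ apply Rmin_pos; [lra|apply Rdiv_lt_0_compat; lra]. }
intros w Hw. eapply Rle_trans; [apply All; eapply Rlt_le_trans; [exact Hw|apply Rmin_l]|].
assert (Cmod (w - z0) * (q + 1) <= eps).
{ apply Rle_div_r; [lra|]. left. eapply Rlt_le_trans; [exact Hw|apply Rmin_r]. }
pose proof (Cmod_ge_0 (w - z0)). nra.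
Qed.

Lemma closed_circle (z0 : C) (r : R) : closed (fun z => Cmod (z - z0) = r).
Proof.
apply closed_ext with (fun z => Cmod (z - z0) <= r /\ r <= Cmod (z - z0)).
- intros z. split; [lra|]. intros ->; lra.
- apply closed_and; apply closed_le; intros; auto using continuous_const_R, continuous_Cmod_minus.
Qed.

Lemma nearly_holo_Cdiff f z0 rho : 0 < rho -> nearly_holo f z0 rho -> Cdiff f z0.
Proof.
intros HR hf.
destruct (compact_bounded (fun z => Cmod (z - z0) = rho / 2) (Cmod z0 + rho / 2) (fun z => Cmod (f z)))
  as [M HM].
- intros z Hz. apply disc_bounded. lra.
- apply closed_circle.
- intros z Hz. apply continuous_Cmod. apply (proj1 hf). lra.
- destruct (taylor_bound f z0 rho (rho / 2) M hf) as (d & _ & _ & H); [lra|auto|].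
  now exists d.
Qed.

Lemma holo_nearly f z0 rho : (forall z, Cmod (z - z0) < rho -> Cdiff f z) -> nearly_holo f z0 rho.
Proof. intros H; split; auto. intros z Hz. apply Cdiff_continuous; auto. Qed.

(** A case of [nearly_holo_Cdiff], the singularity lying on the horizontal line
    through the centre. *)
Lemma removable_singularity f z0 rho : 0 < rho -> continuous f z0 ->
  (forall z, Cmod (z - z0) < rho -> z <> z0 -> Cdiff f z) -> Cdiff f z0.
Proof.
intros HR hc hd. apply (nearly_holo_Cdiff f z0 rho HR). split.
- intros z Hz. destruct (excluded_middle_informative (z = z0)) as [->|N]; auto.
  apply Cdiff_continuous; auto.
- intros z Hz N. apply hd; auto. intros ->. auto.
Qed.

Lemma Cdiff_slope f z0 l rho : 0 < rho -> is_Cderive f z0 l ->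
  (forall z, Cmod (z - z0) < rho -> Cdiff f z) ->
  forall z, Cmod (z - z0) < rho -> Cdiff (slope f z0 l) z.
Proof.
intros HR Hl hd z Hz. apply is_Cderive_slope in Hl.
assert (Off : forall w, Cmod (w - z0) < rho -> w <> z0 -> Cdiff (slope f z0 l) w)
  by (intros; apply Cdiff_slope_off; auto).
destruct (excluded_middle_informative (z = z0)) as [->|N]; auto.
now apply removable_singularity with rho.
Qed.

(** * Maximum principle, open mapping, Schwarz's lemma *)

(** Near 0 a value below [m] would lower the mean. *)
Lemma mean_extremal (h : R -> R) (m : R) :
  (forall t, 0 <= t <= 2 * PI -> continuous h t) ->
  (forall t, 0 <= t <= 2 * PI -> h t <= m) ->
  is_RInt h 0 (2 * PI) (2 * PI * m) -> h 0 = m.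
Proof.
intros hc hm hI. pose proof PI_RGT_0.
destruct (Rle_lt_or_eq_dec (h 0) m) as [L|E]; auto; [apply hm; lra|]. exfalso.
set (k := (m - h 0) / 2). assert (Hk : 0 < k) by (unfold k; lra).
pose proof (proj1 (continuous_R_eps h 0) (hc 0 ltac:(lra)) k Hk) as [e He].
set (s := Rmin (e / 2) PI).
assert (Hs : 0 < s) by (apply Rmin_pos; [pose proof (cond_pos e)|]; lra).
assert (Hs1 : s <= e / 2) by apply Rmin_l. assert (Hs2 : s <= PI) by apply Rmin_r.
assert (I : forall a b, 0 <= a <= b -> b <= 2 * PI -> ex_RInt h a b).
{ intros a b Ha Hb. apply (ex_RInt_continuous (V := R_CompleteNormedModule)).
  intros t. rewrite Rmin_left, Rmax_right by lra. intros Ht. apply hc. lra. }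
pose proof (RInt_correct _ _ _ (I 0 s ltac:(lra) ltac:(lra))) as I1.
pose proof (RInt_correct _ _ _ (I s (2 * PI) ltac:(lra) ltac:(lra))) as I2.
assert (B1 : RInt h 0 s <= s * (m - k)).
{ replace (s * (m - k)) with (scal (s - 0) (m - k)) by (unfold scal; simpl; unfold mult; simpl; ring).
  apply (is_RInt_le h (fun _ => m - k) 0 s); auto; [lra|apply (is_RInt_const (V := R_NormedModule))|].
  intros t Ht. specialize (He t).
  assert (Bt : ball 0 e t).
  { change (Rabs (t - 0) < e). rewrite Rminus_0_r, Rabs_pos_eq by lra. pose proof (cond_pos e). lra. }
  specialize (He Bt). apply Rabs_def2 in He. unfold k in *. lra. }
assert (B2 : RInt h s (2 * PI) <= (2 * PI - s) * m).
{ change ((2 * PI - s) * m) with (scal (2 * PI - s) m).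
  apply (is_RInt_le h (fun _ => m) s (2 * PI)); auto; [lra|apply (is_RInt_const (V := R_NormedModule))|].
  intros t Ht. apply hm. lra. }
pose proof (is_RInt_Chasles _ _ _ _ _ _ I1 I2) as I3.
assert (E : 2 * PI * m = RInt h 0 s + RInt h s (2 * PI)).
{ rewrite <- (is_RInt_unique _ _ _ _ hI). apply is_RInt_unique. exact I3. }
nra.
Qed.

(** The consequence of the mean value property on which the maximum principle
    rests. Imaginary parts and moduli of holomorphic functions both have it. *)
Definition spreads_max (u : C -> R) (z : C) (rho : R) : Prop :=
  forall r, 0 < r < rho -> (forall w, Cmod (w - z) = r -> u w <= u z) ->
    u (z + RtoC r)%C = u z.

Lemma circle_pt_0 z r : circle_pt z r 0 = (z + RtoC r)%C.
Proof.
unfold circle_pt. rewrite cos_0, sin_0. f_equal.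
unfold RtoC, Cmult; simpl. f_equal; ring.
Qed.

Lemma holo_circle_mean (F : C -> C) (z : C) rho r : (forall w, Cmod (w - z) < rho -> Cdiff F w) ->
  0 < r < rho -> is_CInt (fun t => F (circle_pt z r t)) 0 (2 * PI) (RtoC (2 * PI) * F z)%C.
Proof.
intros hd Hr. rewrite <- (circle_mean F z rho List.nil) with (r := r); auto.
- apply is_circle_int; [lra|]. intros w Hw. apply Cdiff_continuous, hd. lra.
- intros w Hw. apply Cdiff_continuous; auto.
- intros s t Hs _ _. apply hd. rewrite circle_pt_dist; lra.
Qed.

Lemma Im_spreads_max (F : C -> C) (z : C) rho : (forall w, Cmod (w - z) < rho -> Cdiff F w) ->
  spreads_max (fun w => Im (F w)) z rho.
Proof.
intros hd r Hr Hmax. cbv beta in *. rewrite <- (circle_pt_0 z r).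
apply (mean_extremal (fun t => Im (F (circle_pt z r t)))).
- intros t _. apply (continuous_comp (fun t => F (circle_pt z r t)) Im); [|apply continuous_Im].
  apply (continuous_comp (circle_pt z r) F); [apply continuous_circle_pt|].
  apply Cdiff_continuous, hd. rewrite circle_pt_dist; lra.
- intros t _. apply Hmax. apply circle_pt_dist. lra.
- pose proof (holo_circle_mean F z rho r hd Hr) as I. apply is_CInt_pair in I.
  rewrite im_scal_l in I. apply I.
Qed.

Lemma Cmod_spreads_max (F : C -> C) (z : C) rho : (forall w, Cmod (w - z) < rho -> Cdiff F w) ->
  spreads_max (fun w => Cmod (F w)) z rho.
Proof.
intros hd r Hr Hmax. cbv beta in *.
assert (Hc : Cmod (z + RtoC r - z) = r).
{ rewrite Cmod_plus_real; lra. }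
apply Rle_antisym; [now apply Hmax|].
destruct (Req_dec (Cmod (F z)) 0) as [E|N]; [rewrite E; apply Cmod_ge_0|].
pose proof (Cmod_ge_0 (F z)).
(* rotating F z to the positive real axis reduces the claim to real parts *)
set (e := (Ci * Cconj (F z))%C).
assert (Ee : Cmod e = Cmod (F z)) by (unfold e; rewrite Cmod_mult, Cmod_Ci, Cmod_conj; ring).
assert (I0 : Im (e * F z)%C = Cmod (F z) * Cmod (F z)).
{ unfold e. destruct (F z) as [x y]. rewrite Cmod_sqr. simpl. ring. }
pose proof (Im_spreads_max (fun w => e * F w)%C z rho) as S. specialize (S ltac:(
  intros w Hw; apply Cdiff_mult; [apply Cdiff_const|auto]) r Hr). cbv beta in S.
rewrite I0 in S.
assert (G : forall w, Im (e * F w)%C <= Cmod (F z) * Cmod (F w)).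
{ intros w. rewrite <- Ee, <- Cmod_mult. eapply Rle_trans; [apply Rle_abs|apply Im_le_Cmod]. }
specialize (G (z + RtoC r)%C). rewrite S in G.
- nra.
- intros w Hw. specialize (Hmax w Hw).
  eapply Rle_trans; [eapply Rle_trans; [apply Rle_abs|apply Im_le_Cmod]|].
  rewrite Cmod_mult, Ee. nra.
Qed.

(** A maximum exceeding [M] would spread to the right from the rightmost point
    at which it is attained. *)
Lemma max_principle (K : C -> Prop) (B : R) (u : C -> R) (M : R) :
  (forall z, K z -> Cmod z <= B) -> closed K -> (forall z, K z -> continuous u z) ->
  (forall z, K z -> u z <= M \/
     exists r, 0 < r /\ (forall w, Cmod (w - z) < r -> K w) /\ spreads_max u z r) ->
  forall z, K z -> u z <= M.
Proof.
intros HB Hcl hc hgood z0 Hz0.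
destruct (compact_max K B u HB Hcl (ex_intro _ z0 Hz0) hc) as [z1 [Hz1 Hmax]].
apply Rle_trans with (u z1); auto. apply Rnot_lt_le. intros Lt.
set (S := fun z => K z /\ u z = u z1).
assert (ClS : closed S).
{ intros z N. apply NNPP. intros NS. apply N.
  destruct (classic (K z)) as [Hz|Hz].
  - assert (D : u z <> u z1) by (intros E; apply NS; split; auto).
    assert (P : 0 < Rabs (u z1 - u z)) by (apply Rabs_pos_lt; lra).
    generalize (proj1 (continuous_R_eps u z) (hc z Hz) _ P). apply filter_imp.
    intros w Hw [_ E]. rewrite E in Hw. lra.
  - assert (L : locally z (fun w => ~ K w)) by (apply NNPP; intros NL; apply Hz, Hcl, NL).
    revert L. apply filter_imp. intros w Hw [Kw _]. auto. }
destruct (compact_max S B Re) as [z2 [[Hz2 E2] Hre]]; auto.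
- intros z [Hz _]. auto.
- exists z1. split; auto.
- intros z _. apply continuous_Re.
- destruct (hgood z2 Hz2) as [G|(r & Hr & HK & Sp)]; [lra|].
  assert (Hc : Cmod (z2 + RtoC (r / 2) - z2) = r / 2).
  { rewrite Cmod_plus_real; lra. }
  assert (E : u (z2 + RtoC (r / 2))%C = u z2).
  { apply Sp; [lra|]. intros w Hw. rewrite E2. apply Hmax, HK. lra. }
  assert (Q : Re (z2 + RtoC (r / 2))%C <= Re z2).
  { apply Hre. split; [apply HK; lra|]. now rewrite E. }
  rewrite re_plus, re_RtoC in Q. lra.
Qed.

Lemma max_modulus_disc (F : C -> C) z0 r M : 0 < r ->
  (forall z, Cmod (z - z0) <= r -> Cdiff F z) ->
  (forall z, Cmod (z - z0) = r -> Cmod (F z) <= M) ->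
  forall z, Cmod (z - z0) <= r -> Cmod (F z) <= M.
Proof.
intros Hr hd hM.
apply (max_principle (fun z => Cmod (z - z0) <= r) (Cmod z0 + r) (fun z => Cmod (F z))).
- intros z Hz. now apply disc_bounded.
- apply closed_disc.
- intros z Hz. apply continuous_Cmod, Cdiff_continuous; auto.
- intros z Hz. destruct (Rle_lt_or_eq_dec _ _ Hz) as [L|E]; auto.
  right. exists (r - Cmod (z - z0)).
  assert (T : forall w, Cmod (w - z) < r - Cmod (z - z0) -> Cmod (w - z0) <= r).
  { intros w Hw. pose proof (Cmod_tri_minus w z z0). lra. }
  split; [lra|]. split; auto. apply Cmod_spreads_max. auto.
Qed.

(** A value closer to [F z0] than to all values on a circle about [z0] is
    attained inside: otherwise [1/(F - w)] contradicts the maximum principle. *)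
Lemma value_attained (F : C -> C) z0 r w m : 0 < r ->
  (forall z, Cmod (z - z0) <= r -> Cdiff F z) ->
  (forall z, Cmod (z - z0) = r -> m <= Cmod (F z - w)) ->
  Cmod (F z0 - w) < m -> exists z, Cmod (z - z0) <= r /\ F z = w.
Proof.
intros Hr hd hm h0. apply NNPP. intros N.
assert (Nz : forall z, Cmod (z - z0) <= r -> (F z - w)%C <> RtoC 0).
{ intros z Hz E. apply N. exists z. split; auto.
  replace (F z) with ((F z - w) + w)%C by ring. rewrite E. ring. }
assert (Z0 : Cmod (z0 - z0) <= r).
{ rewrite Cmod_minus_self. lra. }
assert (P0 : 0 < Cmod (F z0 - w)) by (apply Cmod_gt_0; auto).
assert (H : Cmod (/ (F z0 - w))%C <= / m).
{ apply (max_modulus_disc (fun z => / (F z - w))%C z0 r); auto.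
  - intros z Hz. apply Cdiff_inv; auto. apply Cdiff_minus; auto using Cdiff_const.
  - intros z Hz. rewrite Cmod_inv by (apply Nz; lra). apply Rinv_le_contravar; [lra|auto]. }
rewrite Cmod_inv in H by auto.
assert (/ m < / Cmod (F z0 - w)) by (apply Rinv_lt_contravar; nra). lra.
Qed.

Lemma Cmod_le_sqr (z w : C) : Cmod z * Cmod z <= Cmod w * Cmod w -> Cmod z <= Cmod w.
Proof. intros H. pose proof (Cmod_ge_0 z). pose proof (Cmod_ge_0 w). nra. Qed.

(** Schwarz's lemma for maps of a disc into the upper half-plane, which the
    Cayley transform taking [W z0] to 0 maps onto the unit disc. *)
Lemma schwarz_half_plane (W : C -> C) z0 rho : 0 < rho ->
  (forall z, Cmod (z - z0) < rho -> Cdiff W z) ->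
  (forall z, Cmod (z - z0) < rho -> 0 < Im (W z)) ->
  forall z, Cmod (z - z0) < rho ->
    Cmod (W z - W z0) * rho <= Cmod (z - z0) * Cmod (W z - Cconj (W z0)).
Proof.
intros HR hd hI z Hz.
assert (Z0 : Cmod (z0 - z0) < rho).
{ rewrite Cmod_minus_self. lra. }
set (w0 := W z0). assert (Iw0 : 0 < Im w0) by (apply hI; auto).
assert (Nz : forall v, Cmod (v - z0) < rho -> (W v - Cconj w0)%C <> RtoC 0).
{ intros v Hv E. apply (f_equal Im) in E. unfold Cminus in E.
  rewrite im_plus, im_opp, im_conj in E. simpl in E. specialize (hI v Hv). lra. }
assert (Lt : forall v, Cmod (v - z0) < rho -> Cmod (W v - w0) <= Cmod (W v - Cconj w0)).
{ intros v Hv. apply Cmod_le_sqr. rewrite !Cmod_sqr. specialize (hI v Hv).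
  destruct (W v) as [a b]. destruct w0 as [p q]. simpl in *. nra. }
set (om := fun v => ((W v - w0) / (W v - Cconj w0))%C).
assert (dom : forall v, Cmod (v - z0) < rho -> Cdiff om v).
{ intros v Hv. apply Cdiff_div; auto; apply Cdiff_minus; auto using Cdiff_const. }
destruct (dom z0 Z0) as [l Hl].
pose proof (Cdiff_slope om z0 l rho HR Hl dom) as dsl.
assert (om0 : om z0 = RtoC 0).
{ unfold om. fold w0. replace (w0 - w0)%C with (RtoC 0) by ring. unfold Cdiv. ring. }
assert (om1 : forall v, Cmod (v - z0) < rho -> Cmod (om v) <= 1).
{ intros v Hv. unfold om. rewrite Cmod_div by auto.
  apply Rle_div_l; [apply Cmod_gt_0; auto|]. rewrite Rmult_1_l. auto. }
assert (Bd : forall r, Cmod (z - z0) < r < rho -> Cmod (om z) * r <= Cmod (z - z0)).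
{ intros r Hr. pose proof (Cmod_ge_0 (z - z0)).
  assert (S : Cmod (slope om z0 l z) <= / r).
  { apply (max_modulus_disc (slope om z0 l) z0 r); try lra.
    - intros v Hv. apply dsl. lra.
    - intros v Hv. rewrite slope_off.
      + rewrite om0. replace (om v - 0)%C with (om v) by ring.
        assert ((v - z0)%C <> RtoC 0).
        { intros E. rewrite E, Cmod_0 in Hv. lra. }
        rewrite Cmod_div, Hv by auto. rewrite <- (Rmult_1_l (/ r)).
        apply Rmult_le_compat_r; [left; apply Rinv_0_lt_compat; lra|apply om1; lra].
      + intros ->. rewrite Cmod_minus_self in Hv. lra. }
  assert (E : om z = ((z - z0) * slope om z0 l z)%C) by (rewrite slope_mult, om0; ring).
  rewrite E, Cmod_mult. pose proof (Cmod_ge_0 (slope om z0 l z)).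
  assert (Cmod (slope om z0 l z) * r <= 1).
  { apply Rmult_le_reg_r with (/ r); [apply Rinv_0_lt_compat; lra|].
    rewrite Rmult_assoc, Rinv_r, Rmult_1_r by lra. lra. }
  nra. }
assert (Fin : Cmod (om z) * rho <= Cmod (z - z0)).
{ apply Rnot_lt_le. intros L. pose proof (Cmod_ge_0 (z - z0)). pose proof (Cmod_ge_0 (om z)).
  set (x := Cmod (om z)) in *. set (y := Cmod (z - z0)) in *.
  assert (Px : 0 < x) by nra.
  assert (Y : y / x < rho) by (apply Rlt_div_l; nra).
  pose proof (Rmax_l y (y / x)). pose proof (Rmax_r y (y / x)).
  assert (Rmax y (y / x) < rho) by (apply Rmax_lub_lt; auto).
  specialize (Bd ((Rmax y (y / x) + rho) / 2) ltac:(lra)).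
  assert (y = y / x * x) by (field; lra). nra. }
unfold om in Fin. rewrite Cmod_div in Fin by auto.
assert (P : 0 < Cmod (W z - Cconj w0)) by (apply Cmod_gt_0; auto).
replace (Cmod (W z - w0)) with (Cmod (W z - w0) / Cmod (W z - Cconj w0) * Cmod (W z - Cconj w0)) by (field; lra).
nra.
Qed.

Lemma schwarz_derivative (W : C -> C) z0 rho l : 0 < rho ->
  (forall z, Cmod (z - z0) < rho -> Cdiff W z) ->
  (forall z, Cmod (z - z0) < rho -> 0 < Im (W z)) ->
  is_Cderive W z0 l -> Cmod l <= 2 * Im (W z0) / rho.
Proof.
intros HR hd hI Hl.
assert (Z0 : Cmod (z0 - z0) < rho).
{ rewrite Cmod_minus_self. lra. }
pose proof (is_Cderive_continuous _ _ _ Hl) as cW. apply is_Cderive_slope in Hl.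
set (u := fun z => Cmod (slope W z0 l z) * rho - Cmod (W z - Cconj (W z0))).
assert (cu : continuous u z0).
{ apply (continuous_minus (V := R_NormedModule)).
  - apply (continuous_Rmult (fun z => Cmod (slope W z0 l z))); [now apply continuous_Cmod|apply continuous_const].
  - apply continuous_Cmod, continuous_Cminus; [auto|apply continuous_const]. }
assert (u0 : u z0 = Cmod l * rho - 2 * Im (W z0)).
{ unfold u. rewrite slope_at. f_equal.
  replace (W z0 - Cconj (W z0))%C with (RtoC (2 * Im (W z0)) * Ci)%C.
  - rewrite Cmod_mult, Cmod_Ci, Cmod_R, Rabs_pos_eq; [ring|]. specialize (hI z0 Z0). lra.
  - destruct (W z0) as [a b]. unfold Cconj, Cminus, Cplus, Copp, Cmult, RtoC, Ci; simpl. f_equal; ring. }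
assert (Neg : u z0 <= 0).
{ apply Rnot_lt_le. intros L. pose proof (proj1 (continuous_R_eps u z0) cu _ L) as G.
  apply locally_C_eps in G. destruct G as (d & Hd & G).
  set (s := Rmin (d / 2) (rho / 2)).
  assert (Hs : 0 < s) by (apply Rmin_pos; lra).
  assert (Hs1 : s <= d / 2) by apply Rmin_l. assert (Hs2 : s <= rho / 2) by apply Rmin_r.
  set (w := (z0 + RtoC s)%C).
  assert (Hw : Cmod (w - z0) = s).
  { unfold w; rewrite Cmod_plus_real; lra. }
  specialize (G w ltac:(lra)). apply Rabs_def2 in G.
  assert (Uw : 0 < u w) by lra. unfold u in Uw.
  assert (Nw : w <> z0).
  { intros E. rewrite E in Hw. rewrite Cmod_minus_self in Hw. lra. }
  pose proof (schwarz_half_plane W z0 rho HR hd hI w ltac:(lra)) as S.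
  rewrite slope_off, Cmod_div in Uw by auto using Cminus_neq0. rewrite Hw in S, Uw.
  assert (Cmod (W w - W z0) / s * rho <= Cmod (W w - Cconj (W z0))).
  { apply Rmult_le_reg_r with s; auto.
    replace (Cmod (W w - W z0) / s * rho * s) with (Cmod (W w - W z0) * rho) by (field; lra). lra. }
  lra. }
apply Rle_div_r; lra.
Qed.

Lemma schwarz_modulus (W : C -> C) z0 rho z : 0 < rho ->
  (forall z, Cmod (z - z0) < rho -> Cdiff W z) ->
  (forall z, Cmod (z - z0) < rho -> 0 < Im (W z)) ->
  Cmod (z - z0) < rho -> Cmod (W z) * (rho - Cmod (z - z0)) <= 2 * rho * Cmod (W z0).
Proof.
intros HR hd hI Hz. pose proof (schwarz_half_plane W z0 rho HR hd hI z Hz) as S.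
pose proof (Cmod_minus_ge (W z) (W z0)) as T1.
assert (T2 : Cmod (W z - Cconj (W z0)) <= Cmod (W z) + Cmod (W z0)).
{ eapply Rle_trans; [apply Cmod_triangle|]. rewrite Cmod_opp, Cmod_conj. lra. }
pose proof (Cmod_ge_0 (z - z0)). pose proof (Cmod_ge_0 (W z0)). pose proof (Cmod_ge_0 (W z)).
nra.
Qed.

Lemma is_Cderive_real (G : C -> C) (t : R) (d : C) : is_Cderive G (RtoC t) d ->
  derivable_pt_lim (fun s => Re (G (RtoC s))) t (Re d).
Proof.
intros H eps He. destruct (proj1 (is_Cderive_eps _ _ _) H (eps / 2)) as (e & Hed & E); [lra|].
exists (mkposreal e Hed). intros h Hh1 Hh2. simpl in Hh2.
assert (Eh : (RtoC (t + h) - RtoC t)%C = RtoC h) by (rewrite RtoC_plus; ring).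
specialize (E (RtoC (t + h))). rewrite Eh, Cmod_R in E. specialize (E Hh2).
pose proof (Re_le_Cmod (G (RtoC (t + h)) - G (RtoC t) - d * RtoC h)%C) as K.
unfold Cminus in K at 1 2. rewrite !re_plus, !re_opp, re_scal_r in K.
assert (P : 0 < Rabs h) by now apply Rabs_pos_lt.
replace ((Re (G (RtoC (t + h))) - Re (G (RtoC t))) / h - Re d)
  with ((Re (G (RtoC (t + h))) + - Re (G (RtoC t)) + - (Re d * h)) / h) by (field; auto).
unfold Rdiv. rewrite Rabs_mult, Rabs_inv.
apply Rle_lt_trans with (eps / 2); [|lra].
apply Rle_div_l; [exact P|]. lra.
Qed.

(** The mean value theorem, for the component of [f] in the direction of
    [f b - f a]. *)
Lemma lipschitz_of_derivative (f : C -> C) (U : C -> Prop) (k : R) :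
  (forall a b t, U a -> U b -> 0 <= t <= 1 -> U (a + RtoC t * (b - a))%C) ->
  (forall z, U z -> exists l, is_Cderive f z l /\ Cmod l <= k) ->
  forall a b, U a -> U b -> Cmod (f b - f a) <= k * Cmod (b - a).
Proof.
intros hU hd a b Ha Hb.
set (e := Cconj (f b - f a)).
set (G := fun w => (e * f (a + w * (b - a)))%C).
assert (D : forall t, 0 <= t <= 1 -> exists d, is_Cderive G (RtoC t) d /\
  Cmod d <= Cmod e * (k * Cmod (b - a))).
{ intros t Ht. destruct (hd _ (hU a b t Ha Hb Ht)) as [l [Hl Bl]].
  pose proof (is_Cderive_plus (fun _ => a) (fun w => w * (b - a))%C (RtoC t) _ _ (is_Cderive_const a _)
    (is_Cderive_mult (fun w => w) (fun _ => (b - a)%C) (RtoC t) _ _ (is_Cderive_id _) (is_Cderive_const _ _))) as H1.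
  pose proof (is_Cderive_comp f (fun w => a + w * (b - a))%C (RtoC t) _ _ Hl H1) as H2.
  pose proof (is_Cderive_mult (fun _ => e) _ (RtoC t) _ _ (is_Cderive_const e _) H2) as H3.
  eexists. split; [exact H3|]. cbv beta.
  replace (0 * f (a + RtoC t * (b - a)) + e * (l * (0 + (1 * (b - a) + RtoC t * 0))))%C
    with (e * (l * (b - a)))%C by ring.
  rewrite !Cmod_mult. apply Rmult_le_compat_l; [apply Cmod_ge_0|].
  apply Rmult_le_compat_r; [apply Cmod_ge_0|auto]. }
assert (D' : forall t, exists d, 0 <= t <= 1 -> derivable_pt_lim (fun s => Re (G (RtoC s))) t d /\
   d <= Cmod e * (k * Cmod (b - a))).
{ intros t. destruct (classic (0 <= t <= 1)) as [Ht|Ht].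
  - destruct (D t Ht) as [d [H1 H2]]. exists (Re d). intros _. split.
    + now apply is_Cderive_real.
    + eapply Rle_trans; [|exact H2]. eapply Rle_trans; [apply Rle_abs|apply Re_le_Cmod].
  - exists 0. tauto. }
destruct (choice _ D') as [df Hdf].
destruct (MVT_cor2 (fun s => Re (G (RtoC s))) df 0 1 Rlt_0_1) as [c [Hc Hc']].
{ intros c Hc. now apply Hdf. }
cbv beta in Hc. destruct (Hdf c ltac:(lra)) as [_ B].
assert (E1 : Re (G (RtoC 1)) - Re (G (RtoC 0)) = Cmod e * Cmod (f b - f a)).
{ unfold G. replace (a + RtoC 1 * (b - a))%C with b by ring.
  replace (a + RtoC 0 * (b - a))%C with a by ring.
  unfold e. rewrite Cmod_conj, Cmod_sqr. destruct (f a), (f b). simpl. ring. }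
assert (E0 : Cmod e = Cmod (f b - f a)) by (unfold e; apply Cmod_conj).
rewrite E0 in *. rewrite E1 in Hc. pose proof (Cmod_ge_0 (f b - f a)) as P0.
destruct (Req_dec (Cmod (f b - f a)) 0) as [Z|Z].
- (* the bound [k] is nonnegative because it dominates the modulus of a derivative *)
  rewrite Z. destruct (hd a Ha) as [l [_ Bl]]. pose proof (Cmod_ge_0 l). pose proof (Cmod_ge_0 (b - a)). nra.
- apply Rmult_le_reg_l with (Cmod (f b - f a)); lra.
Qed.

(** * Inverses of injective holomorphic functions *)

Section InjectiveMap.
Context (U : C -> Prop) (g : C -> C).
Context (hU : forall z, U z -> locally z U).
Context (hg : forall z, U z -> Cdiff g z).
Context (hinj : forall z w, U z -> U w -> g z = g w -> z = w).

Lemma small_disc (z0 : C) s : U z0 -> 0 < s -> exists r, 0 < r <= s /\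
  forall z, Cmod (z - z0) <= r -> U z.
Proof.
intros H0 Hs. destruct (proj1 (locally_C_eps _ _) (hU z0 H0)) as (d & Hd & H).
exists (Rmin s (d / 2)). split; [split; [apply Rmin_pos; lra|apply Rmin_l]|].
intros z Hz. apply H. pose proof (Rmin_r s (d / 2)). lra.
Qed.

Lemma circle_gap z0 r : 0 < r -> (forall z, Cmod (z - z0) <= r -> U z) ->
  exists m, 0 < m /\ forall z, Cmod (z - z0) = r -> m <= Cmod (g z - g z0).
Proof.
intros Hr HU.
assert (Nz : forall z, Cmod (z - z0) = r -> (g z - g z0)%C <> RtoC 0).
{ intros z Hz. apply Cminus_neq0. intros E. apply hinj in E.
  - subst z. rewrite Cmod_minus_self in Hz. lra.
  - apply HU. lra.
  - apply HU. rewrite Cmod_minus_self. lra. }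
destruct (compact_max (fun z => Cmod (z - z0) = r) (Cmod z0 + r) (fun z => - Cmod (g z - g z0)))
  as [z1 [Hz1 Hmin]].
- intros z Hz. apply disc_bounded. lra.
- apply closed_circle.
- exists (circle_pt z0 r 0). apply circle_pt_dist. lra.
- intros z Hz. apply (continuous_opp (V := R_NormedModule)).
  apply continuous_Cmod, continuous_Cminus; [|apply continuous_const].
  apply Cdiff_continuous, hg, HU. lra.
- exists (Cmod (g z1 - g z0)). split; [apply Cmod_gt_0; auto|].
  intros z Hz. specialize (Hmin z Hz). lra.
Qed.

(** By injectivity [g] stays away from [g z0] on small circles about [z0]. *)
Lemma injective_open z0 s : U z0 -> 0 < s -> exists del, 0 < del /\
  forall w, Cmod (w - g z0) < del -> exists z, U z /\ Cmod (z - z0) <= s /\ g z = w.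
Proof.
intros H0 Hs. destruct (small_disc z0 s H0 Hs) as (r & Hr & HU).
destruct (circle_gap z0 r) as (m & Hm & Gap); [lra|auto|].
exists (m / 2). split; [lra|]. intros w Hw.
destruct (value_attained g z0 r w (m / 2)) as (z & Hz & E); auto.
- lra.
- intros z Hz. specialize (Gap z Hz). pose proof (Cmod_tri_minus (g z) w (g z0)). lra.
- now rewrite Cmod_minus_sym.
- exists z. repeat split; auto. lra.
Qed.

(** If the derivative vanished at [z0], the zero-free quotients
    [(g z - g a)/(z - a)] would be small at [z0] for [a] near [z0], although
    they are bounded below on a circle. *)
Lemma injective_derivative_neq0 (z0 l : C) : U z0 -> is_Cderive g z0 l -> l <> 0%C.
Proof.
intros H0 Hl Zl. subst l.
destruct (small_disc z0 1 H0 Rlt_0_1) as (r & Hr & HU).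
destruct (circle_gap z0 r) as (m & Hm & Gap); [lra|auto|].
pose proof (is_Cderive_continuous _ _ _ Hl) as cg.
assert (cs : continuous (slope g z0 0) z0) by (apply is_Cderive_slope; exact Hl).
destruct (proj1 (continuous_C_eps _ _) cg (m / 2)) as (d1 & Hd1 & G1); [lra|].
destruct (proj1 (continuous_C_eps _ _) cs (m / (4 * r))) as (d2 & Hd2 & G2);
  [apply Rdiv_lt_0_compat; lra|].
set (e := Rmin (r / 2) (Rmin (d1 / 2) (d2 / 2))).
assert (He : 0 < e) by (repeat apply Rmin_pos; lra).
assert (He1 : e <= r / 2) by apply Rmin_l.
assert (He2 : e <= d1 / 2) by (eapply Rle_trans; [apply Rmin_r|apply Rmin_l]).
assert (He3 : e <= d2 / 2) by (eapply Rle_trans; [apply Rmin_r|apply Rmin_r]).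
assert (Z0 : Cmod (z0 - z0) <= e).
{ rewrite Cmod_minus_self. lra. }
(* [g] is not constant near [z0], so its derivative does not vanish identically *)
assert (A : exists (a la : C), Cmod (a - z0) <= e /\ is_Cderive g a la /\ la <> RtoC 0).
{ apply NNPP. intros N.
  assert (Cst : Cmod (g (z0 + RtoC e)%C - g z0) <= 0 * Cmod (z0 + RtoC e - z0)).
  { apply (lipschitz_of_derivative g (fun z => Cmod (z - z0) <= e) 0); auto.
    - intros a b t Ha Hb Ht.
      replace (a + RtoC t * (b - a) - z0)%C with (RtoC (1 - t) * (a - z0) + RtoC t * (b - z0))%C
        by (rewrite RtoC_minus; ring).
      eapply Rle_trans; [apply Cmod_triangle|]. rewrite !Cmod_mult, !Cmod_R, !Rabs_pos_eq by lra. nra.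
    - intros z Hz. destruct (hg z (HU z ltac:(lra))) as [lz Hlz].
      exists lz. split; auto. destruct (excluded_middle_informative (lz = RtoC 0)) as [->|Nl].
      + rewrite Cmod_0; lra.
      + exfalso. apply N. exists z, lz. auto.
    - rewrite Cmod_plus_real; lra. }
  rewrite Rmult_0_l in Cst.
  assert (E : g (z0 + RtoC e)%C = g z0).
  { replace (g (z0 + RtoC e)%C) with ((g (z0 + RtoC e)%C - g z0) + g z0)%C by ring.
    rewrite (Cmod_eq_0 (g (z0 + RtoC e)%C - g z0)); [ring|].
    apply Rle_antisym; [auto|apply Cmod_ge_0]. }
  apply hinj in E; auto.
  - apply (f_equal Re) in E. rewrite re_plus, re_RtoC in E. lra.
  - apply HU. rewrite Cmod_plus_real; lra. }
destruct A as (a & la & Ha & Hla & Nla).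
assert (Na : a <> z0).
{ intros ->. apply Nla. apply (is_C_derive_unique g z0) in Hl, Hla. congruence. }
assert (Ua : U a) by (apply HU; lra).
assert (da : forall z, Cmod (z - z0) <= r -> Cdiff (slope g a la) z).
{ intros z Hz. destruct (excluded_middle_informative (z = a)) as [->|Nz].
  - destruct (small_disc a 1 Ua Rlt_0_1) as (ra & Hra & HUa).
    apply (Cdiff_slope g a la ra); auto; try lra.
    + intros w Hw. apply hg, HUa. lra.
    + rewrite Cmod_minus_self. lra.
  - apply Cdiff_slope_off; auto. }
assert (Nz : forall z, Cmod (z - z0) <= r -> slope g a la z <> RtoC 0).
{ intros z Hz E. destruct (excluded_middle_informative (z = a)) as [->|N].
  - rewrite slope_at in E. auto.
  - apply N. apply hinj; auto. pose proof (slope_mult g a la z) as S. rewrite E in S.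
    replace (g z) with ((g z - g a) + g a)%C by ring. rewrite <- S. ring. }
assert (Ga : Cmod (g a - g z0) < m / 2) by (apply G1; lra).
assert (Bd : Cmod (/ slope g a la z0) <= 4 * r / m).
{ apply (max_modulus_disc (fun z => / slope g a la z)%C z0 r); try lra.
  - intros z Hz. apply Cdiff_inv; auto.
  - intros z Hz. rewrite Cmod_inv by (apply Nz; lra).
    assert (Ez : z <> a) by (intros ->; lra).
    rewrite slope_off, Cmod_div by auto using Cminus_neq0.
    pose proof (Gap z Hz) as Gz.
    pose proof (Cmod_tri_minus (g z) (g a) (g z0)).
    pose proof (Cmod_tri_minus z z0 a) as T. rewrite (Cmod_minus_sym z0 a) in T.
    assert (P : 0 < Cmod (z - a)) by (apply Cmod_gt_0, Cminus_neq0; auto).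
    assert (Q : m / (4 * r) <= Cmod (g z - g a) / Cmod (z - a)).
    { assert (K : 0 < m / (4 * r)) by (apply Rdiv_lt_0_compat; lra).
      assert (K2 : m / (4 * r) * (2 * r) = m / 2) by (field; lra).
      set (k := m / (4 * r)) in *. apply (proj1 (Rle_div_r k _ _ P)).
      apply Rle_trans with (k * (2 * r)); [apply Rmult_le_compat_l|]; lra. }
    replace (4 * r / m) with (/ (m / (4 * r))) by (field; lra).
    apply Rinv_le_contravar; auto. apply Rdiv_lt_0_compat; lra. }
assert (Sym : slope g a la z0 = slope g z0 0 a).
{ rewrite !slope_off by auto. field. split; apply Cminus_neq0; auto. }
specialize (G2 a ltac:(lra)). rewrite slope_at in G2.
replace (slope g z0 0 a - 0)%C with (slope g z0 0 a) in G2 by ring.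
assert (Z : slope g a la z0 <> RtoC 0) by (apply Nz; lra).
rewrite Cmod_inv in Bd by auto. rewrite <- Sym in G2.
assert (P : 0 < Cmod (slope g a la z0)) by now apply Cmod_gt_0.
assert (/ (m / (4 * r)) < / Cmod (slope g a la z0)).
{ apply Rinv_lt_contravar; auto. apply Rmult_lt_0_compat; auto. lra. }
replace (/ (m / (4 * r))) with (4 * r / m) in * by (field; lra). lra.
Qed.

Lemma injective_inverse_Cdiff (p : C -> C) (V : C -> Prop) w :
  (forall v, V v -> U (p v) /\ g (p v) = v) -> (forall v, V v -> locally v V) -> V w -> Cdiff p w.
Proof.
intros hp hV Hw. destruct (hp w Hw) as [Uw Ew].
destruct (hg _ Uw) as [l Hl]. exists (/ l)%C. apply (is_Cderive_inverse g); auto.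
- apply continuous_C_eps. intros eps He.
  destruct (injective_open (p w) (eps / 2) Uw) as (d & Hd & O); [lra|].
  destruct (proj1 (locally_C_eps _ _) (hV w Hw)) as (d' & Hd' & HV).
  exists (Rmin d d'). split; [now apply Rmin_pos|]. intros v Hv.
  destruct (O v) as (z & Uz & Hz & E).
  { rewrite Ew. eapply Rlt_le_trans; [exact Hv|apply Rmin_l]. }
  destruct (hp v) as [Uv Ev]; [apply HV; eapply Rlt_le_trans; [exact Hv|apply Rmin_r]|].
  replace (p v) with z; [lra|]. apply hinj; auto. now rewrite E, Ev.
- now apply injective_derivative_neq0 with (p w).
- generalize (hV w Hw). apply filter_imp. intros v Hv. now apply hp.
Qed.

End InjectiveMap.

(** * Series of holomorphic functions *)

Lemma ex_series_dominated (a m : nat -> R) : (forall n, Rabs (a n) <= m n) -> ex_series m -> ex_series a.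
Proof. intros H Hm. exact (ex_series_le (V := R_CompleteNormedModule) a m H Hm). Qed.

Lemma Series_nonneg (m : nat -> R) : (forall n, 0 <= m n) -> ex_series m -> 0 <= Series m.
Proof.
intros H Hm. rewrite <- (Rmult_0_l (Series m)), <- Series_scal_l.
apply Series_le; auto. intros n. specialize (H n). lra.
Qed.

Section DominatedSeries.
Context (m : nat -> R) (hm : ex_series m).

Lemma ex_series_Re_Im (u : nat -> C) : (forall n, Cmod (u n) <= m n) ->
  ex_series (fun n => Re (u n)) /\ ex_series (fun n => Im (u n)).
Proof.
intros H. split; apply ex_series_dominated with m; auto; intros n;
 (eapply Rle_trans; [|apply H]); [apply Re_le_Cmod|apply Im_le_Cmod].
Qed.

Lemma CSeries_mult (c : C) (u : nat -> C) : (forall n, Cmod (u n) <= m n) ->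
  CSeries (fun n => c * u n)%C = (c * CSeries u)%C.
Proof.
intros H. destruct (ex_series_Re_Im u H) as [A B]. unfold CSeries, Cmult. cbn [fst snd Re Im]. f_equal.
- rewrite <- !Series_scal_l, <- Series_minus; [reflexivity| |];
   now apply (ex_series_scal (V := R_NormedModule)).
- rewrite <- !Series_scal_l, <- Series_plus; [reflexivity| |];
   now apply (ex_series_scal (V := R_NormedModule)).
Qed.

Lemma CSeries_bound (u : nat -> C) : (forall n, Cmod (u n) <= m n) -> Cmod (CSeries u) <= Series m.
Proof.
intros H. set (s := CSeries u).
assert (E : Re (Cconj s * s)%C = Cmod s * Cmod s).
{ rewrite Cmod_sqr. destruct s; simpl; ring. }
assert (Es : (Cconj s * s)%C = CSeries (fun n => Cconj s * u n)%C) by (unfold s; now rewrite CSeries_mult).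
rewrite Es in E. change (Series (fun n => Re (Cconj s * u n)%C) = Cmod s * Cmod s) in E.
assert (L : Cmod s * Cmod s <= Cmod s * Series m).
{ rewrite <- E, <- Series_scal_l.
  assert (Dm : ex_series (fun n => Cmod s * m n)) by (now apply (ex_series_scal (V := R_NormedModule))).
  assert (Dle : forall n, Rabs (Re (Cconj s * u n)%C) <= Cmod s * m n).
  { intros n. eapply Rle_trans; [apply Re_le_Cmod|]. rewrite Cmod_mult, Cmod_conj.
    apply Rmult_le_compat_l; [apply Cmod_ge_0|auto]. }
  eapply Rle_trans; [apply Rle_abs|]. eapply Rle_trans; [apply Series_Rabs|].
  - apply ex_series_dominated with (fun n => Cmod s * m n); auto.
    intros n. rewrite Rabs_Rabsolu. auto.
  - apply Series_le; auto. intros n. split; [apply Rabs_pos|auto]. }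
pose proof (Cmod_ge_0 s). destruct (Req_dec (Cmod s) 0) as [Z|Z].
- rewrite Z. apply Series_nonneg; auto.
  intros n. eapply Rle_trans; [apply Cmod_ge_0|apply H].
- nra.
Qed.

Lemma CSeries_minus (u v : nat -> C) : (forall n, Cmod (u n) <= m n) ->
  (forall n, Cmod (v n) <= m n) -> CSeries (fun n => u n - v n)%C = (CSeries u - CSeries v)%C.
Proof.
intros H K. destruct (ex_series_Re_Im u H) as [A B]. destruct (ex_series_Re_Im v K) as [A' B'].
unfold CSeries, Cminus, Cplus, Copp. cbn [fst snd Re Im]. f_equal.
- change (Series (fun n => Re (u n) - Re (v n)) = Series (fun n => Re (u n)) - Series (fun n => Re (v n))).
  now apply Series_minus.
- change (Series (fun n => Im (u n) - Im (v n)) = Series (fun n => Im (u n)) - Series (fun n => Im (v n))).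
  now apply Series_minus.
Qed.

End DominatedSeries.

Lemma CSeries_ext (u v : nat -> C) : (forall n, u n = v n) -> CSeries u = CSeries v.
Proof. intros H. f_equal. now apply functional_extensionality. Qed.

(** Weierstrass: Taylor's formula holds for the terms with summable errors. *)
Lemma Cdiff_CSeries (F : nat -> C -> C) (m : nat -> R) z0 rho : 0 < rho -> ex_series m ->
  (forall k z, Cmod (z - z0) < rho -> Cdiff (F k) z) ->
  (forall k z, Cmod (z - z0) < rho -> Cmod (F k z) <= m k) ->
  Cdiff (fun z => CSeries (fun k => F k z)) z0.
Proof.
intros HR hm hd hb.
assert (Z0 : Cmod (z0 - z0) < rho).
{ rewrite Cmod_minus_self. lra. }
assert (T : forall k, exists d, Cmod d <= m k / (rho / 2) /\
   forall z, Cmod (z - z0) < rho / 2 / 2 ->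
   Cmod (F k z - F k z0 - d * (z - z0)) <= 2 * m k / (rho / 2 * (rho / 2)) * (Cmod (z - z0) * Cmod (z - z0))).
{ intros k. destruct (taylor_bound (F k) z0 rho (rho / 2) (m k)) as (d & H1 & H2 & _); try lra.
  - apply holo_nearly. auto.
  - intros z Hz. apply hb. lra.
  - exists d. auto. }
destruct (choice _ T) as [d Hd]. clear T.
assert (m0 : forall k, 0 <= m k) by (intros k; eapply Rle_trans; [apply Cmod_ge_0|apply (hb k z0 Z0)]).
pose proof (Series_nonneg m m0 hm) as S0.
exists (CSeries d). apply is_Cderive_eps. intros eps He.
set (q := 8 / (rho * rho)). assert (Hq : 0 < q) by (unfold q; apply Rdiv_lt_0_compat; nra).
exists (Rmin (rho / 2 / 2) (eps / (q * Series m + 1))). split.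
{ apply Rmin_pos; [lra|]. apply Rdiv_lt_0_compat; nra. }
intros z Hz.
assert (Hz1 : Cmod (z - z0) < rho / 2 / 2) by (eapply Rlt_le_trans; [exact Hz|apply Rmin_l]).
assert (Hz2 : Cmod (z - z0) * (q * Series m + 1) <= eps).
{ apply Rle_div_r; [nra|]. left. eapply Rlt_le_trans; [exact Hz|apply Rmin_r]. }
assert (HzR : Cmod (z - z0) < rho) by lra.
set (h := Cmod (z - z0)) in *. assert (Hh : 0 <= h) by apply Cmod_ge_0.
(* a common majorant of all series involved *)
set (B := 2 + (2 / rho) * (1 + h) + q * (h * h)).
assert (HB : 0 <= 2 / rho) by (apply Rdiv_le_0_compat; lra).
set (M := fun k => B * m k).
assert (eM : ex_series M) by (now apply (ex_series_scal (V := R_NormedModule))).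
assert (K : forall k, 0 <= 2 / rho * m k /\ 0 <= 2 / rho * h * m k /\ 0 <= q * (h * h) * m k).
{ intros k. pose proof (m0 k). pose proof (Rmult_le_pos _ _ HB Hh).
  assert (0 <= q * (h * h)) by nra. repeat split; apply Rmult_le_pos; auto. }
assert (MB : forall k, M k = 2 * m k + 2 / rho * m k + 2 / rho * h * m k + q * (h * h) * m k)
  by (intros k; unfold M, B; ring).
assert (B1 : forall k, Cmod (F k z) <= M k).
{ intros k. rewrite MB. pose proof (hb k z HzR). pose proof (m0 k). specialize (K k). lra. }
assert (B2 : forall k, Cmod (F k z0) <= M k).
{ intros k. rewrite MB. pose proof (hb k z0 Z0). pose proof (m0 k). specialize (K k). lra. }
assert (B5 : forall k, Cmod (F k z - F k z0)%C <= M k).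
{ intros k. eapply Rle_trans; [apply Cmod_triangle|]. rewrite Cmod_opp, MB.
  pose proof (hb k z HzR). pose proof (hb k z0 Z0). pose proof (m0 k). specialize (K k). lra. }
assert (B3 : forall k, Cmod (d k) <= M k).
{ intros k. destruct (Hd k) as [H _]. replace (m k / (rho / 2)) with (2 / rho * m k) in H by (field; lra).
  rewrite MB. pose proof (m0 k). specialize (K k). lra. }
assert (B4 : forall k, Cmod ((z - z0) * d k)%C <= M k).
{ intros k. rewrite Cmod_mult. fold h. destruct (Hd k) as [H _].
  replace (m k / (rho / 2)) with (2 / rho * m k) in H by (field; lra).
  rewrite MB. pose proof (m0 k). specialize (K k).
  pose proof (Rmult_le_compat_l h _ _ Hh H). lra. }
replace (CSeries (fun k => F k z) - CSeries (fun k => F k z0) - CSeries d * (z - z0))%C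
  with (CSeries (fun k => F k z - F k z0 - (z - z0) * d k)%C).
2:{ rewrite (CSeries_minus M eM (fun k => F k z - F k z0)%C), (CSeries_minus M eM), (CSeries_mult M eM); auto.
  ring. }
apply Rle_trans with (Series (fun k => (q * (h * h)) * m k)).
- apply CSeries_bound; [now apply (ex_series_scal (V := R_NormedModule))|].
  intros k. destruct (Hd k) as [_ H]. specialize (H z Hz1). fold h in H.
  replace (F k z - F k z0 - (z - z0) * d k)%C with (F k z - F k z0 - d k * (z - z0))%C by ring.
  eapply Rle_trans; [exact H|]. right. unfold q. field. lra.
- rewrite Series_scal_l. nra.
Qed.

Lemma is_series_CSeries (u : nat -> C) (s : C) :
  is_series (V := C_NormedModule) u s -> CSeries u = s.
Proof.
intros H.
assert (L : forall f : C -> R, (forall z, continuous f z) ->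
   (forall n, f (sum_n u n) = sum_n (fun k => f (u k)) n) -> Series (fun k => f (u k)) = f s).
{ intros f cf ef. apply is_series_unique. apply filterlim_ext with (fun n => f (sum_n u n)); auto.
  apply (filterlim_comp _ _ _ (sum_n u) f _ (locally s)); [exact H|apply cf]. }
unfold CSeries. rewrite (L Re), (L Im).
- now destruct s.
- apply continuous_Im.
- induction n as [|n IH]; [now rewrite !sum_O|]. rewrite !sum_Sn, <- IH. reflexivity.
- apply continuous_Re.
- induction n as [|n IH]; [now rewrite !sum_O|]. rewrite !sum_Sn, <- IH. reflexivity.
Qed.

(** * The reciprocal of an admissible representation in the logarithmic coordinate *)

Lemma nroot_le_pow (n : nat) (x M : R) : (1 <= n)%nat -> 0 <= x -> nroot n x <= M -> x <= M ^ n.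
Proof.
intros Hn Hx. unfold nroot. destruct (Req_EM_T x 0) as [->|N]; intros H.
- now apply pow_le.
- assert (P : 0 < INR n) by (apply lt_0_INR; lia).
  replace x with (Rpower x (/ INR n) ^ n).
  + apply pow_incr. split; [left; apply exp_pos|auto].
  + rewrite <- Rpower_pow by apply exp_pos. rewrite Rpower_mult, Rinv_l, Rpower_1; lra.
Qed.

Lemma CSeries_conj (u : nat -> C) : CSeries (fun k => Cconj (u k)) = Cconj (CSeries u).
Proof.
unfold CSeries, Cconj. cbn [fst snd Re Im]. f_equal.
change (Series (fun k => - Im (u k)) = - Series (fun k => Im (u k))). apply Series_opp.
Qed.

Lemma coef_term_conj c n z k : coef_term c n (Cconj z) k = Cconj (coef_term c n z k).
Proof.
unfold coef_term. rewrite Cmult_conj, Cpow_conj. f_equal.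
unfold Cconj, RtoC; simpl. now rewrite Ropp_0.
Qed.

Definition row_sum (c : nat -> nat -> R) (n : nat) (z : C) : C := CSeries (coef_term c n z).

Lemma row_sum_conj c n z : row_sum c n (Cconj z) = Cconj (row_sum c n z).
Proof.
unfold row_sum. rewrite <- CSeries_conj. apply CSeries_ext. intros k. apply coef_term_conj.
Qed.

Definition log_sum (c : nat -> nat -> R) (l : C) : C :=
  CSeries (fun m => row_sum c (S m) (cexp l) / l ^ S m)%C.

(** The representation is [-2 pi / (a (l - log_shift c l))] at [exp l]. *)
Definition log_shift (c : nat -> nat -> R) (l : C) : C :=
  (l * log_sum c l / (1 + log_sum c l))%C.

Lemma cexp_conj l : cexp (Cconj l) = Cconj (cexp l).
Proof. destruct l. unfold cexp, Cconj; simpl. rewrite cos_neg, sin_neg. f_equal. ring. Qed.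

Lemma ex_geom (q : R) : 0 <= q < 1 -> ex_series (fun k => q ^ k).
Proof. intros H. apply ex_series_geom. rewrite Rabs_pos_eq; lra. Qed.

Section Chart.
Context (c : nat -> nat -> R) (r M : R) (hr : 0 < r) (hM : 0 < M).
Context (hsum : forall (n : nat) (z : C), (1 <= n)%nat -> Cmod z < r -> 0 <= Im z ->
  exists s : C, is_series (V := C_NormedModule) (coef_term c n z) s /\ nroot n (Cmod s) <= M).

Lemma row_sum_bound n z : (1 <= n)%nat -> Cmod z < r -> Cmod (row_sum c n z) <= M ^ n.
Proof.
intros Hn.
assert (Up : forall z, Cmod z < r -> 0 <= Im z -> Cmod (row_sum c n z) <= M ^ n).
{ intros w Hw Iw. destruct (hsum n w Hn Hw Iw) as (s & Hs & Bs).
  unfold row_sum. rewrite (is_series_CSeries _ _ Hs). apply nroot_le_pow; auto. apply Cmod_ge_0. }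
intros Hz. destruct (Rle_dec 0 (Im z)) as [H|H]; auto.
rewrite <- (Cmod_conj (row_sum c n z)), <- row_sum_conj. apply Up.
- now rewrite Cmod_conj.
- rewrite im_conj. lra.
Qed.

(** On discs of radius less than [x], the terms of a power series convergent at
    [x] are dominated by a geometric series. *)
Lemma row_sum_Cdiff n z : (1 <= n)%nat -> Cmod z < r -> Cdiff (row_sum c n) z.
Proof.
intros Hn Hz. set (x := (Cmod z + r) / 2). set (q := (Cmod z + x) / 2).
pose proof (Cmod_ge_0 z).
assert (Hx : Cmod z < x < r) by (unfold x; lra).
assert (Hq : Cmod z < q < x) by (unfold q; lra).
destruct (hsum n (RtoC x) Hn) as (s & Hs & _).
{ rewrite Cmod_R, Rabs_pos_eq; lra. }
{ simpl; lra. }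
assert (Bd : exists B, forall k, Rabs (c n k) * x ^ k <= B).
{ assert (L : is_lim_seq (fun k => c n k * x ^ k) 0).
  { apply ex_series_lim_0. exists (Re s).
    apply (filterlim_ext (fun m => Re (sum_n (coef_term c n (RtoC x)) m))).
    - intros m. induction m as [|m IH]; [rewrite !sum_O|rewrite !sum_Sn, <- IH; clear IH].
      + unfold coef_term. rewrite <- RtoC_pow. simpl. ring.
      + unfold coef_term. rewrite <- RtoC_pow.
        change (Re (sum_n (coef_term c n (RtoC x)) m + RtoC (c n (S m)) * RtoC (x ^ S m))%C
          = Re (sum_n (coef_term c n (RtoC x)) m) + c n (S m) * x ^ S m).
        rewrite re_plus, re_scal_l, re_RtoC. reflexivity.
    - apply (filterlim_comp _ _ _ (sum_n (coef_term c n (RtoC x))) Re _ (locally s)); [exact Hs|].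
      apply continuous_Re. }
  assert (Hb : bound (fun y => exists k, y = Rabs (c n k * x ^ k))).
  { assert (LR : Un_cv (fun k => c n k * x ^ k) 0) by now apply is_lim_seq_Reals.
    destruct (maj_by_pos _ (exist _ 0 LR)) as [B [_ HB]].
    exists B. intros y [k ->]. apply HB. }
  destruct Hb as [B HB]. exists B. intros k.
  replace (Rabs (c n k) * x ^ k) with (Rabs (c n k * x ^ k)).
  - apply HB. now exists k.
  - rewrite Rabs_mult, (Rabs_pos_eq (x ^ k)); auto. apply pow_le; lra. }
destruct Bd as [B HB].
apply (Cdiff_CSeries (fun k z => coef_term c n z k) (fun k => B * (q / x) ^ k) z (q - Cmod z)).
- lra.
- apply (ex_series_scal (V := R_NormedModule)). apply ex_geom. split.
  + apply Rdiv_le_0_compat; lra.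
  + apply Rlt_div_l; lra.
- intros k w _. apply Cdiff_mult; [apply Cdiff_const|]. apply Cdiff_pow, Cdiff_id.
- intros k w Hw. unfold coef_term. rewrite Cmod_mult, Cmod_R, Cmod_pow.
  assert (Hw' : Cmod w <= q) by (pose proof (Cmod_minus_ge w z); lra).
  unfold Rdiv. rewrite Rpow_mult_distr.
  assert (Px : 0 < x ^ k) by (apply pow_lt; lra).
  assert (Pq : Cmod w ^ k <= q ^ k) by (apply pow_incr; split; [apply Cmod_ge_0|auto]).
  assert (Pq0 : 0 <= q ^ k) by (apply pow_le; lra).
  rewrite pow_inv. specialize (HB k). pose proof (Rabs_pos (c n k)).
  apply Rle_trans with (Rabs (c n k) * q ^ k); [apply Rmult_le_compat_l; auto|].
  replace (Rabs (c n k) * q ^ k) with (Rabs (c n k) * x ^ k * (q ^ k * / x ^ k)) by (field; lra).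
  apply Rmult_le_compat_r; auto. apply Rmult_le_pos; auto. left; now apply Rinv_0_lt_compat.
Qed.

Context (R0 : R) (hR0 : 4 * M <= R0) (hR0r : exp (- R0) <= r).

Lemma far_left (l : C) : Re l < - R0 -> R0 < Cmod l /\ Cmod (cexp l) < r /\ l <> RtoC 0.
Proof.
intros H.
assert (K : R0 < Cmod l).
{ pose proof (Re_le_Cmod l) as A. rewrite Rabs_left in A; lra. }
split; auto. split.
- rewrite Cmod_cexp. eapply Rlt_le_trans; [apply exp_increasing; exact H|auto].
- intros E. rewrite E, Cmod_0 in K. lra.
Qed.

Lemma log_sum_term_bound (l : C) m : Re l < - R0 ->
  Cmod (row_sum c (S m) (cexp l) / l ^ S m)%C <= M / Cmod l * (/ 4) ^ m.
Proof.
intros H. destruct (far_left l H) as (A & B & N).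
rewrite Cmod_div by now apply Cpow_nz. rewrite Cmod_pow.
pose proof (row_sum_bound (S m) (cexp l) ltac:(lia) B) as D.
assert (P : 0 < Cmod l) by lra.
assert (P' : 0 < Cmod l ^ S m) by now apply pow_lt.
apply Rle_trans with (M ^ S m / Cmod l ^ S m).
- apply Rmult_le_compat_r; auto. left; now apply Rinv_0_lt_compat.
- replace (M ^ S m / Cmod l ^ S m) with (M / Cmod l * (M / Cmod l) ^ m).
  + apply Rmult_le_compat_l; [apply Rdiv_le_0_compat; lra|].
    apply pow_incr. split; [apply Rdiv_le_0_compat; lra|]. apply Rle_div_l; lra.
  + unfold Rdiv. rewrite Rpow_mult_distr, pow_inv. simpl. field. split; [apply pow_nonzero|]; lra.
Qed.

Lemma log_sum_bound (l : C) : Re l < - R0 -> Cmod (log_sum c l) <= M / Cmod l * (4 / 3).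
Proof.
intros H. replace (4 / 3) with (/ (1 - / 4)) by field.
rewrite <- Series_geom by (rewrite Rabs_pos_eq; lra). rewrite <- Series_scal_l.
apply CSeries_bound; [|intros m; now apply log_sum_term_bound].
apply (ex_series_scal (V := R_NormedModule)), ex_geom. lra.
Qed.

Lemma log_sum_small (l : C) : Re l < - R0 -> Cmod (log_sum c l) <= 1 / 3 /\
  Cmod l * Cmod (log_sum c l) <= 4 / 3 * M.
Proof.
intros H. destruct (far_left l H) as (A & _ & _). pose proof (log_sum_bound l H) as B. split.
- assert (M / Cmod l <= / 4) by (apply Rle_div_l; lra). lra.
- apply Rle_trans with (Cmod l * (M / Cmod l * (4 / 3))).
  + apply Rmult_le_compat_l; [lra|auto].
  + right. field. lra.
Qed.

Lemma log_sum_neq (l : C) : Re l < - R0 -> 2 / 3 <= Cmod (1 + log_sum c l)%C.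
Proof.
intros H. destruct (log_sum_small l H) as [A _].
pose proof (Cmod_minus_ge 1 (- log_sum c l)) as T. rewrite Cmod_opp, Cmod_1 in T.
replace (1 - - log_sum c l)%C with (1 + log_sum c l)%C in T by ring. lra.
Qed.

Lemma one_plus_log_sum_neq0 (l : C) : Re l < - R0 -> (1 + log_sum c l)%C <> RtoC 0.
Proof. intros H E. pose proof (log_sum_neq l H) as K. rewrite E, Cmod_0 in K. lra. Qed.

Lemma left_disc (l : C) : Re l < - R0 -> forall w, Cmod (w - l) < - R0 - Re l -> Re w < - R0.
Proof.
intros H w Hw. pose proof (Re_le_Cmod (w - l)%C) as K. unfold Cminus in K at 1.
rewrite re_plus, re_opp in K. apply Rabs_le_between in K. lra.
Qed.

Lemma log_sum_Cdiff (l : C) : Re l < - R0 -> Cdiff (log_sum c) l.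
Proof.
intros H.
apply (Cdiff_CSeries (fun m l => row_sum c (S m) (cexp l) / l ^ S m)%C (fun m => (/ 4) ^ m) l (- R0 - Re l)).
- lra.
- apply ex_geom. lra.
- intros m w Hw. assert (Hw' := left_disc l H w Hw). destruct (far_left w Hw') as (A & B & N).
  apply Cdiff_div.
  + apply (Cdiff_comp (row_sum c (S m)) cexp).
    * apply row_sum_Cdiff; auto. lia.
    * eexists; apply is_Cderive_cexp.
  + apply (Cdiff_pow (fun w => w) (S m)), Cdiff_id.
  + now apply Cpow_nz.
- intros m w Hw. assert (Hw' := left_disc l H w Hw).
  eapply Rle_trans; [now apply log_sum_term_bound|]. destruct (far_left w Hw') as (A & _ & _).
  rewrite <- (Rmult_1_l ((/ 4) ^ m)) at 2. apply Rmult_le_compat_r; [apply pow_le; lra|].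
  apply Rle_div_l; lra.
Qed.

Lemma log_shift_Cdiff (l : C) : Re l < - R0 -> Cdiff (log_shift c) l.
Proof.
intros H. apply Cdiff_div.
- apply Cdiff_mult; [apply Cdiff_id|now apply log_sum_Cdiff].
- apply Cdiff_plus; [apply Cdiff_const|now apply log_sum_Cdiff].
- now apply one_plus_log_sum_neq0.
Qed.

Lemma log_shift_bound (l : C) : Re l < - R0 -> Cmod (log_shift c l) <= 2 * M.
Proof.
intros H. unfold log_shift. rewrite Cmod_div by now apply one_plus_log_sum_neq0.
pose proof (log_sum_neq l H). apply Rle_div_l; [lra|].
rewrite Cmod_mult. destruct (log_sum_small l H) as [_ B]. nra.
Qed.

(** By Cauchy's estimate the derivative of the bounded function [log_shift] is
    small far away from the boundary of its half-plane. *)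
Lemma log_shift_lipschitz (l l' : C) : Re l < - (R0 + 8 * M + 1) -> Re l' < - (R0 + 8 * M + 1) ->
  Cmod (log_shift c l' - log_shift c l) <= / 4 * Cmod (l' - l).
Proof.
intros H H'.
apply (lipschitz_of_derivative (log_shift c) (fun w => Re w < - (R0 + 8 * M + 1))); auto.
- intros a b t Ha Hb Ht. rewrite re_plus, re_scal_l. unfold Cminus. rewrite re_plus, re_opp.
  cbv beta in *. destruct (Rle_dec (Re a) (Re b)); nra.
- intros w Hw.
  assert (D : forall v, Cmod (v - w) < 8 * M + 1 -> Re v < - R0).
  { intros v Hv. cbv beta in Hw. apply (left_disc w); lra. }
  destruct (taylor_bound (log_shift c) w (8 * M + 1) (8 * M) (2 * M)) as (d & B & _ & Hd).
  + apply holo_nearly. intros v Hv. apply log_shift_Cdiff; auto.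
  + lra.
  + intros v Hv. apply log_shift_bound, D. lra.
  + exists d. split; auto. eapply Rle_trans; [exact B|]. right. field. lra.
Qed.

Lemma log_shift_real (x : R) : x < - R0 -> Im (log_shift c (RtoC x)) = 0.
Proof.
intros H. set (l := RtoC x). assert (Hl : Re l < - R0) by exact H.
assert (Cl : Cconj l = l) by (unfold l, Cconj, RtoC; simpl; now rewrite Ropp_0).
destruct (far_left l Hl) as (_ & _ & N).
assert (E : log_sum c l = Cconj (log_sum c l)).
{ unfold log_sum at 2. rewrite <- CSeries_conj. apply CSeries_ext. intros m.
  rewrite Cdiv_conj by now apply Cpow_nz. rewrite <- row_sum_conj, Cpow_conj, <- cexp_conj, Cl. reflexivity. }
assert (E2 : log_shift c l = Cconj (log_shift c l)).
{ unfold log_shift at 2. rewrite Cdiv_conj by now apply one_plus_log_sum_neq0.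
  rewrite Cmult_conj, Cplus_conj, <- E, Cl. unfold log_shift. f_equal. f_equal.
  unfold Cconj, RtoC; simpl. now rewrite Ropp_0. }
apply (f_equal Im) in E2. rewrite im_conj in E2. lra.
Qed.

Lemma rep_cexp a (l : C) : 0 < a -> Re l < - R0 -> 0 <= Im l <= PI ->
  (rep a c (cexp l) * (RtoC (- a / (2 * PI)) * (l - log_shift c l)) = 1)%C.
Proof.
intros Ha H Hi. pose proof PI_RGT_0. destruct (far_left l H) as (_ & _ & N).
unfold rep. rewrite clog_cexp by auto.
replace (CSeries (rep_term c (cexp l))) with (log_sum c l).
2:{ apply CSeries_ext. intros m. unfold rep_term. now rewrite clog_cexp. }
unfold log_shift. pose proof (one_plus_log_sum_neq0 l H) as N1.
set (s := log_sum c l) in *.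
replace (RtoC (- a / (2 * PI))) with (RtoC a / RtoC (- 2 * PI))%C.
2:{ rewrite <- RtoC_div by lra. f_equal. field. lra. }
field. repeat split; auto; intros E; apply RtoC_eq_0 in E; lra.
Qed.

End Chart.

(** In the coordinate [l = log z] the reciprocal of the representation is a
    bounded, slowly varying perturbation of [- a l / (2 pi)]. The half-plane is
    not confined to the strip [0 <= Im l <= PI], so that a neighbourhood of both
    boundary arcs is covered. *)
Record log_chart (a : R) (c : nat -> nat -> R) (e : C -> C) (R1 B : R) : Prop := {
  chart_B : 0 < B < R1;
  chart_diff : forall l, Re l < - R1 -> Cdiff e l;
  chart_bound : forall l, Re l < - R1 -> Cmod (e l) <= B;
  chart_lip : forall l l', Re l < - R1 -> Re l' < - R1 -> Cmod (e l' - e l) <= / 4 * Cmod (l' - l);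
  chart_real : forall x : R, x < - R1 -> Im (e (RtoC x)) = 0;
  chart_rep : forall l, Re l < - R1 -> 0 <= Im l <= PI ->
    (rep a c (cexp l) * (RtoC (- a / (2 * PI)) * (l - e l)) = 1)%C }.

Lemma log_chart_exists a c : admissible a c -> exists e R1 B, log_chart a c e R1 B.
Proof.
intros [Ha _ (r & M & Hr & HM & Hsum) _ _].
set (R0 := Rmax (4 * M) (- ln r)).
assert (A : 4 * M <= R0) by apply Rmax_l.
assert (A' : exp (- R0) <= r).
{ rewrite <- (exp_ln r Hr).
  assert (K : - R0 <= ln r) by (pose proof (Rmax_r (4 * M) (- ln r)) as G; change (- ln r <= R0) in G; lra).
  destruct K as [K|K]; [left; now apply exp_increasing|rewrite K; lra]. }
exists (log_shift c), (R0 + 8 * M + 1), (2 * M). constructor; intros.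
- lra.
- eapply (log_shift_Cdiff c r M); eauto; lra.
- eapply (log_shift_bound c r M); eauto; lra.
- eapply (log_shift_lipschitz c r M); eauto; lra.
- eapply (log_shift_real c r M); eauto; lra.
- eapply (rep_cexp c r M); eauto; lra.
Qed.

(** * The domain near its cusp *)

Lemma interval_induction (P : R -> Prop) (a b : R) : a <= b -> P a ->
  (forall x, a <= x <= b -> exists d, 0 < d /\
     forall y, a <= y <= b -> Rabs (y - x) < d -> (P x <-> P y)) -> P b.
Proof.
intros Hab Ha Hloc.
set (E := fun x => a <= x <= b /\ forall y, a <= y <= x -> P y).
assert (Ea : E a).
{ split; [lra|]. intros y Hy. replace y with a by lra. auto. }
destruct (completeness E) as [m [Hm1 Hm2]].
{ exists b. intros x [Hx _]. lra. }
{ now exists a. }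
assert (Hm : a <= m <= b).
{ split; [apply Hm1; auto|]. apply Hm2. intros x [Hx _]. lra. }
destruct (Hloc m Hm) as (d & Hd & L).
(* [m] is approximated by points of [E], so [P m] holds *)
assert (X : exists x, E x /\ m - d < x).
{ apply NNPP. intros N. assert (m <= m - d); [|lra]. apply Hm2. intros x Hx.
  apply Rnot_lt_le. intros Hx'. apply N. now exists x. }
destruct X as (x & [Hx HPx] & Hxm).
assert (Hxm' : x <= m) by (apply Hm1; split; auto).
assert (Pm : P m).
{ apply (L x); [lra|rewrite Rabs_left1; lra|]. apply HPx. lra. }
assert (Em : forall y, a <= y <= b -> y < m + d -> P y).
{ intros y Hy Hyd. destruct (Rle_dec y x) as [Hyx|Hyx]; [apply HPx; lra|].
  apply (L y); auto. apply Rabs_def1; lra. }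
destruct (Rle_dec b (m + d / 2)) as [Hb|Hb]; [apply Em; lra|].
assert (m + d / 2 <= m); [|lra]. apply Hm1. split; [lra|]. intros y Hy. apply Em; lra.
Qed.

Lemma min_positive (h : R -> R) (a b : R) : a <= b ->
  (forall t, a <= t <= b -> continuous h t) -> (forall t, a <= t <= b -> 0 < h t) ->
  exists m, 0 < m /\ forall t, a <= t <= b -> m <= h t.
Proof.
intros Hab hc hp. destruct (continuity_ab_min h a b Hab) as (t0 & Ht0 & Hr).
- intros t Ht. apply continuity_pt_filterlim. now apply hc.
- exists (h t0). split; auto.
Qed.

(** A curve running inside a simple arc into its initial point covers an
    initial piece of the arc: it cannot jump over a point of it. *)
Lemma arc_initial_piece (p q : R -> C) (r : R) : 0 < r ->
  (forall t, 0 <= t <= 1 -> continuous p t) -> p 0 = RtoC 0 ->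
  (forall s t, 0 <= s <= 1 -> 0 <= t <= 1 -> p s = p t -> s = t) ->
  (forall s, 0 < s <= r -> continuous q s) -> (forall s, 0 < s <= r -> q s <> RtoC 0) ->
  (forall eps, 0 < eps -> exists s, 0 < s <= r /\ Cmod (q s) < eps) ->
  (forall s, 0 < s <= r -> exists t, 0 <= t <= 1 /\ q s = p t) ->
  exists rho, 0 < rho /\ forall t, 0 <= t <= 1 -> Cmod (p t) < rho ->
    p t = RtoC 0 \/ exists s, 0 < s <= r /\ p t = q s.
Proof.
intros Hr pc p0 pinj qc qn0 q0 qp.
assert (Tex : forall s, exists t, 0 < s <= r -> 0 <= t <= 1 /\ q s = p t).
{ intros s. destruct (classic (0 < s <= r)) as [Hs|Hs].
  - destruct (qp s Hs) as [t Ht]. now exists t.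
  - exists 0. tauto. }
destruct (choice _ Tex) as [T HT]. clear Tex.
assert (Tpos : forall s, 0 < s <= r -> 0 < T s).
{ intros s Hs. destruct (HT s Hs) as [[[A|A] _] E]; auto. exfalso.
  apply (qn0 s Hs). now rewrite E, <- A. }
assert (gap : forall t0 a b, 0 <= t0 <= 1 -> 0 <= a -> a <= b -> b <= 1 -> ~ a <= t0 <= b ->
  exists m, 0 < m /\ forall t, a <= t <= b -> m <= Cmod (p t - p t0)).
{ intros t0 a b Ht0 Ha Hab Hb N. apply min_positive; auto.
  - intros t Ht. apply continuous_Cmod, continuous_Cminus; [apply pc; lra|apply continuous_const].
  - intros t Ht. apply Cmod_gt_0, Cminus_neq0. intros E. apply pinj in E; [subst t; auto|lra|lra]. }
assert (Hr' : 0 < r <= r) by lra. destruct (HT r Hr') as [HT1 _]. pose proof (Tpos r Hr') as HT0.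
destruct (gap 0 (T r) 1) as (rho & Hrho & Grho); try lra.
exists rho. split; auto. intros t Ht Hpt.
destruct (Req_dec t 0) as [->|Nt]; auto. right. apply NNPP. intros N.
assert (Htr : t < T r).
{ apply Rnot_le_lt. intros L. specialize (Grho t ltac:(lra)). rewrite p0 in Grho.
  replace (p t - 0)%C with (p t) in Grho by ring. lra. }
assert (TN : forall s, 0 < s <= r -> T s <> t).
{ intros s Hs E. apply N. exists s. split; auto. rewrite <- E. symmetry. now apply HT. }
destruct (gap 0 t 1) as (m & Hm & Gm); try lra.
destruct (q0 m Hm) as (s0 & Hs0 & Qs0).
destruct (HT s0 Hs0) as [HTs0 Es0].
assert (Ls0 : T s0 < t).
{ apply Rnot_le_lt. intros L. specialize (Gm (T s0) ltac:(lra)). rewrite <- Es0, p0 in Gm.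
  replace (q s0 - 0)%C with (q s0) in Gm by ring. lra. }
assert (C : T r < t); [|lra].
apply (interval_induction (fun s => T s < t) s0 r); try lra.
intros s Hs. assert (Hs' : 0 < s <= r) by lra. destruct (HT s Hs') as [HTs Es].
assert (K : exists m', 0 < m' /\ forall v, 0 < v <= r -> Cmod (q v - q s) < m' -> (T s < t <-> T v < t)).
{ destruct (Rlt_dec (T s) t) as [L|L].
  - destruct (gap (T s) t 1) as (m' & Hm' & G'); try lra. exists m'. split; auto.
    intros v Hv Qv. destruct (HT v Hv) as [HTv Ev]. split; [|auto]. intros _.
    apply Rnot_le_lt. intros L'. specialize (G' (T v) ltac:(lra)). rewrite <- Ev, <- Es in G'. lra.
  - pose proof (TN s Hs'). destruct (gap (T s) 0 t) as (m' & Hm' & G'); try lra. exists m'. split; auto.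
    intros v Hv Qv. destruct (HT v Hv) as [HTv Ev]. split; [tauto|]. intros L'.
    specialize (G' (T v) ltac:(lra)). rewrite <- Ev, <- Es in G'. lra. }
destruct K as (m' & Hm' & K).
destruct (proj1 (continuous_to_C_eps q s) (qc s Hs') m' Hm') as [d Hd].
exists d. split; [apply cond_pos|]. intros v Hv Dv. apply K; [lra|]. apply Hd. exact Dv.
Qed.

(** Membership in [D] is locally constant off the boundary of [D]. *)
Lemma path_avoiding_boundary (D : C -> Prop) (gam : R -> C) :
  (forall t, 0 <= t <= 1 -> continuous gam t) ->
  (forall t, 0 <= t <= 1 -> ~ boundary D (gam t)) -> D (gam 0) -> D (gam 1).
Proof.
intros hc hb h0. apply (interval_induction (fun t => D (gam t)) 0 1); auto; [lra|].
intros t Ht. assert (N := hb t Ht).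
assert (L : locally (gam t) D \/ locally (gam t) (fun w => ~ D w)).
{ unfold boundary in N. tauto. }
assert (Ct : forall Q : C -> Prop, locally (gam t) Q -> exists d, 0 < d /\
  forall y, 0 <= y <= 1 -> Rabs (y - t) < d -> Q (gam y)).
{ intros Q HQ. destruct (hc t Ht Q HQ) as [d Hd]. exists d. split; [apply cond_pos|].
  intros y _ Hy. apply (Hd y Hy). }
destruct L as [L|L]; pose proof (locally_singleton _ _ L) as L0; cbv beta in L0;
 destruct (Ct _ L) as (d & Hd & H); exists d; split; auto; intros y Hy Dy;
 specialize (H y Hy Dy); cbv beta in H; tauto.
Qed.

Lemma segment_continuous (a b : C) t : continuous (fun t => a + RtoC t * (b - a))%C t.
Proof.
apply continuous_Cplus; [apply continuous_const|].
apply continuous_Cmult; [|apply continuous_const].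
apply continuous_pair_iff; split; simpl; [apply continuous_id|apply continuous_const].
Qed.

(** Directions that differ by [PI / 4] do not fit into a sector of opening
    [PI / 8], even modulo full turns. *)
Lemma zero_angle_directions (D : C -> Prop) (t1 t2 : R) : has_interior_angle D (RtoC 0) 0 ->
  Rabs (t1 - t2) = PI / 4 -> exists r, 0 < r /\ forall rho1 rho2, 0 < rho1 < r -> 0 < rho2 < r ->
    ~ (D (RtoC rho1 * (cos t1, sin t1))%C /\ D (RtoC rho2 * (cos t2, sin t2))%C).
Proof.
intros [th H] Ht. pose proof PI_RGT_0.
destruct (H (PI / 16)) as (r & Hr & A); [lra|].
exists r. split; auto. intros r1 r2 H1 H2 [D1 D2].
destruct (A r1 t1 H1) as [_ A1]. destruct (A r2 t2 H2) as [_ A2].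
rewrite Cplus_0_l in A1, A2. destruct (A1 D1) as [k1 K1]. destruct (A2 D2) as [k2 K2].
assert (E : Rabs (t1 - t2 + 2 * IZR (k1 - k2) * PI) < PI / 8).
{ rewrite minus_IZR. apply Rabs_def1; lra. }
assert (Z : (k1 - k2 <= -1 \/ k1 - k2 = 0 \/ 1 <= k1 - k2)%Z) by lia.
assert (Ht' : -(PI / 4) <= t1 - t2 <= PI / 4) by (apply Rabs_le_between; lra).
apply Rabs_def2 in E.
destruct Z as [Z|[Z|Z]].
- apply IZR_le in Z. nra.
- rewrite Z in E. replace (2 * 0 * PI) with 0 in E by ring.
  assert (Rabs (t1 - t2) < PI / 8) by (apply Rabs_def1; lra). lra.
- apply IZR_le in Z. nra.
Qed.

Section Cusp.
Context (a : R) (c : nat -> nat -> R) (e : C -> C) (R1 B : R) (ha : 0 < a).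
Context (hch : log_chart a c e R1 B).

Let k := a / (2 * PI).

Lemma k_pos : 0 < k.
Proof. pose proof PI_RGT_0. apply Rdiv_lt_0_compat; lra. Qed.

(** The reciprocal of the representation at [exp l]. *)
Definition recip (l : C) : C := (RtoC (- a / (2 * PI)) * (l - e l))%C.

Lemma recip_k l : recip l = (- RtoC k * (l - e l))%C.
Proof.
unfold recip. rewrite <- RtoC_opp. do 2 f_equal. unfold k. field. pose proof PI_RGT_0; lra.
Qed.

Lemma recip_Re l : Re (recip l) = - k * (Re l - Re (e l)).
Proof.
now rewrite recip_k, <- RtoC_opp, re_scal_l, re_minus.
Qed.

Lemma recip_Im l : Im (recip l) = - k * (Im l - Im (e l)).
Proof.
now rewrite recip_k, <- RtoC_opp, im_scal_l, im_minus.
Qed.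

Lemma e_Re_bound l : Re l < - R1 -> - B <= Re (e l) <= B.
Proof.
intros H. apply Rabs_le_between. eapply Rle_trans; [apply Re_le_Cmod|]. now apply (chart_bound _ _ _ _ _ hch).
Qed.

(** As [e] is real on the real axis, its imaginary part is controlled by the
    distance from there. *)
Lemma e_Im_bound l : Re l < - R1 -> Rabs (Im (e l)) <= / 4 * Rabs (Im l).
Proof.
intros H. pose proof (chart_lip _ _ _ _ _ hch (RtoC (Re l)) l H H) as L.
pose proof (chart_real _ _ _ _ _ hch (Re l) H) as Z.
rewrite (Cmod_vertical l) in L by reflexivity. simpl (Im (RtoC (Re l))) in L.
rewrite Rminus_0_r in L. eapply Rle_trans; [|exact L]. eapply Rle_trans; [|apply Im_minus_le].
rewrite Z, Rminus_0_r. apply Rle_refl.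
Qed.

Lemma recip_Im_bounds l : Re l < - R1 ->
  (0 <= Im l -> - k * (5 / 4 * Im l) <= Im (recip l) <= - k * (3 / 4 * Im l)) /\
  (Im l <= 0 -> - k * (3 / 4 * Im l) <= Im (recip l) <= - k * (5 / 4 * Im l)).
Proof.
intros H. pose proof (e_Im_bound l H) as E. rewrite recip_Im. pose proof k_pos.
split; intros I; [rewrite (Rabs_pos_eq (Im l)) in E by auto|rewrite (Rabs_left1 (Im l)) in E by auto];
 apply Rabs_le_between in E; nra.
Qed.

Lemma recip_Re_lower l : Re l < - R1 -> k * (- Re l - B) <= Re (recip l).
Proof. intros H. rewrite recip_Re. pose proof (e_Re_bound l H). pose proof k_pos. nra. Qed.

Lemma recip_neq0 l : Re l < - R1 -> recip l <> RtoC 0.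
Proof.
intros H E. pose proof (recip_Re_lower l H) as K. rewrite E in K. simpl in K.
pose proof k_pos. pose proof (chart_B _ _ _ _ _ hch). nra.
Qed.

Lemma Cmod_recip_upper l : Re l < - R1 -> Cmod (recip l) <= k * (- Re l + Rabs (Im l) + B).
Proof.
intros H. pose proof k_pos. rewrite recip_k, Cmod_mult, Cmod_opp, Cmod_R, Rabs_pos_eq by lra.
apply Rmult_le_compat_l; [lra|]. eapply Rle_trans; [apply Cmod_triangle|]. rewrite Cmod_opp.
pose proof (chart_bound _ _ _ _ _ hch l H). pose proof (Cmod_le_Re_Im l).
pose proof (chart_B _ _ _ _ _ hch). rewrite (Rabs_left (Re l)) in *; lra.
Qed.

Lemma recip_inj l l' : Re l < - R1 -> Re l' < - R1 -> recip l = recip l' -> l = l'.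
Proof.
intros H H' E. pose proof (chart_lip _ _ _ _ _ hch l l' H H') as L. pose proof k_pos.
assert (E' : (l' - l)%C = (e l' - e l)%C).
{ rewrite !recip_k in E. assert (N : RtoC k <> RtoC 0) by (intros Z; apply RtoC_eq_0 in Z; lra).
  transitivity (/ - RtoC k * (- RtoC k * (l' - e l')) - / - RtoC k * (- RtoC k * (l - e l)) + (e l' - e l))%C;
    [field; auto|rewrite <- E; ring]. }
rewrite <- E' in L. pose proof (Cmod_ge_0 (l' - l)).
assert (Z : (l' - l)%C = RtoC 0) by (apply Cmod_eq_0; lra).
replace l' with ((l' - l) + l)%C by ring. rewrite Z. ring.
Qed.

Lemma recip_Cdiff l : Re l < - R1 -> Cdiff recip l.
Proof.
intros H. apply Cdiff_mult; [apply Cdiff_const|].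
apply Cdiff_minus; [apply Cdiff_id|now apply (chart_diff _ _ _ _ _ hch)].
Qed.

(** On the circle of radius [5 B] about [- z / k], the solution for [e = 0], the
    distance of [recip] from [z] exceeds its value at the centre. *)
Lemma recip_surj z : k * (R1 + 6 * B) < Re z ->
  exists l, Re l < - R1 /\ recip l = z /\ Re z <= k * (- Re l + 5 * B).
Proof.
intros Hz. pose proof k_pos as Hk. pose proof (chart_B _ _ _ _ _ hch) as HB.
set (l0 := (RtoC (- / k) * z)%C).
assert (Rl0 : Re l0 = - (Re z / k)) by (unfold l0; rewrite re_scal_l; field; lra).
assert (Rz : R1 + 6 * B < Re z / k) by (apply Rlt_div_r; lra).
assert (Near : forall l, Cmod (l - l0) <= 5 * B -> Re l0 - 5 * B <= Re l <= Re l0 + 5 * B).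
{ intros l Hl. pose proof (Re_minus_le l l0) as K. apply Rabs_le_between in K. lra. }
assert (Dif : forall l, (recip l - z = - RtoC k * ((l - l0) - e l))%C).
{ intros l. rewrite recip_k. unfold l0. rewrite RtoC_opp, RtoC_inv by lra. field.
  intros Z. injection Z. lra. }
assert (Mod : forall l, Cmod (recip l - z) = k * Cmod ((l - l0) - e l)).
{ intros l. rewrite Dif, Cmod_mult, Cmod_opp, Cmod_R, Rabs_pos_eq; lra. }
destruct (value_attained recip l0 (5 * B) z (4 * k * B)) as (l & Hl & E).
- lra.
- intros l Hl. apply recip_Cdiff. specialize (Near l Hl). lra.
- intros l Hl. rewrite Mod. specialize (Near l ltac:(lra)).
  pose proof (chart_bound _ _ _ _ _ hch l ltac:(lra)). pose proof (Cmod_minus_ge (l - l0) (e l)). nra.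
- rewrite Mod. replace (l0 - l0 - e l0)%C with (- e l0)%C by ring. rewrite Cmod_opp.
  pose proof (chart_bound _ _ _ _ _ hch l0 ltac:(lra)). nra.
- exists l. specialize (Near l Hl). split; [lra|]. split; auto.
  assert (Re z = k * (Re z / k)) by (field; lra). nra.
Qed.

Lemma rep_recip (x : R) : x < 0 -> ln (- x) < - R1 -> rep a c (RtoC x) = (/ recip (ln (- x), PI))%C.
Proof.
intros Hx H. pose proof PI_RGT_0.
pose proof (chart_rep _ _ _ _ _ hch (ln (- x), PI) H) as E. simpl in E. specialize (E ltac:(lra)).
assert (X : cexp (ln (- x), PI) = RtoC x).
{ unfold cexp; simpl. rewrite exp_ln, cos_PI, sin_PI by lra. unfold RtoC. f_equal; ring. }
rewrite X in E. fold (recip (ln (- x), PI)) in E.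
pose proof (recip_neq0 (ln (- x), PI) H) as N.
replace (rep a c (RtoC x)) with (rep a c (RtoC x) * recip (ln (- x), PI) * / recip (ln (- x), PI))%C by (field; auto).
rewrite E. ring.
Qed.

Context (D : C -> Prop) (eps : R) (heps : 0 < eps).
Context (hD : open D) (hcusp : analytic_cusp D (real_segment 0 eps) (Gamma a c eps)).

(** A point [f x] with [x] away from 0 might also be close to 0. It then lies on
    the initial piece of the simple arc [Gamma], which is already covered by the
    points [f x] with [x] close to 0. *)
Lemma Gamma_near_0 : exists rho, 0 < rho /\ forall w, Gamma a c eps w -> Cmod w < rho ->
  w = RtoC 0 \/ exists l, Re l < - R1 /\ Im l = PI /\ w = (/ recip l)%C.
Proof.
destruct hcusp as (_ & _ & (p & p0 & _ & pd & pinj & pA) & _). pose proof PI_RGT_0. pose proof k_pos as Hk.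
set (r := Rmin eps (exp (- R1) / 2)).
assert (Hr : 0 < r) by (apply Rmin_pos; [lra|pose proof (exp_pos (- R1)); lra]).
assert (Hr1 : r <= eps) by apply Rmin_l.
assert (Hr2 : r < exp (- R1)).
{ pose proof (exp_pos (- R1)). pose proof (Rmin_r eps (exp (- R1) / 2)) as M. change (r <= exp (- R1) / 2) in M. lra. }
assert (Hl : forall s, 0 < s <= r -> ln s < - R1).
{ intros s Hs. rewrite <- (ln_exp (- R1)). apply ln_increasing; lra. }
set (q := fun s => (/ recip (ln s, PI))%C).
destruct (arc_initial_piece p q r Hr) as (rho & Hrho & A); auto.
- intros t Ht. destruct (pd t Ht) as (l & Hl' & _).
  apply (ex_derive_continuous (K := R_AbsRing) (V := C_R_NormedModule)). now exists l.
- intros s Hs. specialize (Hl s Hs). apply continuous_Cinv.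
  + apply (continuous_comp (fun s => (ln s, PI) : C) recip).
    * apply continuous_pair_iff; split; simpl; [|apply continuous_const].
      apply continuity_pt_filterlim, derivable_continuous_pt. exists (/ s). apply derivable_pt_lim_ln. lra.
    * now apply Cdiff_continuous, recip_Cdiff.
  + now apply recip_neq0.
- intros s Hs E. specialize (Hl s Hs). pose proof (recip_neq0 (ln s, PI) Hl) as N.
  apply (f_equal (fun z => z * recip (ln s, PI)))%C in E. unfold q in E.
  rewrite Cinv_l, Cmult_0_l in E by auto. injection E. lra.
- intros eta He. set (u := Rmin (ln r) (- (B + / (k * eta)) - 1)).
  assert (Hu1 : u <= ln r) by apply Rmin_l. assert (Hu2 : u <= - (B + / (k * eta)) - 1) by apply Rmin_r.
  assert (Hs : 0 < exp u <= r).
  { split; [apply exp_pos|]. rewrite <- (exp_ln r Hr). destruct Hu1 as [L|L]; [left; now apply exp_increasing|rewrite L; lra]. }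
  exists (exp u). split; auto. specialize (Hl _ Hs). unfold q.
  rewrite ln_exp in Hl |- *. rewrite Cmod_inv by now apply recip_neq0.
  assert (Hke : 0 < k * eta) by nra.
  pose proof (recip_Re_lower (u, PI) Hl) as L. change (Re (u, PI)) with u in L.
  pose proof (Rle_trans _ _ _ (Rle_abs _) (Re_le_Cmod (recip (u, PI)))) as L'.
  rewrite <- (Rinv_inv eta).
  assert (K : / eta < Cmod (recip (u, PI))).
  { assert (Fx : forall x y, 0 < x -> 0 < y -> / y = x * / (x * y)) by (intros; field; lra).
    pose proof (Fx k eta Hk He). pose proof (Rmult_le_compat_l k (/ (k * eta) + 1) (- u - B) ltac:(lra) ltac:(lra)). lra. }
  apply Rinv_lt_contravar; auto. apply Rmult_lt_0_compat; [now apply Rinv_0_lt_compat|].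
  assert (0 < / eta) by now apply Rinv_0_lt_compat. lra.
- intros s Hs. apply (proj1 (pA (q s))). right. exists (- s). split; [lra|].
  rewrite rep_recip; rewrite ?Ropp_involutive; auto. lra.
- exists rho. split; auto. intros w Hw Hm. apply pA in Hw. destruct Hw as (t & Ht & ->).
  destruct (A t Ht Hm) as [E|(s & Hs & E)]; auto.
  right. exists (ln s, PI). simpl. split; auto.
Qed.

(** The positive axis is the image of the line [Im l = 0], because [recip] takes
    all values in a right half-plane and is real on this line only. The line
    [Im l = PI] covers [Gamma] by [Gamma_near_0]. *)
Lemma boundary_near_0 : exists K, 0 < K /\
  (forall z, K < Cmod z -> boundary D (/ z)%C ->
     exists l, Re l < - R1 /\ (Im l = 0 \/ Im l = PI) /\ z = recip l) /\
  (forall l, Re l < - R1 -> (Im l = 0 \/ Im l = PI) -> K < Cmod (recip l) -> ~ D (/ recip l)%C).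
Proof.
pose proof PI_RGT_0. pose proof k_pos as Hk. pose proof (chart_B _ _ _ _ _ hch) as HB.
destruct Gamma_near_0 as (rho & Hrho & HG).
destruct hcusp as (_ & _ & _ & (r & Hr & Hb) & _).
(* each summand enforces one of the conditions met below *)
set (K := / rho + / r + / eps + k * (R1 + 6 * B) + k * (PI + B + Rabs (ln eps)) + 1).
assert (0 < / rho) by now apply Rinv_0_lt_compat. assert (0 < / r) by now apply Rinv_0_lt_compat.
assert (0 < / eps) by now apply Rinv_0_lt_compat.
assert (0 < k * (R1 + 6 * B)) by (apply Rmult_lt_0_compat; lra).
pose proof (Rabs_pos (ln eps)).
assert (0 < k * (PI + B + Rabs (ln eps))) by (apply Rmult_lt_0_compat; lra).
assert (small : forall u x, 0 < u -> 0 < x -> / x < / u -> u < x).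
{ intros u x Hu Hx L. apply Rinv_lt_contravar in L; [|apply Rmult_lt_0_compat; apply Rinv_0_lt_compat; auto].
  now rewrite !Rinv_inv in L. }
exists K. split; [unfold K; lra|]. split.
- intros z Kz Bw.
  assert (Nz : z <> RtoC 0) by (intros E; rewrite E, Cmod_0 in Kz; unfold K in Kz; lra).
  assert (Iz : (/ / z)%C = z) by (field; auto).
  pose proof (Cinv_neq_0 z Nz) as Nw.
  set (w := (/ z)%C) in *. assert (Pw : 0 < Cmod w) by now apply Cmod_gt_0.
  assert (Kw : K < / Cmod w) by (rewrite <- Cmod_inv, Iz by auto; exact Kz).
  rewrite <- Iz. clear Iz Nz Kz. clearbody w. clear z.
  assert (W1 : Cmod w < rho) by (apply small; auto; unfold K in Kw; lra).
  assert (W2 : Cmod w < r) by (apply small; auto; unfold K in Kw; lra).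
  apply Hb in Bw; auto. destruct Bw as [(t & Ht & ->)|Gw].
  + assert (t <> 0) by (intros ->; auto).
    rewrite Cmod_R, Rabs_pos_eq in * by lra.
    destruct (recip_surj (RtoC (/ t))) as (l & Hl & E & _); [simpl; unfold K in Kw; lra|].
    exists l. split; auto. split; [|rewrite E, RtoC_inv by auto; reflexivity]. left.
    assert (Z : Im (recip l) = 0) by now rewrite E.
    destruct (recip_Im_bounds l Hl) as [P N].
    destruct (Rtotal_order (Im l) 0) as [L|[L|L]]; auto.
    * specialize (N ltac:(lra)). nra.
    * specialize (P ltac:(lra)). nra.
  + destruct (HG w Gw W1) as [E|(l & Hl & Il & E)]; [tauto|].
    exists l. repeat split; auto. rewrite E. field. now apply recip_neq0.
- intros l Hl Il Kl Dl.
  pose proof (recip_neq0 l Hl) as N. assert (P : 0 < Cmod (recip l)) by now apply Cmod_gt_0.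
  set (w := (/ recip l)%C) in *.
  assert (Mw : Cmod w = / Cmod (recip l)) by (unfold w; now rewrite Cmod_inv).
  assert (Pw : 0 < Cmod w) by (rewrite Mw; now apply Rinv_0_lt_compat).
  assert (W1 : Cmod w < r) by (apply small; auto; rewrite Mw, Rinv_inv; unfold K in Kl; lra).
  assert (W2 : Cmod w < eps) by (apply small; auto; rewrite Mw, Rinv_inv; unfold K in Kl; lra).
  assert (Bw : boundary D w).
  { apply Hb; auto. pose proof (recip_Re_lower l Hl) as RL. destruct Il as [Il|Il].
    - left. exists (/ Re (recip l)).
      assert (E : recip l = RtoC (Re (recip l))).
      { destruct (recip_Im_bounds l Hl) as [A _]. specialize (A ltac:(lra)). rewrite Il in A.
        destruct (recip l) as [x y]; simpl in *. unfold RtoC; f_equal. lra. }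
      assert (Rp : 0 < Re (recip l)) by nra.
      assert (Ew : w = RtoC (/ Re (recip l))) by (unfold w; rewrite E at 1; rewrite RtoC_inv; [reflexivity|lra]).
      split; auto. assert (0 < / Re (recip l)) by now apply Rinv_0_lt_compat.
      rewrite Ew, Cmod_R, Rabs_pos_eq in W2; lra.
    - right. right. exists (- exp (Re l)).
      assert (RLe : Re l < - Rabs (ln eps)).
      { pose proof (Cmod_recip_upper l Hl) as U. rewrite Il, Rabs_pos_eq in U by lra. unfold K in Kl. nra. }
      assert (exp (Re l) <= eps).
      { rewrite <- (exp_ln eps heps). left. apply exp_increasing.
        pose proof (Rle_abs (- ln eps)) as A. rewrite Rabs_Ropp in A. lra. }
      pose proof (exp_pos (Re l)). split; [lra|].
      rewrite rep_recip; rewrite ?Ropp_involutive, ?ln_exp; auto; [|lra].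
      unfold w. do 2 f_equal. destruct l; simpl in *; subst; auto. }
  apply (proj1 Bw). apply hD. exact Dl.
Qed.

(** Parts of the plane in which [1/w] lies far above or below the real axis
    would be contained in [D] as a whole, contradicting the interior angle 0. *)
Lemma no_far_points K : 0 < K ->
  (forall z, K < Cmod z -> boundary D (/ z)%C ->
     exists l, Re l < - R1 /\ (Im l = 0 \/ Im l = PI) /\ z = recip l) ->
  exists H, 0 < H /\ forall z, H < Rabs (Im z) -> ~ D (/ z)%C.
Proof.
intros HK Hb. pose proof PI_RGT_0 as HPI. pose proof k_pos as Hk.
exists (K + k * (5 / 4 * PI)). split; [nra|]. intros z Hz Dz.
set (H := K + k * (5 / 4 * PI)) in *.
assert (HHp : 0 < H) by (unfold H; nra).
set (sg := if Rle_dec 0 (Im z) then 1 else -1).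
assert (sg2 : sg * sg = 1) by (unfold sg; destruct Rle_dec; ring).
assert (Hz' : H < sg * Im z).
{ unfold sg. destruct Rle_dec as [L|L]; [rewrite Rabs_pos_eq in Hz|rewrite Rabs_left in Hz]; lra. }
assert (Nb : forall v, H < sg * Im v -> v <> RtoC 0 /\ ~ boundary D (/ v)%C).
{ intros v Hv. assert (HK' : K <= H) by (unfold H; nra).
  assert (Av : H < Rabs (Im v)).
  { eapply Rlt_le_trans; [exact Hv|]. replace (Rabs (Im v)) with (Rabs (sg * Im v)); [apply Rle_abs|].
    rewrite Rabs_mult. replace (Rabs sg) with 1; [ring|]. unfold sg. destruct Rle_dec; [rewrite Rabs_pos_eq|rewrite Rabs_left]; lra. }
  assert (Nv : v <> RtoC 0) by (intros E; rewrite E in Av; simpl in Av; rewrite Rabs_R0 in Av; lra).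
  split; auto. intros Bv.
  destruct (Hb v) as (l & Hl & Il & E); auto.
  - eapply Rlt_le_trans; [|apply Im_le_Cmod]. lra.
  - destruct (recip_Im_bounds l Hl) as [P _].
    assert (Hb' : 0 <= Im l <= PI) by (destruct Il; lra). specialize (P (proj1 Hb')). rewrite <- E in P.
    assert (Rabs (Im v) <= k * (5 / 4 * PI)) by (apply Rabs_le; nra). unfold H in Av. lra. }
assert (All : forall v, H < sg * Im v -> D (/ v)%C).
{ intros v Hv.
  assert (Seg : forall t, 0 <= t <= 1 -> H < sg * Im (z + RtoC t * (v - z))%C).
  { intros t Ht. rewrite Im_segment.
    replace (sg * _) with ((1 - t) * (sg * Im z) + t * (sg * Im v)) by ring.
    destruct (Rle_dec (sg * Im z) (sg * Im v)); nra. }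
  replace v with (z + RtoC 1 * (v - z))%C by ring.
  apply (path_avoiding_boundary D (fun t => / (z + RtoC t * (v - z)))%C).
  - intros t Ht. apply continuous_Cinv; [apply segment_continuous|]. now apply Nb, Seg.
  - intros t Ht. now apply Nb, Seg.
  - now replace (z + RtoC 0 * (v - z))%C with z by ring. }
destruct hcusp as (_ & _ & _ & _ & ang).
destruct (zero_angle_directions D (- sg * (PI / 2)) (- sg * (PI / 4)) ang) as (r & Hr & A).
{ replace (- sg * (PI / 2) - - sg * (PI / 4)) with (- sg * (PI / 4)) by field.
  unfold sg. destruct Rle_dec; [rewrite Rabs_left|rewrite Rabs_pos_eq]; lra. }
set (T := H + 1 + / r). assert (0 < / r) by now apply Rinv_0_lt_compat.
assert (HT : H < T /\ 0 < T) by (unfold T; lra).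
assert (Tr : / T < r).
{ rewrite <- (Rinv_inv r). apply Rinv_lt_contravar; [apply Rmult_lt_0_compat; lra|]. unfold T; lra. }
assert (HTp : 0 < / T) by (apply Rinv_0_lt_compat; lra).
assert (Sq : 1 <= sqrt 2) by (rewrite <- sqrt_1; apply sqrt_le_1; lra).
assert (Sq2 : sqrt 2 * sqrt 2 = 2) by (apply sqrt_sqrt; lra).
assert (cs : forall x, cos (- sg * x) = cos x /\ sin (- sg * x) = - sg * sin x).
{ intros x. unfold sg. destruct Rle_dec.
  - replace (- (1) * x) with (- x) by ring. rewrite cos_neg, sin_neg. split; ring.
  - replace (- -1 * x) with x by ring. split; ring. }
set (v1 := (0, sg * T) : C). set (v2 := (T, sg * T) : C).
destruct (A (/ T) (/ T / sqrt 2)).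
- lra.
- split; [apply Rdiv_lt_0_compat; lra|]. apply Rle_lt_trans with (/ T); auto.
  apply Rle_div_l; [lra|]. nra.
- split.
  + replace (RtoC (/ T) * _)%C with (/ v1)%C; unfold v1.
    * apply All. simpl. replace (sg * (sg * T)) with (sg * sg * T) by ring. rewrite sg2. lra.
    * rewrite (proj1 (cs _)), (proj2 (cs _)), cos_PI2, sin_PI2.
      unfold Cinv, Cmult, RtoC; simpl. f_equal.
      -- unfold Rdiv; ring.
      -- replace (0 * (0 * 1) + sg * T * (sg * T * 1)) with (sg * sg * (T * T)) by ring. rewrite sg2. field. lra.
  + replace (RtoC (/ T / sqrt 2) * _)%C with (/ v2)%C; unfold v2.
    * apply All. simpl. replace (sg * (sg * T)) with (sg * sg * T) by ring. rewrite sg2. lra.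
    * rewrite (proj1 (cs _)), (proj2 (cs _)), cos_PI4, sin_PI4.
      unfold Cinv, Cmult, RtoC; simpl.
      replace (T * (T * 1) + sg * T * (sg * T * 1)) with (T * T * (1 + sg * sg)) by ring. rewrite sg2.
      assert (Q : / T / sqrt 2 * (1 / sqrt 2) = / (2 * T)).
      { replace (/ T / sqrt 2 * (1 / sqrt 2)) with (/ (T * (sqrt 2 * sqrt 2))) by (field; lra). rewrite Sq2. f_equal; ring. }
      f_equal.
      -- rewrite Rmult_0_l, Rminus_0_r, Q. field. lra.
      -- rewrite Rmult_0_l, Rplus_0_r.
         replace (/ T / sqrt 2 * (- sg * (1 / sqrt 2))) with (- sg * (/ T / sqrt 2 * (1 / sqrt 2))) by ring.
         rewrite Q. field. lra.
Qed.

(** In the coordinate [l] a path can meet the boundary of [D] only on the lines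
    [Im l = 0] and [Im l = PI]. *)
Lemma chart_path K l l' :
  (forall z, K < Cmod z -> boundary D (/ z)%C ->
     exists l, Re l < - R1 /\ (Im l = 0 \/ Im l = PI) /\ z = recip l) ->
  (forall t, 0 <= t <= 1 -> let v := (l + RtoC t * (l' - l))%C in
     Re v < - R1 /\ Im v <> 0 /\ Im v <> PI /\ K < k * (- Re v - B)) ->
  D (/ recip l)%C -> D (/ recip l')%C.
Proof.
intros Hb Hv Dl. replace l' with (l + RtoC 1 * (l' - l))%C by ring.
apply (path_avoiding_boundary D (fun t => / recip (l + RtoC t * (l' - l)))%C).
- intros t Ht. destruct (Hv t Ht) as (A & _). apply continuous_Cinv; [|now apply recip_neq0].
  apply (continuous_comp (fun t => l + RtoC t * (l' - l))%C recip); [apply segment_continuous|].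
  now apply Cdiff_continuous, recip_Cdiff.
- intros t Ht Bd. destruct (Hv t Ht) as (A & I0 & I1 & L). cbv zeta in *.
  set (v := (l + RtoC t * (l' - l))%C) in *.
  pose proof (recip_neq0 v A) as N.
  destruct (Hb (recip v)) as (u & Hu & Iu & E); auto.
  + pose proof (recip_Re_lower v A).
    pose proof (Rle_trans _ _ _ (Rle_abs _) (Re_le_Cmod (recip v))). lra.
  + apply recip_inj in E; auto. subst u. tauto.
- now replace (l + RtoC 0 * (l' - l))%C with l by ring.
Qed.

(** A point of [D] near 0 outside the image of the half-strip could be moved along
    a vertical line, in the coordinate [1 / w] or in the coordinate [l], to a
    point excluded by [no_far_points] without meeting the boundary. *)
Lemma cusp_chart : exists R2 rho, R1 <= R2 /\ 0 < rho /\
  (forall w, D w -> Cmod w < rho ->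
     exists l, Re l < - R2 /\ 0 < Im l < PI /\ w = (/ recip l)%C) /\
  (forall l, Re l < - R2 -> 0 < Im l < PI -> D (/ recip l)%C) /\
  (forall l, Re l < - R2 -> Im l = 0 \/ Im l = PI -> ~ D (/ recip l)%C).
Proof.
pose proof PI_RGT_0 as HPI. pose proof k_pos as Hk. pose proof (chart_B _ _ _ _ _ hch) as HB.
destruct boundary_near_0 as (K & HK & Hb1 & Hb2).
destruct (no_far_points K HK Hb1) as (H & HH & Far).
set (R2 := R1 + (K + H + 1) / k + B).
assert (Pk : 0 < (K + H + 1) / k) by (apply Rdiv_lt_0_compat; lra).
assert (Ek : k * ((K + H + 1) / k) = K + H + 1) by (field; lra).
assert (Left : forall x, x < - R2 -> K + H < k * (- x - B)).
{ intros x Hx. unfold R2 in Hx. nra. }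
set (X := K + H + k * (R1 + 6 * B) + k * (R2 + 5 * B) + 1).
assert (P1 : 0 < k * (R1 + 6 * B)) by (apply Rmult_lt_0_compat; lra).
assert (P2 : 0 < k * (R2 + 5 * B)) by (apply Rmult_lt_0_compat; unfold R2; lra).
assert (D0 : ~ D (RtoC 0)).
{ intros D0. destruct hcusp as ((N & _) & _). apply N. apply hD. exact D0. }
assert (Strip : forall z, D (/ z)%C -> X + H < Cmod z ->
  exists l, Re l < - R2 /\ 0 < Im l < PI /\ z = recip l).
{ intros z Dz Mz.
  assert (Iz : Rabs (Im z) <= H) by (apply Rnot_lt_le; intros L; now apply (Far z L)).
  pose proof (Cmod_le_Re_Im z) as T.
  destruct (Rle_dec 0 (Re z)) as [Rz|Rz].
  - rewrite (Rabs_pos_eq (Re z)) in T by auto.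
    destruct (recip_surj z) as (l & Hl & E & Bz); [unfold X in Mz; lra|].
    exists l. subst z.
    assert (Hl2 : Re l < - R2) by (unfold X in Mz; nra).
    split; auto. split; auto.
    pose proof (recip_Re_lower l Hl) as RL. pose proof (Left _ Hl2) as Lf.
    assert (ML : K < Cmod (recip l)) by (unfold X in Mz; lra).
    destruct (classic (0 < Im l < PI)) as [I|I]; auto. exfalso.
    destruct (Req_dec (Im l) 0) as [I0|I0]; [apply (Hb2 l); auto|].
    destruct (Req_dec (Im l) PI) as [I1|I1]; [apply (Hb2 l); auto|].
    (* outside the strip one can move vertically to points with large imaginary part *)
    assert (S : forall s, (s = 1 /\ PI < Im l) \/ (s = -1 /\ Im l < 0) -> False).
    { intros s Hs. set (q := 2 * H / k).
      assert (Hq : 0 < q) by (apply Rdiv_lt_0_compat; lra).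
      assert (Eq : k * q = 2 * H) by (unfold q; field; lra).
      set (l' := (l + Ci * RtoC (s * q))%C).
      assert (Rl' : Re l' = Re l) by (unfold l'; rewrite re_plus, re_scal_r; simpl; ring).
      assert (Il' : Im l' = Im l + s * q) by (unfold l'; rewrite im_plus, im_scal_r; simpl; ring).
      apply (Far (recip l')).
      - destruct (recip_Im_bounds l' ltac:(lra)) as [A A']. rewrite Il' in A, A'.
        destruct Hs as [[-> L]|[-> L]].
        + specialize (A ltac:(lra)). rewrite Rabs_left1; nra.
        + specialize (A' ltac:(lra)). rewrite Rabs_pos_eq; nra.
      - apply (chart_path K l l' Hb1); auto. intros t Ht v.
        assert (Rv : Re v = Re l).
        { unfold v. rewrite Re_segment, Rl'. ring. }
        assert (Iv : Im v = Im l + s * (t * q)).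
        { unfold v. rewrite Im_segment, Il'. ring. }
        rewrite Rv, Iv. assert (0 <= t * q) by (apply Rmult_le_pos; lra).
        destruct Hs as [[-> L]|[-> L]]; repeat split; lra. }
    destruct (Rle_dec (Im l) 0) as [L|L].
    + apply (S (-1)). right. split; lra.
    + apply (S 1). left. split; auto. apply Rnot_le_lt. intros L'. apply I. lra.
  - exfalso.
    set (z' := (z + Ci * RtoC (2 * H + 1))%C).
    assert (Rz' : Re z' = Re z) by (unfold z'; rewrite re_plus, re_scal_r; simpl; ring).
    assert (Iz' : Im z' = Im z + (2 * H + 1)) by (unfold z'; rewrite im_plus, im_scal_r; simpl; ring).
    apply (Far z').
    + rewrite Iz'. apply Rabs_le_between in Iz. rewrite Rabs_pos_eq; lra.
    + rewrite (Rabs_left (Re z)) in T by lra.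
      replace z' with (z + RtoC 1 * (z' - z))%C by ring.
      assert (Seg : forall t, Re (z + RtoC t * (z' - z))%C = Re z).
      { intros t. rewrite Re_segment, Rz'. ring. }
      assert (Nz : forall t, (z + RtoC t * (z' - z))%C <> RtoC 0).
      { intros t E. specialize (Seg t). rewrite E in Seg. simpl in Seg. lra. }
      apply (path_avoiding_boundary D (fun t => / (z + RtoC t * (z' - z)))%C).
      * intros t Ht. apply continuous_Cinv; [apply segment_continuous|auto].
      * intros t Ht Bd. specialize (Seg t). specialize (Nz t). set (v := (z + RtoC t * (z' - z))%C) in *.
        destruct (Hb1 v) as (u & Hu & Iu & E); auto.
        -- pose proof (Re_le_Cmod v) as M. rewrite Seg, Rabs_left in M by lra. unfold X in Mz; lra.
        -- pose proof (recip_Re_lower u Hu) as RL. rewrite <- E, Seg in RL. nra.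
      * now replace (z + RtoC 0 * (z' - z))%C with z by ring. }
assert (XH : 0 < X + H) by (unfold X; lra).
assert (HX : 0 < / (X + H)) by (now apply Rinv_0_lt_compat).
assert (Near : forall w, D w -> Cmod w < / (X + H) ->
     exists l, Re l < - R2 /\ 0 < Im l < PI /\ w = (/ recip l)%C).
{ intros w Dw Mw.
  assert (Nw : w <> RtoC 0) by (intros E; apply D0; now rewrite <- E).
  assert (Iw : (/ / w)%C = w) by (field; auto).
  assert (Pw : 0 < Cmod w) by now apply Cmod_gt_0.
  destruct (Strip (/ w)%C) as (l & Hl & Il & E).
  - now rewrite Iw.
  - rewrite Cmod_inv by auto. rewrite <- (Rinv_inv (X + H)). apply Rinv_lt_contravar; auto.
    now apply Rmult_lt_0_compat.
  - exists l. repeat split; try tauto. rewrite <- E. auto. }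
exists R2, (/ (X + H)). split; [unfold R2; lra|]. split; auto. split; auto. split.
- intros l Hl Il.
  assert (W : exists w, D w /\ Cmod w < / (X + H)).
  { apply NNPP. intros N. destruct hcusp as ((_ & B0) & _). apply B0.
    apply locally_C_eps. exists (/ (X + H)). split; auto. intros w Hw Dw. apply N. exists w. split; auto.
    now rewrite Cminus_0_r in Hw. }
  destruct W as (w & Dw & Mw). destruct (Near w Dw Mw) as (l1 & Hl1 & Il1 & E).
  apply (chart_path K l1 l Hb1); [|now rewrite <- E].
  intros t Ht v.
  assert (Rv : Re v = (1 - t) * Re l1 + t * Re l).
  { unfold v. apply Re_segment. }
  assert (Iv : Im v = (1 - t) * Im l1 + t * Im l).
  { unfold v. apply Im_segment. }
  assert (Hv : Re v < - R2) by (rewrite Rv; destruct (Rle_dec (Re l1) (Re l)); nra).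
  assert (Hi : 0 < Im v < PI) by (rewrite Iv; destruct (Rle_dec (Im l1) (Im l)); nra).
  specialize (Left _ Hv). repeat split; try lra. unfold R2 in Hv; lra.
- intros l Hl Il. apply Hb2; auto; [unfold R2 in Hl; lra|].
  pose proof (recip_Re_lower l ltac:(unfold R2 in Hl; lra)). specialize (Left _ Hl).
  pose proof (Rle_trans _ _ _ (Rle_abs _) (Re_le_Cmod (recip l))). lra.
Qed.

End Cusp.

(** * Reflection and the simple pole *)

Lemma spreads_max_ext (u v : C -> R) z rho : (forall w, Cmod (w - z) < rho -> u w = v w) ->
  spreads_max v z rho -> spreads_max u z rho.
Proof.
intros E S r Hr H. assert (Z0 : Cmod (z - z) < rho).
{ rewrite Cmod_minus_self. lra. }
rewrite !E; auto.
- apply S; auto. intros w Hw. rewrite <- !E; auto. lra.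
- rewrite Cmod_plus_real; lra.
Qed.

Section Reflection.
Context (W : C -> C) (r : R) (hr : 0 < r).
Context (hW : forall z, 0 < Cmod z < r -> 0 < Im z -> Cdiff W z /\ 0 < Im (W z)).
Context (hb : forall x : R, 0 < Rabs x < r -> forall eps, 0 < eps -> exists del, 0 < del /\
  forall z, 0 < Im z -> Cmod (z - RtoC x) < del -> Im (W z) < eps).

(** Extended by 0, the imaginary part of [W] is continuous across the real axis. *)
Let V (z : C) : R := if Rlt_dec 0 (Im z) then Im (W z) else 0.

Lemma V_continuous z : 0 < Cmod z < r -> 0 <= Im z -> continuous V z.
Proof.
intros Hz Iz. destruct (Rle_lt_or_eq_dec 0 (Im z) Iz) as [L|L].
- apply continuous_ext_loc with (fun z => Im (W z)).
  + apply locally_C_eps. exists (Im z). split; auto. intros w Hw. unfold V.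
    apply near_Im in Hw. destruct (Rlt_dec 0 (Im w)); auto. lra.
  + apply (continuous_comp W Im); [|apply continuous_Im].
    apply Cdiff_continuous. now apply hW.
- apply continuous_R_eps. intros eps He.
  pose proof (real_of_Im z (eq_sym L)) as Ez.
  destruct (hb (Re z)) with (eps := eps) as (d & Hd & H); auto.
  { now rewrite Ez, Cmod_R in Hz. }
  apply locally_C_eps. exists (Rmin d (Rmin (Cmod z) (r - Cmod z))).
  split; [repeat apply Rmin_pos; lra|]. intros w Hw.
  assert (Vz : V z = 0) by (unfold V; destruct (Rlt_dec 0 (Im z)); lra).
  rewrite Vz, Rminus_0_r. unfold V. destruct (Rlt_dec 0 (Im w)) as [Iw|Iw]; [|rewrite Rabs_R0; auto].
  apply Rmin_Rgt_l in Hw as [W1 W2]. apply Rmin_Rgt_l in W2 as [W2 W3].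
  pose proof (Cmod_annulus w z).
  rewrite Rabs_pos_eq; [|left; apply hW; auto; lra].
  apply H; auto. now rewrite <- Ez.
Qed.

Lemma box_room (x0 : R) : 0 < Rabs x0 < r -> exists s, 0 < s /\
  forall z, Cmod (z - RtoC x0) <= 3 * s -> 0 < Cmod z < r.
Proof.
intros Hx. exists (Rmin (Rabs x0) (r - Rabs x0) / 4).
assert (P : 0 < Rmin (Rabs x0) (r - Rabs x0)) by (apply Rmin_pos; lra).
pose proof (Rmin_l (Rabs x0) (r - Rabs x0)). pose proof (Rmin_r (Rabs x0) (r - Rabs x0)).
split; [lra|]. intros z Hz.
pose proof (Cmod_annulus z (RtoC x0)) as T. rewrite Cmod_R in T. lra.
Qed.

(** The barrier [X^2 - Y^2 + 2 s Y] is harmonic, nonnegative on the real axis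
    and at least [s^2] on the upper half of the circle of radius [s]; on the
    imaginary axis it is at most [2 s Y]. A multiple of it therefore dominates
    [Im W] in half-discs centred on the real axis. *)
Lemma Im_linear_bound (x0 : R) : 0 < Rabs x0 < r -> exists s A, 0 < s /\ 0 <= A /\
  (forall z, Cmod (z - RtoC x0) <= 3 * s -> 0 < Cmod z < r) /\
  forall z, Rabs (Re z - x0) < s -> 0 < Im z < s -> Im (W z) <= A * Im z.
Proof.
intros Hx. destruct (box_room x0 Hx) as (s & Hs & Room).
set (K := fun z : C => Cmod (z - RtoC x0) <= 2 * s /\ 0 <= Im z).
assert (clK : closed K).
{ apply closed_and; [apply closed_disc|apply closed_le; auto using continuous_const_R, continuous_Im]. }
destruct (compact_bounded K (Cmod (RtoC x0) + 2 * s) V) as [A0 HA0]; auto.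
{ intros z [Hz _]. now apply disc_bounded. }
{ intros z [Hz Iz]. apply V_continuous; auto. apply Room. lra. }
set (A := Rmax A0 0). assert (HA : forall z, K z -> V z <= A).
{ intros z Hz. eapply Rle_trans; [now apply HA0|apply Rmax_l]. }
assert (A0' : 0 <= A) by apply Rmax_r.
exists s, (2 * A / s). split; auto. split; [apply Rdiv_le_0_compat; lra|]. split; auto.
intros z Hz Iz. set (x := Re z) in *.
set (q := A / (s * s)). assert (Hq : 0 <= q) by (apply Rdiv_le_0_compat; nra).
assert (Hqs : q * (s * s) = A) by (unfold q; field; lra).
set (P := fun w : C => (RtoC q * (Ci * ((w - RtoC x) * (w - RtoC x)) + RtoC (2 * s) * (w - RtoC x)))%C).
assert (IP : forall w, Im (P w) = q * ((Re w - x) * (Re w - x) - Im w * Im w + 2 * s * Im w)).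
{ intros [u v]. unfold P. simpl. ring. }
assert (dP : forall w, Cdiff P w).
{ intros w. apply Cdiff_mult; [apply Cdiff_const|].
  assert (D1 : Cdiff (fun w => w - RtoC x)%C w) by (apply Cdiff_shift).
  apply Cdiff_plus; apply Cdiff_mult; auto using Cdiff_const. now apply Cdiff_mult. }
set (K' := fun w : C => Cmod (w - RtoC x) <= s /\ 0 <= Im w).
assert (KK : forall w, K' w -> K w).
{ intros w [A1 A2]. split; auto. pose proof (Cmod_tri_minus w (RtoC x) (RtoC x0)) as T.
  rewrite <- RtoC_minus, Cmod_R in T. lra. }
assert (Max : V z - Im (P z) <= 0).
{ apply (max_principle K' (Cmod (RtoC x) + s) (fun w => V w - Im (P w))).
  - intros w [Hw _]. now apply disc_bounded.
  - apply closed_and; [apply closed_disc|apply closed_le; auto using continuous_const_R, continuous_Im].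
  - intros w Hw. destruct (KK w Hw) as [A1 A2]. apply (continuous_minus (V := R_NormedModule)).
    + apply V_continuous; auto. apply Room. lra.
    + apply (continuous_comp P Im); [now apply Cdiff_continuous|apply continuous_Im].
  - intros w Hw. pose proof (HA w (KK w Hw)) as VA. destruct Hw as [H1 H2].
    destruct (Rle_lt_or_eq_dec 0 (Im w) H2) as [I|I].
    2:{ left. rewrite IP, <- I. unfold V. destruct (Rlt_dec 0 (Im w)); [lra|].
        pose proof (Rle_0_sqr (Re w - x)). unfold Rsqr in *. nra. }
    destruct (Rle_lt_or_eq_dec _ _ H1) as [L|L].
    + right. exists (Rmin (Im w) (s - Cmod (w - RtoC x))).
      assert (In : forall v, Cmod (v - w) < Rmin (Im w) (s - Cmod (w - RtoC x)) -> K' v /\ 0 < Im v).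
      { intros v Hv. assert (Iv : 0 < Im v).
        { apply (near_Im w). eapply Rlt_le_trans; [exact Hv|apply Rmin_l]. }
        split; auto. split; [|lra].
        pose proof (Cmod_tri_minus v w (RtoC x)). pose proof (Rmin_r (Im w) (s - Cmod (w - RtoC x))). lra. }
      split; [apply Rmin_pos; lra|]. split; [apply In|].
      apply spreads_max_ext with (fun v => Im (W v - P v)%C).
      * intros v Hv. destruct (In v Hv) as [_ Iv]. unfold V. destruct (Rlt_dec 0 (Im v)); [|lra].
        now rewrite im_minus.
      * apply (Im_spreads_max (fun v => W v - P v)%C). intros v Hv. destruct (In v Hv) as [Kv Iv].
        apply Cdiff_minus; auto. apply hW; auto. apply Room. destruct (KK v Kv). lra.
    + left. rewrite IP.
      pose proof (Cmod_sqr (w - RtoC x)%C) as S. rewrite L, re_minus, im_minus, re_RtoC in S.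
      simpl (Im (RtoC x)) in S.
      assert (Is : Im w <= s).
      { pose proof (Im_minus_le w (RtoC x)) as J. rewrite L in J. apply Rabs_le_between in J. simpl in *. lra. }
      assert (s * s <= (Re w - x) * (Re w - x) - Im w * Im w + 2 * s * Im w) by nra. nra.
  - split; [|lra]. rewrite Cmod_vertical by reflexivity. simpl (Im (RtoC x)).
    rewrite Rminus_0_r, Rabs_pos_eq; lra. }
rewrite IP in Max. unfold V in Max. destruct (Rlt_dec 0 (Im z)); [|lra]. fold x in Max.
replace (2 * A / s) with (2 * s * q) by (unfold q; field; lra).
replace ((x - x) * (x - x)) with 0 in Max by ring. nra.
Qed.

(** Schwarz's lemma in the disc of radius [Im z] about [z] turns the linear bound
    on [Im W] into a bound on the derivative of [W]. *)
Lemma W_lipschitz (x0 : R) : 0 < Rabs x0 < r -> exists s k, 0 < s /\ 0 <= k /\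
  (forall z, Cmod (z - RtoC x0) <= 3 * s -> 0 < Cmod z < r) /\
  (forall z, Rabs (Re z - x0) < s -> 0 < Im z < s -> Im (W z) <= k * Im z) /\
  (forall z w, Rabs (Re z - x0) < s -> 0 < Im z < s -> Rabs (Re w - x0) < s -> 0 < Im w < s ->
     Cmod (W w - W z) <= k * Cmod (w - z)).
Proof.
intros Hx. destruct (Im_linear_bound x0 Hx) as (s & A & Hs & HA & Room & Lin).
exists s, (2 * A). split; auto. split; [lra|]. split; auto. split.
{ intros z H1 H2. specialize (Lin z H1 H2). nra. }
intros z w Hz Iz Hw Iw.
apply (lipschitz_of_derivative W (fun z => Rabs (Re z - x0) < s /\ 0 < Im z < s)); auto.
- intros a b t [Ha Ia] [Hb' Ib] Ht.
  rewrite Re_segment, Im_segment. apply Rabs_def2 in Ha, Hb'. split.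
  + apply Rabs_def1; destruct (Rle_dec (Re a) (Re b)); nra.
  + destruct (Rle_dec (Im a) (Im b)); nra.
- intros v [Hv Iv].
  assert (Dm : forall u, Cmod (u - v) < Im v -> 0 < Cmod u < r /\ 0 < Im u).
  { intros u Hu. split; [|now apply (near_Im v)]. apply Room.
    pose proof (Cmod_tri_minus u v (RtoC x0)) as T. pose proof (Cmod_minus_le_Re_Im v (RtoC x0)) as T'.
    rewrite re_RtoC in T'. simpl (Im (RtoC x0)) in T'. rewrite Rminus_0_r, (Rabs_pos_eq (Im v)) in T'; lra. }
  assert (V0 : Cmod (v - v) < Im v).
  { rewrite Cmod_minus_self. lra. }
  destruct (hW v) as [[l Hl] _]; [now apply Dm|lra|].
  exists l. split; auto.
  eapply Rle_trans; [apply (schwarz_derivative W v (Im v) l)|]; auto; try lra.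
  + intros u Hu. destruct (Dm u Hu). now apply hW.
  + intros u Hu. destruct (Dm u Hu). now apply hW.
  + specialize (Lin v Hv Iv). apply Rle_div_l; lra.
Qed.

(** Being Lipschitz near the real axis, [W] has boundary values there; they are
    real because [Im W] tends to 0. *)
Lemma boundary_value (x : R) : exists y : R, 0 < Rabs x < r ->
  forall eps, 0 < eps -> exists del, 0 < del /\
    forall z, 0 < Im z -> Cmod (z - RtoC x) < del -> Cmod (W z - RtoC y) < eps.
Proof.
destruct (classic (0 < Rabs x < r)) as [Hx|Hx]; [|exists 0; tauto].
destruct (W_lipschitz x Hx) as (s & k & Hs & Hk & Room & _ & Lip).
set (F := within (fun z : C => 0 < Im z) (locally (RtoC x))).
assert (FE : forall P : C -> Prop, F P <-> exists del, 0 < del /\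
  forall z, 0 < Im z -> Cmod (z - RtoC x) < del -> P z).
{ intros P. unfold F, within. rewrite locally_C_eps.
  split; intros (d & Hd & H); exists d; split; auto. }
assert (PF : ProperFilter F).
{ constructor; [|apply within_filter, locally_filter]. intros P HP.
  apply FE in HP. destruct HP as (d & Hd & H). exists (RtoC x + Ci * RtoC (d / 2))%C. apply H.
  - rewrite im_plus, im_scal_r. simpl. lra.
  - rewrite Cmod_vertical, im_plus, im_scal_r by (rewrite re_plus, re_scal_r; simpl; ring).
    simpl. replace (0 + 1 * (d / 2) - 0) with (d / 2) by ring. rewrite Rabs_pos_eq; lra. }
destruct (proj1 (filterlim_locally_cauchy (U := R_CompleteSpace) (F := F) (fun z => Re (W z))))
  as [y Hy].
{ intros eps. set (d := Rmin s (eps / (2 * k + 1))).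
  assert (He : 0 < eps / (2 * k + 1)) by (apply Rdiv_lt_0_compat; [apply cond_pos|lra]).
  exists (fun z => 0 < Im z /\ Cmod (z - RtoC x) < d). split.
  { apply FE. exists d. split; [now apply Rmin_pos|auto]. }
  intros u v [Iu Hu] [Iv Hv]. apply Rmin_Rgt_l in Hu as [Hu1 Hu2]. apply Rmin_Rgt_l in Hv as [Hv1 Hv2].
  assert (Box : forall w, 0 < Im w -> s > Cmod (w - RtoC x) -> Rabs (Re w - x) < s /\ 0 < Im w < s).
  { intros w Iw Hw. pose proof (Re_minus_le w (RtoC x)) as A. pose proof (Im_minus_le w (RtoC x)) as A'.
    simpl (Re (RtoC x)) in A. simpl (Im (RtoC x)) in A'. rewrite Rminus_0_r, Rabs_pos_eq in A'; lra. }
  destruct (Box u Iu Hu1), (Box v Iv Hv1).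
  change (Rabs (Re (W v) - Re (W u)) < eps).
  eapply Rle_lt_trans; [apply Re_minus_le|]. eapply Rle_lt_trans; [apply Lip; auto|].
  apply Rle_lt_trans with (k * (2 * (eps / (2 * k + 1)))).
  - apply Rmult_le_compat_l; auto. eapply Rle_trans; [apply (Cmod_tri_minus v (RtoC x))|].
    rewrite (Cmod_minus_sym (RtoC x)). lra.
  - assert ((2 * k + 1) * (eps / (2 * k + 1)) = eps) by (field; lra). lra. }
exists y. intros _ eps He.
destruct (hb x Hx (eps / 2)) as (d1 & Hd1 & H1); [lra|].
assert (He2 : 0 < eps / 2) by lra.
pose proof (proj1 (filterlim_locally _ _) Hy (mkposreal _ He2)) as L.
apply FE in L. destruct L as (d2 & Hd2 & H2).
exists (Rmin s (Rmin d1 d2)). split; [repeat apply Rmin_pos; auto|]. intros z Iz Hz.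
apply Rmin_Rgt_l in Hz as [Hz0 Hz]. apply Rmin_Rgt_l in Hz as [Hz1 Hz2].
specialize (H1 z Iz Hz1). specialize (H2 z Iz Hz2). change (Rabs (Re (W z) - y) < eps / 2) in H2.
eapply Rle_lt_trans; [apply Cmod_minus_le_Re_Im|]. simpl (Re (RtoC y)). simpl (Im (RtoC y)).
rewrite Rminus_0_r, (Rabs_pos_eq (Im (W z))); [lra|].
left. apply hW; auto. apply Room. lra.
Qed.

Let Wr (x : R) : R := proj1_sig (constructive_indefinite_description _ (boundary_value x)).

Lemma Wr_spec (x : R) : 0 < Rabs x < r -> forall eps, 0 < eps -> exists del, 0 < del /\
    forall z, 0 < Im z -> Cmod (z - RtoC x) < del -> Cmod (W z - RtoC (Wr x)) < eps.
Proof. exact (proj2_sig (constructive_indefinite_description _ (boundary_value x))). Qed.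

Definition reflected (z : C) : C :=
  if Rlt_dec 0 (Im z) then W z
  else if Rlt_dec (Im z) 0 then Cconj (W (Cconj z)) else RtoC (Wr (Re z)).

Lemma reflected_upper z : 0 < Im z -> reflected z = W z.
Proof. intros H. unfold reflected. destruct (Rlt_dec 0 (Im z)); tauto. Qed.

Lemma reflected_lower z : Im z < 0 -> reflected z = Cconj (W (Cconj z)).
Proof.
intros H. unfold reflected. destruct (Rlt_dec 0 (Im z)); [lra|].
destruct (Rlt_dec (Im z) 0); tauto.
Qed.

Lemma reflected_real (x : R) : reflected (RtoC x) = RtoC (Wr x).
Proof. unfold reflected. simpl. destruct (Rlt_dec 0 0); [lra|auto]. Qed.

Lemma reflected_Cdiff_off z : 0 < Cmod z < r -> Im z <> 0 -> Cdiff reflected z.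
Proof.
intros Hz N. destruct (Rlt_dec 0 (Im z)) as [L|L].
- apply Cdiff_ext_loc with W; [|now apply hW].
  apply locally_C_eps. exists (Im z). split; auto. intros w Hw.
  symmetry. apply reflected_upper. now apply near_Im with z.
- apply Cdiff_ext_loc with (fun w => Cconj (W (Cconj w))).
  + apply locally_C_eps. exists (Im (Cconj z)). rewrite im_conj. split; [lra|]. intros w Hw.
    symmetry. apply reflected_lower.
    assert (0 < Im (Cconj w)).
    { apply near_Im with (Cconj z). rewrite <- Cminus_conj, Cmod_conj, im_conj. exact Hw. }
    rewrite im_conj in *. lra.
  + apply Cdiff_Cconj. apply hW; [now rewrite Cmod_conj|rewrite im_conj; lra].
Qed.

Lemma reflected_continuous_real (x0 : R) : 0 < Rabs x0 < r -> continuous reflected (RtoC x0).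
Proof.
intros Hx. apply continuous_C_eps. intros eps He. rewrite reflected_real.
destruct (Wr_spec x0 Hx (eps / 2)) as (d & Hd & Up); [lra|].
set (q := Rmin (d / 2) (Rmin (Rabs x0) (r - Rabs x0))).
exists q. split; [repeat apply Rmin_pos; lra|].
intros z Hz. apply Rmin_Rgt_l in Hz as [Hz1 Hz2]. apply Rmin_Rgt_l in Hz2 as [Hz2 Hz3].
destruct (Rtotal_order (Im z) 0) as [L|[L|L]].
- rewrite reflected_lower, <- (Cconj_RtoC (Wr x0)), <- Cminus_conj, Cmod_conj by auto.
  apply Rlt_trans with (eps / 2); [|lra]. apply Up.
  + rewrite im_conj. lra.
  + rewrite <- (Cconj_RtoC x0), <- Cminus_conj, Cmod_conj. lra.
- rewrite (real_of_Im z L) in *. set (x := Re z) in *. rewrite reflected_real.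
  assert (Hx' : 0 < Rabs x < r).
  { pose proof (Cmod_annulus (RtoC x) (RtoC x0)). rewrite !Cmod_R in *. lra. }
  (* both values are compared with the value at a point above [x] *)
  destruct (Wr_spec x Hx' (eps / 2)) as (d' & Hd' & Up'); [lra|].
  set (t := Rmin (d / 4) (d' / 2)). assert (Ht : 0 < t) by (apply Rmin_pos; lra).
  assert (Ht1 : t <= d / 4) by apply Rmin_l. assert (Ht2 : t <= d' / 2) by apply Rmin_r.
  set (w := (x, t) : C).
  assert (Wx : Cmod (w - RtoC x) = t) by (rewrite Cmod_vertical; simpl; auto; rewrite Rminus_0_r, Rabs_pos_eq; lra).
  pose proof (Up' w Ht ltac:(lra)) as B1.
  pose proof (Up w Ht ltac:(pose proof (Cmod_tri_minus w (RtoC x) (RtoC x0)); lra)) as B2.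
  eapply Rle_lt_trans; [apply (Cmod_tri_minus _ (W w))|]. rewrite (Cmod_minus_sym (RtoC (Wr x))). lra.
- rewrite reflected_upper by auto. apply Rlt_trans with (eps / 2); [|lra]. apply Up; auto. lra.
Qed.

(** At real points [reflected] is continuous, and near them it is differentiable
    off the real axis, so that [nearly_holo_Cdiff] applies. *)
Lemma reflected_Cdiff z : 0 < Cmod z < r -> Cdiff reflected z.
Proof.
intros Hz. destruct (Req_dec (Im z) 0) as [I|I]; [|now apply reflected_Cdiff_off].
set (rho := Rmin (Cmod z) (r - Cmod z)).
assert (HR : 0 < rho) by (apply Rmin_pos; lra).
assert (Near : forall w, Cmod (w - z) < rho -> 0 < Cmod w < r).
{ intros w Hw. pose proof (Cmod_annulus w z). apply Rmin_Rgt_l in Hw. lra. }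
apply (nearly_holo_Cdiff reflected z rho HR). split.
- intros w Hw. destruct (Req_dec (Im w) 0) as [J|J].
  + specialize (Near w Hw). rewrite (real_of_Im w J) in Near |- *. rewrite Cmod_R in Near. now apply reflected_continuous_real.
  + apply Cdiff_continuous, reflected_Cdiff_off; auto.
- intros w Hw J. apply reflected_Cdiff_off; auto. now rewrite <- I.
Qed.

(** The bound [|W z| <= k / Im z] comes from Schwarz's lemma in discs touching
    the real axis. *)
Lemma W_Im_bound : exists k, 0 <= k /\ forall z, 0 < Cmod z <= r / 4 -> 0 < Im z ->
  Cmod (W z) * Im z <= k.
Proof.
set (s := r / 4). assert (Hs : 0 < s) by (unfold s; lra).
assert (In : forall w, in_rect (- s) s s s w -> 0 < Cmod w <= 2 * s /\ 0 < Im w).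
{ intros w [H1 H2]. assert (Ew : Im w = s) by lra. split; [|lra]. split.
  - pose proof (Im_le_Cmod w) as Q. rewrite Ew, Rabs_pos_eq in Q; lra.
  - pose proof (Cmod_le_Re_Im w) as Q. rewrite Ew, (Rabs_pos_eq s) in Q by lra.
    assert (Rabs (Re w) <= s) by (apply Rabs_le; lra). lra. }
destruct (compact_bounded (in_rect (- s) s s s) _ (fun z => Cmod (W z)) (in_rect_bounded _ _ _ _) (in_rect_closed _ _ _ _)) as [M HM].
{ intros z Hz. destruct (In z Hz). apply continuous_Cmod, Cdiff_continuous, hW; auto. unfold s in *; lra. }
exists (2 * s * Rmax M 0). split; [apply Rmult_le_pos; [lra|apply Rmax_r]|].
intros z Hz Iz. fold s in Hz.
pose proof (Re_le_Cmod z) as Q1. pose proof (Im_le_Cmod z) as Q2.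
apply Rabs_le_between in Q1. rewrite Rabs_pos_eq in Q2 by lra.
set (z0 := (Re z, s) : C).
assert (H0 : in_rect (- s) s s s z0) by (split; simpl; lra).
assert (Ed : Cmod (z - z0) = s - Im z).
{ rewrite Cmod_vertical by reflexivity. simpl (Im z0). rewrite Rabs_left1; lra. }
assert (Disc : forall w, Cmod (w - z0) < s -> 0 < Cmod w < r /\ 0 < Im w).
{ intros w Hw. assert (Iw : 0 < Im w) by (apply (near_Im z0); exact Hw). split; auto. split.
  - pose proof (Im_le_Cmod w) as Q. rewrite Rabs_pos_eq in Q; lra.
  - pose proof (Cmod_minus_ge w z0). destruct (In z0 H0). unfold s in *. lra. }
pose proof (schwarz_modulus W z0 s z Hs) as S. rewrite Ed in S.
replace (s - (s - Im z)) with (Im z) in S by ring.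
eapply Rle_trans; [apply S|].
- intros w Hw. destruct (Disc w Hw). now apply hW.
- intros w Hw. destruct (Disc w Hw). now apply hW.
- lra.
- apply Rmult_le_compat_l; [lra|]. eapply Rle_trans; [apply HM; auto|apply Rmax_l].
Qed.

(** On a circle of radius [t] about 0 the factor [z^2 - t^2] has modulus
    [2 t |Im z|] and compensates for the growth of [W] towards the real axis. *)
Lemma reflected_growth : exists k, 0 <= k /\ forall z, 0 < Cmod z <= r / 8 ->
  Cmod (z * reflected z) <= k.
Proof.
destruct W_Im_bound as (k & Hk & Bd). set (rho := r / 4) in *.
assert (HR : 0 < rho) by (unfold rho; lra).
assert (BdR : forall z, 0 < Cmod z <= rho -> Cmod (reflected z) * Rabs (Im z) <= k).
{ intros z Hz. destruct (Rtotal_order (Im z) 0) as [L|[L|L]].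
  - rewrite reflected_lower, Cmod_conj, Rabs_left by auto. rewrite <- im_conj. apply Bd.
    + now rewrite Cmod_conj.
    + rewrite im_conj; lra.
  - rewrite L, Rabs_R0. lra.
  - rewrite reflected_upper, Rabs_pos_eq by (auto; lra). now apply Bd. }
assert (Fac : forall t z, 0 <= t -> Cmod z = t -> Cmod (z * z - RtoC (t * t)) = 2 * t * Rabs (Im z)).
{ intros t z Ht E.
  replace (z * z - RtoC (t * t))%C with (z * (RtoC 2 * Ci * RtoC (Im z)))%C.
  - rewrite !Cmod_mult, E, Cmod_Ci, !Cmod_R, (Rabs_pos_eq 2) by lra. ring.
  - rewrite <- E, Cmod_sqr. destruct z as [x y]. unfold Ci, RtoC, Cmult, Cminus, Cplus, Copp; simpl. f_equal; ring. }
exists (8 * k). split; [lra|]. intros z0 Hz0.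
assert (Hz0R : Cmod z0 <= rho / 2) by (unfold rho; lra).
set (t := Cmod z0 / 2).
assert (Ht : 0 < t) by (unfold t; lra).
set (N := fun z => ((z * z - RtoC (t * t)) * (z * z - RtoC (rho * rho)) * reflected z / z)%C).
assert (Nz : forall z, 0 < Cmod z -> z <> RtoC 0).
{ intros z Hz E. rewrite E, Cmod_0 in Hz. lra. }
assert (dN : forall z, 0 < Cmod z < r -> Cdiff N z).
{ intros z Hz. apply Cdiff_div; [|apply Cdiff_id|now apply Nz].
  apply Cdiff_mult; [|now apply reflected_Cdiff].
  apply Cdiff_mult; apply Cdiff_minus; auto using Cdiff_const; apply Cdiff_mult; apply Cdiff_id. }
assert (EN : forall z, 0 < Cmod z -> Cmod (N z) =
  Cmod (z * z - RtoC (t * t)) * Cmod (z * z - RtoC (rho * rho)) * Cmod (reflected z) / Cmod z).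
{ intros z Hz. unfold N. rewrite Cmod_div by now apply Nz. now rewrite !Cmod_mult. }
assert (Tri : forall z q, 0 <= q -> Cmod (z * z - RtoC (q * q)) <= Cmod z * Cmod z + q * q).
{ intros z q Hq. eapply Rle_trans; [apply Cmod_triangle|].
  rewrite Cmod_opp, Cmod_mult, Cmod_R, Rabs_pos_eq; [lra|nra]. }
assert (MN : Cmod (N z0) <= 4 * k * (rho * rho)).
{ apply (max_principle (fun z => t <= Cmod z /\ Cmod z <= rho) rho (fun z => Cmod (N z))).
  - tauto.
  - assert (cC : forall z, continuous Cmod z) by (intros; apply (continuous_Cmod (fun z => z)), continuous_id).
    apply closed_and; apply closed_le; auto using continuous_const_R.
  - intros z [H1 H2]. apply continuous_Cmod, Cdiff_continuous, dN. unfold rho in *; lra.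
  - intros z [H1 H2]. pose proof (BdR z ltac:(lra)) as BRz.
    pose proof (Cmod_ge_0 (reflected z)). pose proof (Rabs_pos (Im z)).
    destruct (Rle_lt_or_eq_dec _ _ H1) as [L1|L1]; [destruct (Rle_lt_or_eq_dec _ _ H2) as [L2|L2]|].
    + right. exists (Rmin (Cmod z - t) (rho - Cmod z)).
      assert (In : forall w, Cmod (w - z) < Rmin (Cmod z - t) (rho - Cmod z) -> t <= Cmod w /\ Cmod w <= rho).
      { intros w Hw. pose proof (Cmod_annulus w z). apply Rmin_Rgt_l in Hw. lra. }
      split; [apply Rmin_pos; lra|]. split; [exact In|]. apply Cmod_spreads_max.
      intros w Hw. apply dN. destruct (In w Hw). unfold rho in *; lra.
    + left. rewrite EN by lra. rewrite (Fac rho z ltac:(lra) L2). apply Rle_div_l; [lra|]. rewrite L2.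
      assert (T : Cmod (z * z - RtoC (t * t)) <= 2 * (rho * rho)).
      { eapply Rle_trans; [apply Tri; lra|]. rewrite L2. nra. }
      replace (Cmod (z * z - RtoC (t * t)) * (2 * rho * Rabs (Im z)) * Cmod (reflected z))
        with (Cmod (z * z - RtoC (t * t)) * (2 * rho) * (Cmod (reflected z) * Rabs (Im z))) by ring.
      replace (4 * k * (rho * rho) * rho) with (2 * (rho * rho) * (2 * rho) * k) by ring.
      apply Rmult_le_compat; auto.
      * apply Rmult_le_pos; [apply Cmod_ge_0|lra].
      * now apply Rmult_le_pos.
      * apply Rmult_le_compat_r; [lra|auto].
    + left. rewrite EN by lra. rewrite (Fac t z ltac:(lra) (eq_sym L1)). apply Rle_div_l; [lra|]. rewrite <- L1.
      assert (T : Cmod (z * z - RtoC (rho * rho)) <= 2 * (rho * rho)).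
      { eapply Rle_trans; [apply Tri; lra|]. rewrite <- L1. nra. }
      replace (2 * t * Rabs (Im z) * Cmod (z * z - RtoC (rho * rho)) * Cmod (reflected z))
        with (Cmod (z * z - RtoC (rho * rho)) * (2 * t) * (Cmod (reflected z) * Rabs (Im z))) by ring.
      replace (4 * k * (rho * rho) * t) with (2 * (rho * rho) * (2 * t) * k) by ring.
      apply Rmult_le_compat; auto.
      * apply Rmult_le_pos; [apply Cmod_ge_0|lra].
      * now apply Rmult_le_pos.
      * apply Rmult_le_compat_r; [lra|auto].
  - unfold t. split; lra. }
assert (Pz0 : 0 < Cmod z0) by lra.
rewrite EN in MN by lra. apply (proj1 (Rle_div_l _ _ _ Pz0)) in MN.
set (m := Cmod z0) in *. assert (Em : m = 2 * t) by (unfold t; field).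
assert (F1 : 3 * (t * t) <= Cmod (z0 * z0 - RtoC (t * t))).
{ pose proof (Cmod_minus_ge (z0 * z0) (RtoC (t * t))) as T. rewrite Cmod_mult, Cmod_R, Rabs_pos_eq in T by nra.
  fold m in T. rewrite Em in T. nra. }
assert (F2 : 3 / 4 * (rho * rho) <= Cmod (z0 * z0 - RtoC (rho * rho))).
{ pose proof (Cmod_minus_ge (RtoC (rho * rho)) (z0 * z0)) as T. rewrite Cmod_mult, Cmod_R, Rabs_pos_eq in T by nra.
  rewrite (Cmod_minus_sym (RtoC (rho * rho))) in T. fold m in T. nra. }
rewrite Cmod_mult. fold m. set (w := Cmod (reflected z0)) in *. assert (Hw : 0 <= w) by apply Cmod_ge_0.
assert (F3 : 3 * (t * t) * (3 / 4 * (rho * rho)) * w <= 4 * k * (rho * rho) * m).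
{ eapply Rle_trans; [|exact MN]. apply Rmult_le_compat_r; auto.
  apply Rmult_le_compat; auto; nra. }
rewrite Em in F3 |- *. assert (0 < t * (rho * rho)) by (repeat apply Rmult_lt_0_compat; lra).
assert (0 <= k * (t * (rho * rho))) by (apply Rmult_le_pos; lra).
apply Rmult_le_reg_l with (9 / 8 * t * (rho * rho)); lra.
Qed.

(** As [z * z * reflected z] tends to 0 at 0, the singularity of
    [z * reflected z] is removable, and [b] is the value at 0. If this value
    vanishes, a further factor [z] can be divided out. *)
Theorem half_disc_pole : exists b : C,
  (forall eps, 0 < eps -> exists del, 0 < del /\
     forall z, 0 < Cmod z < del -> 0 < Im z -> Cmod (z * W z - b) < eps) /\
  (b = RtoC 0 -> exists M del, 0 < del /\
     forall z, 0 < Cmod z < del -> 0 < Im z -> Cmod (W z) <= M).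
Proof.
destruct reflected_growth as (k & Hk & Gr).
set (h := fun z => (z * (z * reflected z))%C).
assert (h0 : h (RtoC 0) = RtoC 0) by (unfold h; ring).
assert (m0 : forall z, (z - 0)%C = z) by (intros; ring).
assert (hoff : forall z, 0 < Cmod z < r -> Cdiff h z).
{ intros z Hz. apply Cdiff_mult; [apply Cdiff_id|]. apply Cdiff_mult; [apply Cdiff_id|].
  now apply reflected_Cdiff. }
assert (hd : forall z, Cmod (z - 0) < r -> Cdiff h z).
{ intros z Hz. destruct (excluded_middle_informative (z = RtoC 0)) as [->|Nz].
  2:{ apply hoff. rewrite m0 in Hz. split; auto. now apply Cmod_gt_0. }
  apply (removable_singularity h (RtoC 0) r hr).
  - apply continuous_C_eps. intros eps He. exists (Rmin (r / 8) (eps / (k + 1))).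
    split; [apply Rmin_pos; [lra|apply Rdiv_lt_0_compat; lra]|]. intros w Hw.
    rewrite h0, m0. rewrite m0 in Hw.
    destruct (excluded_middle_informative (w = RtoC 0)) as [->|Nw]; [rewrite h0, Cmod_0; auto|].
    assert (Pw : 0 < Cmod w) by now apply Cmod_gt_0.
    apply Rmin_Rgt_l in Hw as [Hw1 Hw2]. apply Rlt_div_r in Hw2; [|lra].
    unfold h. rewrite Cmod_mult. specialize (Gr w ltac:(lra)). nra.
  - intros w Hw Nw. rewrite m0 in Hw. apply hoff. split; auto. now apply Cmod_gt_0. }
assert (Z0 : Cmod (RtoC 0 - 0) < r) by (rewrite m0, Cmod_0; auto).
destruct (hd (RtoC 0) Z0) as [b Hb].
set (k1 := slope h (RtoC 0) b).
assert (k1d : Cdiff k1 (RtoC 0)) by (apply (Cdiff_slope h (RtoC 0) b r); auto).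
assert (k1E : forall z, z <> RtoC 0 -> 0 < Im z -> k1 z = (z * W z)%C).
{ intros z Nz Iz. unfold k1. rewrite slope_off, h0 by auto. unfold h. rewrite reflected_upper by auto.
  rewrite !m0. field. auto. }
assert (k10 : k1 (RtoC 0) = b) by apply slope_at.
assert (Nz : forall z, 0 < Cmod z -> z <> RtoC 0).
{ intros z Hz E. rewrite E, Cmod_0 in Hz. lra. }
exists b. split.
- intros eps He.
  destruct (proj1 (continuous_C_eps _ _) (Cdiff_continuous _ _ k1d) eps He) as (d & Hd & S).
  exists d. split; auto. intros z Hz Iz. rewrite <- k1E, <- k10 by (auto; apply Nz; lra).
  apply S. rewrite m0. lra.
- intros b0. destruct k1d as [b' Hb']. apply is_Cderive_slope in Hb'.
  destruct (proj1 (continuous_C_eps _ _) Hb' 1 Rlt_0_1) as (d & Hd & S).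
  exists (Cmod b' + 1), d. split; auto. intros z Hz Iz.
  assert (N : z <> RtoC 0) by (apply Nz; lra).
  specialize (S z). rewrite slope_at, slope_off, k10, b0, k1E, !m0 in S by auto.
  replace (z * W z / z)%C with (W z) in S by (field; auto).
  specialize (S ltac:(lra)). pose proof (Cmod_minus_ge (W z) b'). lra.
Qed.

End Reflection.

(** * Asymptotics of the conformal map *)

Lemma Im_opp_inv (z : C) : z <> 0%C -> Im (- / z)%C = Im z / (Cmod z * Cmod z).
Proof.
intros H. assert (P : 0 < Cmod z) by now apply Cmod_gt_0.
rewrite Cmod_sqr. assert (0 < Re z * Re z + Im z * Im z) by (rewrite <- Cmod_sqr; nra).
destruct z as [x y]. unfold Cinv, Copp; simpl in *. field. nra.
Qed.

(** The points at which [Im (- 1 / z) >= eta] form a disc tangent to the real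
    axis at 0. On it [g] stays away from [w0]: inside the half-plane since [w0]
    is not a value of [g], and near 0 since [g] tends to 0 there. *)
Lemma preimage_near_boundary (D : C -> Prop) (g : C -> C) (w0 : C) (eta : R) :
  (forall z, 0 < Im z -> Cdiff g z /\ D (g z)) ->
  (forall eps, 0 < eps -> exists del, 0 < del /\ forall z, 0 < Im z -> Cmod z < del -> Cmod (g z) < eps) ->
  ~ D w0 -> w0 <> 0%C -> 0 < eta ->
  exists del, 0 < del /\ forall z, 0 < Im z -> Cmod (g z - w0) < del -> Im (- / z)%C < eta.
Proof.
intros hg g0 nD n0 He.
set (K := fun z : C => eta * (Cmod z * Cmod z) <= Im z).
assert (cC : forall z, continuous Cmod z) by (intros; apply (continuous_Cmod (fun z => z)), continuous_id).
assert (BK : forall z, K z -> Cmod z <= / eta).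
{ intros z Hz. unfold K in Hz. pose proof (Im_le_Cmod z) as Q. apply Rabs_le_between in Q.
  pose proof (Cmod_ge_0 z). apply Rmult_le_reg_l with eta; auto. rewrite Rinv_r by lra.
  destruct (Req_dec (Cmod z) 0) as [E|E]; [rewrite E; lra|]. nra. }
assert (clK : closed K).
{ apply closed_le; [|apply continuous_Im]. intros z.
  apply (continuous_Rmult (fun _ : C => eta)); [apply continuous_const|]. now apply continuous_Rmult. }
assert (Q : exists del, 0 < del /\ forall z, K z -> 0 < Im z -> del <= Cmod (g z - w0)).
{ apply (compact_induction (fun A => exists del, 0 < del /\ forall z, A z -> 0 < Im z -> del <= Cmod (g z - w0)) K (/ eta)); auto.
  - intros A A' H (d & Hd & H'). exists d. split; auto.
  - exists 1. split; [lra|tauto].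
  - intros A A' (d & Hd & H) (d' & Hd' & H'). exists (Rmin d d'). split; [now apply Rmin_pos|].
    intros z [Hz|Hz] Iz; [eapply Rle_trans; [apply Rmin_l|auto]|eapply Rle_trans; [apply Rmin_r|auto]].
  - intros z Hz. destruct (Rlt_dec 0 (Im z)) as [I|I].
    + destruct (hg z I) as [dg Dg].
      assert (P : 0 < Cmod (g z - w0)).
      { apply Cmod_gt_0, Cminus_neq0. intros E. apply nD. now rewrite <- E. }
      destruct (proj1 (continuous_C_eps _ _) (Cdiff_continuous _ _ dg) (Cmod (g z - w0) / 2)) as (d & Hd & H); [lra|].
      exists d. split; auto. exists (Cmod (g z - w0) / 2). split; [lra|]. intros w [_ Hw] _.
      specialize (H w Hw). pose proof (Cmod_tri_minus (g z) (g w) w0) as T.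
      rewrite (Cmod_minus_sym (g z) (g w)) in T. lra.
    + assert (Ez : z = RtoC 0).
      { apply Cmod_eq_0. unfold K in Hz. pose proof (Cmod_ge_0 z).
        destruct (Req_dec (Cmod z) 0); auto. exfalso. assert (0 < Cmod z * Cmod z) by nra. nra. }
      subst z. assert (P : 0 < Cmod w0) by now apply Cmod_gt_0.
      destruct (g0 (Cmod w0 / 2)) as (d & Hd & H); [lra|].
      exists d. split; auto. exists (Cmod w0 / 2). split; [lra|]. intros w [_ Hw] Iw.
      rewrite Cminus_0_r in Hw. specialize (H w Iw Hw).
      pose proof (Cmod_minus_ge w0 (g w)) as T. rewrite (Cmod_minus_sym w0) in T. lra. }
destruct Q as (d & Hd & H). exists d. split; auto. intros z Iz Hz.
assert (Nz : z <> RtoC 0) by (intros E; rewrite E in Iz; simpl in Iz; lra).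
assert (P : 0 < Cmod z) by now apply Cmod_gt_0.
rewrite Im_opp_inv by auto. apply Rnot_le_lt. intros L.
apply Rle_div_r in L; [|nra]. specialize (H z L Iz). lra.
Qed.


(** What remains of the quotient in the theorem at the point [/ recip l] when
    [t], which stands for the logarithm of the modulus, is close to [Re l]. *)
Lemma quotient_estimate a c e R1 B l t L eta : 0 < a -> log_chart a c e R1 B ->
  Re l < - R1 -> 0 <= Im l <= PI -> t < 0 -> Rabs (t - Re l) <= L -> 0 < eta ->
  (L + PI + B) / eta + B < - Re l ->
  Cmod (/ recip a e l * / RtoC (- (2 * PI) / (a * t)) - 1) < eta.
Proof.
intros ha hch Hl Il Ht HL He Far. pose proof PI_RGT_0 as HPI.
pose proof (chart_bound _ _ _ _ _ hch l Hl) as Be. pose proof (chart_B _ _ _ _ _ hch) as HB.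
set (m := (l - e l)%C).
assert (Mm : (L + PI + B) / eta < Cmod m).
{ pose proof (Cmod_minus_ge l (e l)) as T1. pose proof (Re_le_Cmod l) as T2.
  rewrite Rabs_left in T2 by lra. unfold m. lra. }
pose proof (Rabs_pos (t - Re l)).
assert (P : 0 < (L + PI + B) / eta) by (apply Rdiv_lt_0_compat; lra).
assert (Nm : m <> RtoC 0) by (intros E; rewrite E, Cmod_0 in Mm; lra).
assert (Pi2 : 0 < / (2 * PI)) by (apply Rinv_0_lt_compat; lra).
assert (Hka : - a / (2 * PI) < 0) by (unfold Rdiv; nra).
assert (E : (/ recip a e l * / RtoC (- (2 * PI) / (a * t)) - 1 = (RtoC t - l + e l) / m)%C).
{ unfold recip. fold m.
  assert (Q : RtoC (- (2 * PI) / (a * t)) = (/ (RtoC (- a / (2 * PI)) * RtoC t))%C).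
  { rewrite <- RtoC_mult, <- RtoC_inv by nra. f_equal. field. lra. }
  rewrite Q. assert (RtoC (- a / (2 * PI)) <> RtoC 0) by (intros Z; apply RtoC_eq_0 in Z; lra).
  assert (RtoC t <> RtoC 0) by (intros Z; apply RtoC_eq_0 in Z; lra).
  replace (RtoC t - l + e l)%C with (RtoC t - m)%C by (unfold m; ring). field. auto. }
rewrite E, Cmod_div by auto. apply Rlt_div_l; [now apply Cmod_gt_0|].
apply Rlt_div_l in Mm; [|lra]. rewrite Rmult_comm in Mm. eapply Rle_lt_trans; [|exact Mm].
eapply Rle_trans; [apply Cmod_triangle|]. apply Rplus_le_compat; auto.
eapply Rle_trans; [apply Cmod_minus_le_Re_Im|]. rewrite re_RtoC. simpl (Im (RtoC t)).
apply Rplus_le_compat; auto. rewrite Rminus_0_l, Rabs_Ropp, Rabs_pos_eq; lra.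
Qed.

Section Pullback.
Context (a : R) (c : nat -> nat -> R) (e : C -> C) (R1 B : R) (ha : 0 < a).
Context (hch : log_chart a c e R1 B) (D : C -> Prop) (R2 rho : R).
Context (hR : R1 <= R2) (hrho : 0 < rho).
Context (near : forall w, D w -> Cmod w < rho ->
  exists l, Re l < - R2 /\ 0 < Im l < PI /\ w = (/ recip a e l)%C).
Context (ins : forall l, Re l < - R2 -> 0 < Im l < PI -> D (/ recip a e l)%C).
Context (outs : forall l, Re l < - R2 -> Im l = 0 \/ Im l = PI -> ~ D (/ recip a e l)%C).
Context (g p : C -> C).
Context (hg : forall z, 0 < Im z -> Cdiff g z /\ D (g z)).
Context (hp : forall w, D w -> 0 < Im (p w) /\ g (p w) = w) (dp : forall w, D w -> Cdiff p w).
Context (pg : forall z, 0 < Im z -> p (g z) = z).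
Context (g0 : forall eps, 0 < eps -> exists del, 0 < del /\
  forall z, 0 < Im z -> Cmod z < del -> Cmod (g z) < eps).

Definition rep_log (x : C) : C := (/ recip a e (clog x))%C.

(** The inverse of [g] composed with the representation, followed by the
    automorphism [- 1 / z] of the half-plane, which moves 0 to infinity. *)
Definition pullback (x : C) : C := (- / p (rep_log x))%C.

Lemma upper_neq0 z : 0 < Im z -> z <> RtoC 0.
Proof. intros H E. rewrite E in H. simpl in H. lra. Qed.

Lemma Re_clog_left x : 0 < Cmod x < exp (- R2) -> Re (clog x) < - R2.
Proof. intros H. simpl. rewrite <- (ln_exp (- R2)). apply ln_increasing; tauto. Qed.

Lemma recip_clog_neq0 x : 0 < Cmod x < exp (- R2) -> recip a e (clog x) <> RtoC 0.
Proof.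
intros H. apply Re_clog_left in H. apply (recip_neq0 a c e R1 B ha hch). lra.
Qed.

Lemma rep_log_in x : 0 < Cmod x < exp (- R2) -> 0 < Im x -> D (rep_log x).
Proof.
intros Hx Ix. apply ins; [now apply Re_clog_left|]. apply clog_Im_bound; auto using upper_neq0.
Qed.

Lemma pullback_upper x : 0 < Cmod x < exp (- R2) -> 0 < Im x ->
  Cdiff pullback x /\ 0 < Im (pullback x).
Proof.
intros Hx Ix. pose proof (rep_log_in x Hx Ix) as Df. destruct (hp _ Df) as [Up _].
pose proof (upper_neq0 _ Up) as N. split.
- apply Cdiff_opp, Cdiff_inv; [|exact N].
  apply (Cdiff_comp p rep_log); [now apply dp|]. apply Cdiff_inv; [|now apply recip_clog_neq0].
  apply (Cdiff_comp (recip a e) clog); [|now apply Cdiff_clog].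
  apply (recip_Cdiff a c e R1 B hch). apply Re_clog_left in Hx. lra.
- unfold pullback. rewrite Im_opp_inv by auto. apply Cmod_gt_0 in N.
  apply Rdiv_lt_0_compat; auto. now apply Rmult_lt_0_compat.
Qed.

Lemma pullback_boundary (x : R) : 0 < Rabs x < exp (- R2) -> forall eta, 0 < eta ->
  exists del, 0 < del /\
    forall z, 0 < Im z -> Cmod (z - RtoC x) < del -> Im (pullback z) < eta.
Proof.
intros Hx eta He. rewrite <- Cmod_R in Hx.
assert (N0 : RtoC x <> RtoC 0) by (intros E; rewrite E, Cmod_0 in Hx; lra).
assert (nD : ~ D (rep_log (RtoC x))).
{ apply outs; [now apply Re_clog_left|].
  destruct (Rtotal_order x 0) as [L|[L|L]]; [|now rewrite L in N0|].
  - right. now rewrite clog_neg.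
  - left. now rewrite clog_pos. }
pose proof (recip_clog_neq0 _ Hx) as Nr.
pose proof (Cinv_neq_0 _ Nr) as Nw.
destruct (preimage_near_boundary D g (rep_log (RtoC x)) eta) as (d & Hd & H); auto.
assert (cf : continuous rep_log (RtoC x)).
{ apply continuous_Cinv; [|exact Nr].
  apply (continuous_comp clog (recip a e)); [now apply continuous_clog|].
  apply Cdiff_continuous, (recip_Cdiff a c e R1 B hch). apply Re_clog_left in Hx. lra. }
destruct (proj1 (continuous_C_eps _ _) cf d Hd) as (d' & Hd' & C').
exists (Rmin d' (exp (- R2) - Cmod (RtoC x))). split; [apply Rmin_pos; lra|]. intros z Iz Hz.
apply Rmin_Rgt_l in Hz as [Hz1 Hz2].
assert (Pz : 0 < Cmod z < exp (- R2)).
{ split; [now apply Cmod_gt_0, upper_neq0|]. pose proof (Cmod_annulus z (RtoC x)). lra. }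
destruct (hp _ (rep_log_in z Pz Iz)) as [Up Ep].
apply H; auto. rewrite Ep. now apply C'.
Qed.

(** As [g] tends to 0 at 0, points of the half-plane near 0 correspond to
    points far to the left in the strip. *)
Lemma chart_point T : exists del, 0 < del /\ forall z, 0 < Im z -> Cmod z < del ->
  exists l, Re l < - T /\ Re l < - R2 /\ 0 < Im l < PI /\
    g z = (/ recip a e l)%C /\ pullback (cexp l) = (- / z)%C.
Proof.
set (k := a / (2 * PI)). pose proof PI_RGT_0. pose proof (chart_B _ _ _ _ _ hch).
assert (Hk : 0 < k) by (apply Rdiv_lt_0_compat; lra).
set (q := k * (Rmax T 0 + PI + B)). assert (Hq : 0 < q).
{ apply Rmult_lt_0_compat; auto. pose proof (Rmax_r T 0). lra. }
destruct (g0 (Rmin rho (/ q))) as (d & Hd & H1); [apply Rmin_pos; auto; now apply Rinv_0_lt_compat|].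
exists d. split; auto. intros z Iz Hz. specialize (H1 z Iz Hz). apply Rmin_Rgt_l in H1 as [G1 G2].
destruct (near (g z)) as (l & Rl & Il & E); [now apply hg|exact G1|].
assert (Nr : recip a e l <> RtoC 0) by (apply (recip_neq0 a c e R1 B ha hch); lra).
exists l. repeat split; try tauto.
- rewrite E, Cmod_inv in G2 by auto.
  assert (P : 0 < Cmod (recip a e l)) by now apply Cmod_gt_0.
  apply Rinv_lt_contravar in G2; [|apply Rmult_lt_0_compat; now apply Rinv_0_lt_compat].
  rewrite !Rinv_inv in G2.
  pose proof (Cmod_recip_upper a c e R1 B ha hch l ltac:(lra)) as U. fold k in U.
  rewrite (Rabs_pos_eq (Im l)) in U by lra. unfold q in G2. pose proof (Rmax_l T 0).
  apply Rnot_le_lt. intros L.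
  assert (k * (- Re l + Im l + B) <= k * (Rmax T 0 + PI + B)) by (apply Rmult_le_compat_l; lra). lra.
- unfold pullback, rep_log. now rewrite clog_cexp, <- E, pg by (auto; lra).
Qed.

End Pullback.

Theorem theorem1 (a : R) (c : nat -> nat -> R) (D : C -> Prop) (eps : R)
  (g : C -> C)
  (hf : admissible a c)
  (heps : 0 < eps)
  (hdef : forall x : R, - eps <= x < 0 -> rep_defined c (RtoC x))
  (hD : domain D) (hsc : simply_connected D)
  (hcusp : analytic_cusp D (real_segment 0 eps) (Gamma a c eps))
  (hg : conformal_map upper_half_plane D g)
  (hg0 : filterlim g (within upper_half_plane (locally (RtoC 0)))
                     (locally (RtoC 0))) :
  filterlim
    (fun z : C => (g z * / RtoC (- (2 * PI) / (a * ln (Cmod z))))%C)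
    (within upper_half_plane (locally (RtoC 0)))
    (locally (RtoC 1)).
Proof.
pose proof PI_RGT_0 as HPI. pose proof (adm_pos _ _ hf) as ha.
destruct (log_chart_exists a c hf) as (e & R1 & B & hch). pose proof (chart_B _ _ _ _ _ hch) as HB.
destruct hD as (_ & oD & _).
destruct (cusp_chart a c e R1 B ha hch D eps heps oD hcusp) as (R2 & rho & HR & Hrho & Near & Ins & Outs).
destruct hg as (gd & gD & ginj & gsurj).
assert (g0 : forall eta, 0 < eta -> exists del, 0 < del /\
  forall z, 0 < Im z -> Cmod z < del -> Cmod (g z) < eta).
{ intros eta He. assert (L : locally (RtoC 0) (fun w => Cmod w < eta)).
  { apply locally_C_eps. exists eta. split; auto. intros w Hw. now rewrite Cminus_0_r in Hw. }
  specialize (hg0 _ L). unfold filtermap, within in hg0. apply locally_C_eps in hg0.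
  destruct hg0 as (d & Hd & H). exists d. split; auto. intros z Iz Hz. apply H; auto.
  now rewrite Cminus_0_r. }
assert (pex : forall w, exists z, D w -> 0 < Im z /\ g z = w).
{ intros w. destruct (classic (D w)) as [Hw|Hw].
  - destruct (gsurj w Hw) as [z Hz]. now exists z.
  - exists (RtoC 0). tauto. }
destruct (choice _ pex) as [p hp]. clear pex.
assert (oU : forall z, upper_half_plane z -> locally z upper_half_plane).
{ intros z Hz. apply locally_C_eps. exists (Im z). split; auto. intros w Hw. now apply (near_Im z). }
assert (dp : forall w, D w -> Cdiff p w).
{ intros w Hw. apply (injective_inverse_Cdiff upper_half_plane g oU gd ginj p D); auto. }
assert (pg : forall z, 0 < Im z -> p (g z) = z).
{ intros z Iz. destruct (hp (g z) (gD z Iz)). now apply ginj. }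
assert (hg : forall z, 0 < Im z -> Cdiff g z /\ D (g z)) by (split; [now apply gd|now apply gD]).
set (W := pullback a e p).
destruct (half_disc_pole W (exp (- R2)) (exp_pos _)) as (b & Pole & Bounded).
{ intros x. eapply pullback_upper; eauto. }
{ intros x. eapply pullback_boundary; eauto. }
assert (Coord := chart_point a c e R1 B ha hch D R2 rho HR Hrho Near g p hg pg g0).
assert (Rexp : forall d l, 0 < d -> Re l < ln d -> 0 < Cmod (cexp l) < d).
{ intros d l Hd Hl. rewrite Cmod_cexp. split; [apply exp_pos|].
  rewrite <- (exp_ln d Hd). now apply exp_increasing. }
assert (Icexp : forall l, 0 < Im l < PI -> 0 < Im (cexp l)).
{ intros l Hl. simpl. apply Rmult_lt_0_compat; [apply exp_pos|apply sin_gt_0; tauto]. }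
(* [W] is not bounded near 0, since it takes the values [- / z] *)
assert (Nb : b <> RtoC 0).
{ intros b0. destruct (Bounded b0) as (M & d & Hd & BM).
  destruct (Coord (- ln d)) as (d1 & Hd1 & Co).
  set (y := Rmin (d1 / 2) (/ (Rabs M + 1))). pose proof (Rabs_pos M).
  assert (Hy : 0 < y) by (apply Rmin_pos; [lra|apply Rinv_0_lt_compat; lra]).
  assert (Hy1 : y <= d1 / 2) by apply Rmin_l. assert (Hy2 : y <= / (Rabs M + 1)) by apply Rmin_r.
  set (z := (Ci * RtoC y)%C).
  assert (Mz : Cmod z = y) by (unfold z; rewrite Cmod_mult, Cmod_Ci, Cmod_R, Rabs_pos_eq; lra).
  assert (Iz : 0 < Im z) by (unfold z; rewrite im_scal_r; simpl; lra).
  destruct (Co z Iz ltac:(lra)) as (l & Rl & _ & Il & _ & El).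
  specialize (BM (cexp l) (Rexp d l Hd ltac:(lra)) (Icexp l Il)). unfold W in BM.
  rewrite El, Cmod_opp, Cmod_inv, Mz in BM by now apply upper_neq0.
  assert (Rabs M + 1 <= / y).
  { rewrite <- (Rinv_inv (Rabs M + 1)). apply Rinv_le_contravar; auto. }
  pose proof (Rle_abs M). lra. }
assert (Pb : 0 < Cmod b) by now apply Cmod_gt_0.
intros Q HQ. apply locally_C_eps in HQ. destruct HQ as (eta & He & HQ).
unfold filtermap, within. apply locally_C_eps.
destruct (Pole (Cmod b / 2)) as (d & Hd & Po); [lra|].
set (L := Rabs (ln (Cmod b)) + ln 2).
assert (HL : 0 < L) by (unfold L; pose proof (Rabs_pos (ln (Cmod b))); pose proof ln_lt_2; lra).
assert (HX : 0 < (L + PI + B) / eta) by (apply Rdiv_lt_0_compat; lra).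
destruct (Coord (Rmax (- ln d) ((L + PI + B) / eta + B + L))) as (d1 & Hd1 & Co).
exists d1. split; auto. intros z Hz Uz. rewrite Cminus_0_r in Hz.
apply HQ. destruct (Co z Uz Hz) as (l & Rl & Rl2 & Il & Eg & El). clear Co.
pose proof (Rmax_l (- ln d) ((L + PI + B) / eta + B + L)).
pose proof (Rmax_r (- ln d) ((L + PI + B) / eta + B + L)).
specialize (Po (cexp l) (Rexp d l Hd ltac:(lra)) (Icexp l Il)). unfold W in Po. rewrite El in Po.
pose proof (upper_neq0 z Uz) as Nz. assert (Pz : 0 < Cmod z) by now apply Cmod_gt_0.
(* [exp l / z] has modulus close to that of [b], so the logarithms differ by O(1) *)
assert (Ratio : Cmod b / 2 < exp (Re l) / Cmod z < 2 * Cmod b).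
{ pose proof (Cmod_annulus (cexp l * - / z) b) as T.
  rewrite Cmod_mult, Cmod_opp, Cmod_inv, Cmod_cexp in T by auto. unfold Rdiv. lra. }
assert (Log : Rabs (ln (Cmod z) - Re l) <= L).
{ assert (E : ln (exp (Re l) / Cmod z) = Re l - ln (Cmod z)) by (rewrite ln_div, ln_exp; auto using exp_pos).
  assert (A1 : ln (Cmod b / 2) < Re l - ln (Cmod z)) by (rewrite <- E; apply ln_increasing; lra).
  assert (A2 : Re l - ln (Cmod z) < ln (2 * Cmod b)) by (rewrite <- E; apply ln_increasing; lra).
  rewrite ln_div in A1 by lra. rewrite ln_mult in A2 by lra. unfold L.
  pose proof (Rle_abs (ln (Cmod b))). pose proof (Rle_abs (- ln (Cmod b))) as A3. rewrite Rabs_Ropp in A3.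
  apply Rabs_le. lra. }
rewrite Eg. apply (quotient_estimate a c e R1 B l (ln (Cmod z)) L); auto; try lra.
apply Rabs_le_between in Log. lra.
Qed.
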